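(* Let $f$ be an analytic function in $\mathbb{D}$ such that it admits a generalized proximate order $\lambda$, and either $1<\lambda_M(f)<\sigma_M(f)<\infty$ or $0\le\lambda_M(f)<\sigma_M(f)\le1$. Let $1\le p<\infty$ and $\varepsilon>0$. Then $$m_p(r,\log|f|)\lesssim\frac{1}{(1-r)^{\lambda(r)\left(1-\frac1{\sigma_M(f)}\right)^++1+\varepsilon}},\qquad r\to1^-.$$ In particular, if $\eta\in(0,\sigma_M(f)-\lambda_M(f))$, then $$m_p(r,\log|f|)\lesssim\frac{1}{(1-r)^{\left(\lambda_M(f)+\eta\right)\left(1-\frac1{\sigma_M(f)}\right)^++1+\varepsilon}},\qquad r\in E,$$ where $E=E_{\varepsilon,\eta}\subset[0,1)$ is of upper density one.
   Context: $\mathbb{D}=\{z\in\mathbb{C}:|z|<1\}$, $x^+=\max\{x,0\}$, $\log^+x=\max\{\log x,0\}$ (with $\log^+0=0$), and $M(r,f)=\max\{|f(z)|:|z|=r\}$. For $f$ analytic in $\mathbb{D}$, the order and lower order are $$\sigma_M(f)=\limsup_{r\to1^-}\frac{\log^+\log^+M(r,f)}{\log\frac1{1-r}},\qquad \lambda_M(f)=\liminf_{r\to1^-}\frac{\log^+\log^+M(r,f)}{\log\frac1{1-r}},$$ and $$m_p(r,\log|f|)=\left(\frac1{2\pi}\int_0^{2\pi}\bigl|\log|f(re^{i\theta})|\bigr|^p\,d\theta\right)^{1/p},\qquad 0<r<1.$$ Let $f$ be analytic in $\mathbb{D}$ with $0\le\lambda_M(f)<\sigma_M(f)<\infty$ and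 let $\kappa\in(0,\sigma_M(f)-\lambda_M(f))$. A function $\lambda:[0,1)\to(0,\infty)$ is called a quasi proximate order of $f$, related to $\kappa$, if there is an associated function $A^*$ on $[0,1)$ such that (1) $\lambda\in C^1[0,1)$; (2) $\limsup_{r\to1^-}\lambda(r)=\sigma_M(f)$; (3) $\liminf_{r\to1^-}\lambda(r)=\lambda_M(f)+\kappa$; (4) $\limsup_{r\to1^-}|\lambda'(r)|(1-r)\log\frac1{1-r}<\infty$; (5) $A^*(r)\le\frac1{(1-r)^{\lambda(r)}}\le(1+o(1))A^*(r)$ as $r\to1^-$; (6) $A^*$ is nondecreasing and $A^*\left(\frac{1+r}2\right)\lesssim A^*(r)$ for all $0\le r<1$; (7) $\log M(r,f)\le\frac1{(1-r)^{\lambda(r)}}$ for all $0\le r<1$. If, further, (4') $\limsup_{r\to1^-}|\lambda'(r)|(1-r)\log\frac1{1-r}=0$, then $\lambda$ is called a generalized proximate order of $f$. The upper density of a measurable set $E\subset[0,1)$ is $\limsup_{r\to1^-}\frac{m(E\cap[r,1))}{1-r}$, where $m$ is Lebesgue measure. The notation $a\lesssim b$ means that $a\le Cb$ for some constant $C>0$ independent of $r$. *)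

(* Defs.v *)
From HB Require Import structures.
From mathcomp Require Import all_boot all_order all_algebra.
From mathcomp Require Export complex.
From mathcomp Require Import all_classical all_reals all_analysis.

Set Implicit Arguments.
Unset Strict Implicit.
Unset Printing Implicit Defensive.

Import Order.TTheory GRing.Theory Num.Theory.
Import numFieldNormedType.Exports.

Local Open Scope classical_set_scope.
Local Open Scope ring_scope.
Local Open Scope complex_scope.

(* The library declares the topology of a numeric field on the regular module
   [_^o] and on abstract numeric fields; it is transported to [R[i]]. *)
HB.instance Definition _ (R : rcfType) := NormedModule.copy R[i] R[i]^o.

(* [normc] is the modulus as a real number; the generic norm [`|z|] of [R[i]]
   is [(normc z)%:C]. *)
Notation normc := ComplexField.Normc.normc.

Section definitions.
Context {R : realType}.
Implicit Types (f : R[i] -> R[i]) (lam : R -> R) (kappa p r x : R).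

Definition unit_disc : set R[i] := [set z | normc z < 1].

Definition analytic_on (U : set R[i]) f : Prop :=
  forall z0, U z0 -> exists a : nat -> R[i],
    \forall z \near z0, series (fun n => a n * (z - z0) ^+ n) @ \oo --> f z.

Definition pospart x : R := Num.max x 0.

(* [ln x = 0] for [x <= 0], so that [logp 0 = 0]. *)
Definition logp x : R := pospart (ln x).

Definition circle_point r (t : R) : R[i] := (r * cos t) +i* (r * sin t).

Definition max_modulus r f : R :=
  sup [set normc (f z) | z in [set z : R[i] | normc z = r]].

Definition order_quotient f r : R :=
  logp (logp (max_modulus r f)) / ln (1 - r)^-1.

Definition sigmaM f : \bar R :=
  limf_esup (fun r => (order_quotient f r)%:E) 1^'-.

Definition lambdaM f : \bar R :=
  limf_einf (fun r => (order_quotient f r)%:E) 1^'-.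

(* [lne] is the extended logarithm, with [lne 0 = -oo]; the mean is therefore
   an extended real number. *)
Definition mean_log p r f : \bar R :=
  ((((2 * pi)^-1)%:E *
    \int[lebesgue_measure]_(t in `[0%R, (2 * pi)%R])
      `|lne (normc (f (circle_point r t)))%:E| `^ p) `^ p^-1)%E.

(* At the endpoint [0] the derivative is one-sided. *)
Definition C1_on_01 lam : Prop :=
  exists dlam : R -> R,
    {within `[0, 1[%classic, continuous dlam} /\
    forall r, 0 <= r < 1 ->
      (lam x - lam r) / (x - r) @[x --> within `[0, 1[%classic r^'] --> dlam r.

(* The fields are the conditions for [lam] to be a quasi proximate order of [f],
   related to [kappa], with associated function [A] (both functions are only
   considered on [0, 1)). *)
Record quasi_proximate_order_with f kappa lam (A : R -> R) : Prop := {
  qpo_orders : (0 <= lambdaM f /\ lambdaM f < sigmaM f /\ sigmaM f < +oo)%E ;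
  qpo_kappa : 0 < kappa /\ (kappa%:E < sigmaM f - lambdaM f)%E ;
  qpo_pos : forall r, 0 <= r < 1 -> 0 < lam r ;
  qpo_C1 : C1_on_01 lam ;
  qpo_limsup : limf_esup (fun r => (lam r)%:E) 1^'- = sigmaM f ;
  qpo_liminf : limf_einf (fun r => (lam r)%:E) 1^'- = (lambdaM f + kappa%:E)%E ;
  qpo_deriv :
    (limf_esup (fun r => (`|derive1 lam r| * (1 - r) * ln (1 - r)^-1)%:E) 1^'-
     < +oo)%E ;
  qpo_equiv : exists2 e : R -> R, e r @[r --> 1^'-] --> (0 : R) &
    \forall r \near 1^'-,
      A r <= ((1 - r) `^ lam r)^-1 <= (1 + e r) * A r ;
  qpo_ndecr : forall r s, 0 <= r -> r <= s -> s < 1 -> A r <= A s ;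
  qpo_doubling : exists2 C : R, 0 < C &
    forall r, 0 <= r < 1 -> A ((1 + r) / 2) <= C * A r ;
  qpo_majorant : forall r, 0 <= r < 1 ->
    (lne (max_modulus r f)%:E <= (((1 - r) `^ lam r)^-1)%:E)%E
}.

Definition quasi_proximate_order f kappa lam : Prop :=
  exists A : R -> R, quasi_proximate_order_with f kappa lam A.

Definition generalized_proximate_order f kappa lam : Prop :=
  quasi_proximate_order f kappa lam /\
  limf_esup (fun r => (`|derive1 lam r| * (1 - r) * ln (1 - r)^-1)%:E) 1^'- = 0%E.

Definition upper_density (E : set R) : \bar R :=
  limf_esup (fun r =>
    (lebesgue_measure (E `&` `[r, 1%R[%classic) * ((1 - r)^-1)%:E)%E) 1^'-.

End definitions.

(* Main.v *)
Require Import Defs.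
From HB Require Import structures.
From mathcomp Require Import all_boot all_order all_algebra.
From mathcomp Require Import complex.
From mathcomp Require Import all_classical all_reals all_analysis.
From mathcomp Require Import measurable_realfun ring lra.

Set Implicit Arguments.
Unset Strict Implicit.
Unset Printing Implicit Defensive.

Import Order.TTheory GRing.Theory Num.Theory.
Import numFieldNormedType.Exports.

Local Open Scope classical_set_scope.
Local Open Scope ring_scope.
Local Open Scope complex_scope.

(** Let [0 < e < eps], put [delta = 1 - r] and let [Q >= 1] be such that
    [log |f z| <= Q / (1 - |z|)^(1+e)] on a disc slightly larger than
    [|z| <= r].  Then, up to a constant factor, [log |f|] cannot stay below
    [- Q / delta^(1+eps)] anywhere near the circle [|z| = r], except on sets
    whose measure decays exponentially, and therefore
    [m_p(r, log |f|) <= C Q / delta^(1+eps)] for every [p]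
    (lemma [mean_log_growth]).  The growth of [f] enters only through [Q].

    The value of [Q] comes from an interpolation.  Near the boundary
    [log |f z| <= (1 - |z|)^-(sigma+e)], where [sigma] is the order; and
    [log |f z| <= U] on that larger disc, where [U] is about
    [(1 - r)^-lam(r)], because the function associated with the proximate
    order is monotone and doubling.  With [th = (1 - 1/sigma)^+] one has
    [sigma (1 - th) <= 1], so the weighted geometric mean of the two bounds is
    [U^th / (1 - |z|)^(1+e)], that is [Q = U^th].  For the second estimate
    [U] comes from a radius [rho] close to 1 at which [log M(rho)] is at most
    [(1 - rho)^-(lambda + eta/2)]: the same value serves, with exponent
    [lambda + eta], for all [r] with
    [(1 - rho)/c <= 1 - r <= (1 - rho)^tau] and a suitable [tau < 1].  Each of
    these intervals fills almost all of the part of [[0, 1[] to the right of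
    its left endpoint, so that their union has upper density one.

    For the lower bound on [log |f|] only the maximum principle is used, in
    two ways.

    - In a sector of opening slightly less than [pi] with vertex at a boundary
      point, the distance to the boundary is comparable to the distance [|w|]
      to the vertex.  Hence [C Q Re (w^-(1+e))] is a harmonic majorant of
      [log |f|] whose value at a fixed base point is [O(Q)].  If
      [log |f| <= -K] on the arc [|w| = delta], then a multiple of
      [K delta^g' Re (w^-g')], with [g' = 1 + eps], can be subtracted from the
      majorant, and comparison at the base point gives [K = O(Q / delta^g')]
      (lemma [sector_two_constants]).  So each such arc contains a point at
      which [f] is not too small.

    - Let [log |f| <= -L] on a set of measure [m] contained in an arc of the
      circle [|z| = r] of length [delta].  A normalised sum of Green functions
      of [|z| < rho] with poles at well-spaced points of this set is at most
      [log (C delta/m)] on small circles around the poles, and bounded below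
      at the point provided by the sector.  Comparison there yields
      [m <= C delta exp (- L / B)] with [B = C Q / delta^g']
      (lemmas [small_values_spread] and [arc_measure]).

    Summing the second estimate over the arcs and over [L = k B] gives the
    means of every order [p]. *)

(** * The modulus of a complex number *)

Section complex_modulus.
Context {R : realType}.
Implicit Types (x y z : R[i]).

Lemma normcD x y : normc (x + y) <= normc x + normc y.
Proof. exact: (@le_normcD R). Qed.

Lemma normcN x : normc (- x) = normc x.
Proof. exact: (@complex.normcN R). Qed.

Lemma normcB x y : normc (x - y) <= normc x + normc y.
Proof. by rewrite -(normcN y); exact: normcD. Qed.

Lemma normcBC x y : normc (x - y) = normc (y - x).
Proof. by rewrite -normcN opprB. Qed.

Lemma normc_ge0 x : 0 <= normc x.
Proof. by case: x => a b; rewrite sqrtr_ge0. Qed.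

Lemma normcM x y : normc (x * y) = normc x * normc y.
Proof. exact: Normc.normcM. Qed.

Lemma normcX x n : normc (x ^+ n) = normc x ^+ n.
Proof.
elim: n => [|n ih]; first by rewrite !expr0 Normc.normc1.
by rewrite !exprS normcM ih.
Qed.

Lemma normc_eq0 x : (normc x == 0) = (x == 0).
Proof.
apply/eqP/eqP => [/Normc.eq0_normc //|->]; exact: Normc.normc0.
Qed.

Lemma normc_gt0 x : (0 < normc x) = (x != 0).
Proof. by rewrite lt_def normc_ge0 andbT normc_eq0. Qed.

Lemma normc_real (a : R) : normc a%:C = `|a|.
Proof. by rewrite /= expr0n addr0 sqrtr_sqr. Qed.

Lemma normc_i : normc ('i : R[i]) = 1.
Proof. by rewrite /= expr0n add0r expr1n sqrtr1. Qed.

Lemma sqr_normcE x : normc x ^+ 2 = complex.Re x ^+ 2 + complex.Im x ^+ 2.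
Proof. by case: x => a b; rewrite sqr_sqrtr // addr_ge0 ?sqr_ge0. Qed.

Lemma normc_le_sum x : normc x <= `|complex.Re x| + `|complex.Im x|.
Proof.
rewrite -(@ler_pXn2r _ 2%N) ?nnegrE ?normc_ge0 ?addr_ge0 //.
rewrite sqr_normcE sqrrD !real_normK ?num_real //.
by rewrite -addrA (addrC (`|_| * _ *+ 2)) addrA lerDl mulrn_wge0 ?mulr_ge0.
Qed.

Lemma normc_ge_Re x : `|complex.Re x| <= normc x.
Proof.
rewrite -(@ler_pXn2r _ 2%N) ?nnegrE ?normc_ge0 //.
by rewrite sqr_normcE real_normK ?num_real // lerDl sqr_ge0.
Qed.

Lemma normc_ge_Im x : `|complex.Im x| <= normc x.
Proof.
rewrite -(@ler_pXn2r _ 2%N) ?nnegrE ?normc_ge0 //.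
by rewrite sqr_normcE real_normK ?num_real // lerDr sqr_ge0.
Qed.

Lemma ler_dist_normc x y : `|normc x - normc y| <= normc (x - y).
Proof.
rewrite ler_norml lerBrDr lerBlDr addrC; apply/andP; split.
- rewrite lerBlDl normcBC; apply: le_trans (normcD _ _); by rewrite addrNK.
- by apply: le_trans (normcD _ _); rewrite subrK.
Qed.

End complex_modulus.

(** * The maximum principle *)

Section maximum_principle.
Context {R : realType}.
Implicit Types (z w : R[i]) (h : R[i] -> R) (phi : R[i] -> R[i]) (r : R).

Definition cross_sum h z r : R :=
  h (z + r%:C) + h (z - r%:C) + h (z + r%:C * 'i) + h (z - r%:C * 'i).

Definition cross_prod phi z r : R[i] :=
  phi (z + r%:C) * phi (z - r%:C) *
  (phi (z + r%:C * 'i) * phi (z - r%:C * 'i)).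

(** Harmonicity at [z] in the weakest form that the maximum principle needs:
    the discrete Laplacian over a cross of radius [r] is [O(r^3)], hence
    negligible with respect to [r^2].  For an analytic [phi] the corresponding
    property is multiplicative and makes sense at the zeros of [phi] too. *)
Definition add_harmonic h z := exists C r0 : R, [/\ 0 <= C, 0 < r0 &
  forall r, 0 < r -> r < r0 -> `|cross_sum h z r - 4 * h z| <= C * r ^+ 3].

Definition mul_harmonic phi z := exists C r0 : R, [/\ 0 <= C, 0 < r0 &
  forall r, 0 < r -> r < r0 ->
    normc (cross_prod phi z r - phi z ^+ 4) <= C * r ^+ 3].

(** Extreme values are taken on [R * R], whose compact sets are at hand. *)
Definition cx (p : R * R) : R[i] := p.1 +i* p.2.

Definition ctn_in (K : set R[i]) h := forall z, K z -> forall e, 0 < e ->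
  exists2 d, 0 < d & forall w, K w -> normc (w - z) < d -> `|h w - h z| < e.

Lemma ctn_in_within K h : ctn_in K h ->
  {within [set p | K (cx p)], continuous (h \o cx)}.
Proof.
move=> ch; apply/subspace_continuousP => p Kp.
apply/cvgrPdist_lt => e e0.
have [d d0 dP] := ch _ Kp _ e0.
rewrite near_withinE.
have d2 : 0 < d / 2 by rewrite divr_gt0.
near=> q => Kq; rewrite distrC; apply: dP => //.
have [q1 q2] : ball p (d / 2) q by near: q; exact: nbhsx_ballx.
apply: le_lt_trans (normc_le_sum _) _; rewrite /=.
rewrite (distrC q.1) (distrC q.2) [ltRHS](splitr d).
by apply: ltrD.
Unshelve. all: end_near. Qed.


Definition open_at (U : set R[i]) z :=
  exists2 d, 0 < d & forall w, normc (w - z) < d -> U w.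

Lemma disc_compl_open (rho : R) z : ~ [set z | normc z <= rho] z ->
  open_at (~` [set z | normc z <= rho]) z.
Proof.
move=> /= /negP; rewrite -ltNge => zr.
exists (normc z - rho); first by rewrite subr_gt0.
move=> w wz /= wr; have := ler_dist_normc z w; rewrite normcBC ler_norml.
by move=> /andP[_]; clear -wz wr; lra.
Qed.

(** Heine-Borel, for a closed set described by its open complement. *)
Lemma compact_cx (K : set R[i]) (L : R) :
  (forall z, K z -> normc z <= L) -> (forall z, ~ K z -> open_at (~` K) z) ->
  compact [set p : R * R | K (cx p)].
Proof.
move=> bK cK.
apply: (@subclosed_compact _ _ (`[- L, L]%classic `*` `[- L, L]%classic)).
- rewrite -[X in closed X]setCK; apply: open_closedC.
  rewrite openE => p Kp; rewrite /interior.
  have [d d0 dP] := cK _ Kp.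
  have d2 : 0 < d / 2 by rewrite divr_gt0.
  apply/nbhs_ballP; exists (d / 2) => //= q [q1 q2]; apply: dP.
  apply: le_lt_trans (normc_le_sum _) _; rewrite /=.
  by rewrite (distrC q.1) (distrC q.2) [ltRHS](splitr d); apply: ltrD.
- by apply: compact_setX; exact: segment_compact.
- move=> p /= /bK pL; split; rewrite /= in_itv /= -ler_norml.
  + exact: le_trans (normc_ge_Re (cx p)) pL.
  + exact: le_trans (normc_ge_Im (cx p)) pL.
Qed.

(** The function [|z|^2] is strictly subharmonic; a small multiple of it makes
    the Laplacian of the perturbed function positive. *)
Lemma sqr_normc_cross z r :
  cross_sum (fun w => normc w ^+ 2) z r = 4 * normc z ^+ 2 + 4 * r ^+ 2.
Proof. by case: z => a b; rewrite /cross_sum !sqr_normcE /=; ring. Qed.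

Lemma ctn_in_sqr_normc K L : (forall z, K z -> normc z <= L) ->
  ctn_in K (fun z => normc z ^+ 2).
Proof.
move=> bK z Kz e e0.
have L0 : 0 <= L by apply: le_trans (bK _ Kz); exact: normc_ge0.
have L1 : 0 < 2 * L + 1 by lra.
exists (e / (2 * L + 1)); first by rewrite divr_gt0.
move=> w Kw wz; rewrite subr_sqr normrM.
have h1 : `|normc w - normc z| <= normc (w - z) by exact: ler_dist_normc.
have h2 : `|normc w + normc z| <= 2 * L.
  by rewrite ger0_norm ?addr_ge0 ?normc_ge0 // mulr_natl mulr2n lerD ?bK.
apply: le_lt_trans (ler_pM _ _ h1 h2) _ => //.
have := normc_ge0 (w - z); move: wz; rewrite ltr_pdivlMr //; nra.
Qed.


Lemma max_principle_pos (K B : set R[i]) phi h (m L : R) :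
  let U z := normc (phi z) * expR (h z) in
  (forall z, K z -> normc z <= L) -> (forall z, ~ K z -> open_at (~` K) z) ->
  ctn_in K U ->
  (forall z, K z -> ~ B z ->
     [/\ open_at K z, mul_harmonic phi z & add_harmonic h z]) ->
  (forall z, K z -> B z -> U z <= m) -> 0 < m -> forall z, K z -> U z <= m.
Proof.
move=> U bK cK cU iU bU m0 z1 Kz1; rewrite leNgt; apply/negP => mz1.
have L0 : 0 <= L by apply: le_trans (bK _ Kz1); exact: normc_ge0.
have Uz1 : 0 < U z1 by apply: lt_trans mz1.
pose eta := ln (U z1 / m) / (2 * (L ^+ 2 + 1)).
have q1 : 1 < U z1 / m by rewrite ltr_pdivlMr // mul1r.
have lq : 0 < ln (U z1 / m) by rewrite ln_gt0.
have LL : 0 < L ^+ 2 + 1 by rewrite ltr_wpDl ?sqr_ge0.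
have eta0 : 0 < eta by rewrite divr_gt0 // mulr_gt0.
have etaL : m * expR (eta * L ^+ 2) < U z1.
  rewrite mulrC -ltr_pdivlMr // -[ltRHS]lnK ?posrE ?divr_gt0 // ltr_expR.
  rewrite /eta -mulrA gtr_pMr // mulrC ltr_pdivrMr ?mulr_gt0 //.
  have := sqr_ge0 L; lra.
pose V z := U z * expR (eta * normc z ^+ 2).
have V1 z : K z -> U z <= V z.
  move=> Kz; rewrite /V ler_peMr //; first by rewrite mulr_ge0 ?normc_ge0 ?expR_ge0.
  by rewrite -expR0 ler_expR mulr_ge0 ?sqr_ge0 // ltW.
(* [eta] is so small that the maximum of the perturbed function [V] still
   exceeds its values on [B]; it is then attained off [B]. *)
have [[a b] /[!inE] Kp pmax] : exists2 p, p \in [set p | K (cx p)] &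
    forall q, q \in [set p | K (cx p)] -> (V \o cx) q <= (V \o cx) p.
  apply: compact_EVT_max.
  - by exists (complex.Re z1, complex.Im z1); case: (z1) Kz1.
  - exact: compact_cx bK cK.
  - move=> p; apply: (@continuousM R (subspace _) (U \o cx)
      (expR \o (fun p => eta * normc (cx p) ^+ 2)) p).
      exact: ctn_in_within.
    apply: (@continuous_comp (subspace _) R R); last exact: continuous_expR.
    apply: (@continuousM R (subspace _) (cst eta)); first exact: cst_continuous.
    exact: (ctn_in_within (ctn_in_sqr_normc bK)).
set z0 := cx (a, b) in Kp pmax.
have {}pmax z : K z -> V z <= V z0.
  by move=> Kz; have := pmax (complex.Re z, complex.Im z); rewrite inE /=;
    case: z Kz => u v Kz; apply.
have Vz0 : m * expR (eta * L ^+ 2) < V z0.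
  exact: lt_le_trans etaL (le_trans (V1 _ Kz1) (pmax _ Kz1)).
have nBz0 : ~ B z0.
  move=> Bz0; move: Vz0; apply/negP; rewrite -leNgt /V ler_pM ?expR_ge0 //.
  - by rewrite mulr_ge0 ?normc_ge0 ?expR_ge0.
  - exact: bU.
  - by rewrite ler_expR ler_pM2l // ler_pXn2r ?nnegrE ?normc_ge0 ?bK.
have V0 : 0 < V z0 by apply: lt_trans Vz0; rewrite mulr_gt0 ?expR_gt0.
have p0 : 0 < normc (phi z0).
  move: V0; rewrite /V /U normc_gt0; apply: contraTneq => ->.
  by rewrite Normc.normc0 !mul0r ltxx.
have [[d d0 dK] [C [r1 [C0 r10 Cp]]] [C' [r2 [C'0 r20 Ch]]]] := iU _ Kp nBz0.
(* The product of [V] over a cross is at most [V z0 ^ 4]. *)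
have cross_le r : 0 < r -> r < d -> normc (cross_prod phi z0 r) *
   expR (cross_sum h z0 r + eta * cross_sum (fun w => normc w ^+ 2) z0 r) <= V z0 ^+ 4.
  move=> r0 rd; have -> : normc (cross_prod phi z0 r) *
      expR (cross_sum h z0 r + eta * cross_sum (fun w => normc w ^+ 2) z0 r) =
      V (z0 + r%:C) * V (z0 - r%:C) * (V (z0 + r%:C * 'i) * V (z0 - r%:C * 'i)).
    by rewrite /cross_prod /cross_sum /V /U !normcM !mulrDr !expRD; ring.
  have V_ge0 w : 0 <= V w by rewrite !mulr_ge0 ?normc_ge0 ?expR_ge0.
  have VK w : normc (w - z0) <= r -> V w <= V z0.
    by move=> wz; apply: pmax; apply: dK; apply: le_lt_trans rd.
  rewrite (_ : 4 = 2 * 2)%N // exprM expr2 expr2.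
  have nr : normc r%:C <= r by rewrite normc_real gtr0_norm.
  have nri : normc (r%:C * 'i) <= r by rewrite normcM normc_i mulr1.
  have V2 u v : normc (u - z0) <= r -> normc (v - z0) <= r ->
    0 <= V u * V v <= V z0 * V z0.
    by move=> ur vr; rewrite mulr_ge0 ?V_ge0 // ler_pM ?V_ge0 ?VK.
  have /andP[a1 a2] := V2 (z0 + r%:C) (z0 - r%:C) ltac:(by rewrite addrC addKr)
    ltac:(by rewrite addrC addKr normcN).
  have /andP[b1 b2] := V2 (z0 + r%:C * 'i) (z0 - r%:C * 'i)
    ltac:(by rewrite addrC addKr) ltac:(by rewrite addrC addKr normcN).
  exact: ler_pM.
set P := normc (phi z0) in p0.
(* For small [r] the gain [4 eta r^2] beats all the errors, of order [r^3]. *)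
pose c := C / P ^+ 4.
have P4 : 0 < P ^+ 4 by rewrite exprn_gt0.
have c0 : 0 <= c by rewrite divr_ge0 // ltW.
have cP : C = c * P ^+ 4 by rewrite /c divfK // gt_eqF.
pose q := C' + c + 4 * eta * c.
have ec0 : 0 <= eta * c by rewrite mulr_ge0 // ltW.
have q0 : 0 <= q by rewrite /q; lra.
have [r [r0 rd [rr1 rr2 r1' rq]]] : exists r, [/\ 0 < r, r < d &
   [/\ r < r1, r < r2, r < 1 & q * r < 4 * eta]].
  exists (Num.min d (Num.min r1 (Num.min r2 (Num.min 1 (4 * eta / (q + 1))))) / 2).
  set mm := Num.min d _; set m1 := 4 * eta / (q + 1).
  have q1' : 0 < q + 1 by lra.
  have m1_gt0 : 0 < m1 by rewrite divr_gt0 // mulr_gt0.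
  have mm0 : 0 < mm by rewrite !lt_min d0 r10 r20 ltr01 m1_gt0.
  have mm1 : mm / 2 < mm by rewrite ltr_pdivrMr // ltr_pMr // ltr1n.
  have : mm <= mm by []; rewrite {2}/mm !le_min => /and5P[i1 i2 i3 i4 i5].
  split; [by rewrite divr_gt0|lra|split; try lra].
  have : mm * (q + 1) <= 4 * eta by rewrite -ler_pdivlMr.
  have : 0 <= mm * q by rewrite mulr_ge0 // ltW.
  nra.
have := cross_le _ r0 rd; rewrite sqr_normc_cross.
have e1 := Cp _ r0 rr1; have := Ch _ r0 rr2.
rewrite ler_norml => /andP[e2 _].
have e1' : P ^+ 4 * (1 - c * r ^+ 3) <= normc (cross_prod phi z0 r).
  have h1 := ler_dist_normc (cross_prod phi z0 r) (phi z0 ^+ 4).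
  have := le_trans h1 e1; rewrite normcX -/P ler_norml cP => /andP[+ _].
  lra.
set S := cross_sum h z0 r in e2 *.
have -> : V z0 ^+ 4 = P ^+ 4 * expR (4 * (h z0 + eta * normc z0 ^+ 2)).
  by rewrite /V /U exprMn exprMn -mulrA -expRM_natl -expRM_natl -expRD mulrDr.
apply/negP; rewrite -ltNge.
have cr : c * r < 1.
  have : 4 * eta * (c * r) < 4 * eta * 1.
    rewrite mulr1; apply: le_lt_trans rq; rewrite mulrA ler_wpM2r ?(ltW r0) //.
    by rewrite /q; lra.
  by rewrite ltr_pM2l // mulr_gt0.
have r2' : r ^+ 2 <= 1 by rewrite expr_le1 // ltW.
have cr3 : c * r ^+ 3 < 1.
  apply: le_lt_trans cr; rewrite ler_wpM2l // exprS ler_piMr // ltW //.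
set D := 4 * eta * r ^+ 2 - C' * r ^+ 3.
have step : P ^+ 4 * (1 - c * r ^+ 3) * expR (4 * (h z0 + eta * normc z0 ^+ 2) + D)
   <= normc (cross_prod phi z0 r) * expR (S + eta * (4 * normc z0 ^+ 2 + 4 * r ^+ 2)).
  have D1 : expR (4 * (h z0 + eta * normc z0 ^+ 2) + D) <=
            expR (S + eta * (4 * normc z0 ^+ 2 + 4 * r ^+ 2)).
    by rewrite ler_expR /D; lra.
  have lhs0 : 0 <= P ^+ 4 * (1 - c * r ^+ 3).
    by apply: mulr_ge0; [exact: ltW|rewrite subr_ge0 ltW].
  exact: (ler_pM lhs0 (expR_ge0 _) e1' D1).
apply: lt_le_trans step; rewrite expRD; set E0 := expR (4 * _).
rewrite (_ : _ * (E0 * _) = P ^+ 4 * E0 * ((1 - c * r ^+ 3) * expR D));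
  last by ring.
rewrite ltr_pMr ?mulr_gt0 ?expR_gt0 //.
have : (1 - c * r ^+ 3) * (1 + D) <= (1 - c * r ^+ 3) * expR D.
  by rewrite ler_pM2l ?subr_gt0 // expR_ge1Dx.
apply: lt_le_trans.
have -> : (1 - c * r ^+ 3) * (1 + D) = 1 + r ^+ 2 *
   (4 * eta - (C' + c + 4 * eta * c * r ^+ 2) * r + c * C' * (r ^+ 2 * r ^+ 2)).
  by rewrite /D; ring.
rewrite ltrDl pmulr_rgt0 ?exprn_gt0 //.
apply: ltr_wpDr; first by apply: mulr_ge0; apply: mulr_ge0 => //; exact: sqr_ge0.
rewrite subr_gt0; apply: le_lt_trans rq; rewrite ler_wpM2r ?(ltW r0) //.
by rewrite /q lerD2l ler_piMr // -mulrA; lra.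
Qed.

(** The maximum principle for [|phi| exp h], stated for the product because
    [log |phi|] is infinite at the zeros of [phi].  The set [B] contains the
    boundary of [K]. *)
Lemma max_principle (K B : set R[i]) phi h (m L : R) :
  let U z := normc (phi z) * expR (h z) in
  (forall z, K z -> normc z <= L) -> (forall z, ~ K z -> open_at (~` K) z) ->
  ctn_in K U ->
  (forall z, K z -> ~ B z ->
     [/\ open_at K z, mul_harmonic phi z & add_harmonic h z]) ->
  (forall z, K z -> B z -> U z <= m) -> 0 <= m -> forall z, K z -> U z <= m.
Proof.
move=> U bK cK cU iU bU m0 z Kz; apply/ler_addgt0Pr => e e0.
apply: (max_principle_pos bK cK cU iU _ _ Kz) => [w Kw Bw|].
  by rewrite (le_trans (bU _ Kw Bw)) // lerDl ltW.
by rewrite ltr_wpDl.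
Qed.

End maximum_principle.

(** * Second order expansions and discrete harmonicity *)

Section second_order_expansions.
Context {R : realType}.
Implicit Types (z u : R[i]) (h : R[i] -> R) (phi f : R[i] -> R[i]) (r t : R).

(** All that is used of analyticity: a second order expansion with a cubic
    error at every point.  The second definition asks for it only along the
    four directions [1, -1, 'i, - 'i], which are the fourth roots of unity;
    this is enough for the crosses and easy to check for the exponential. *)
Definition taylor2 f z := exists (b c : R[i]) (C r0 : R), [/\ 0 <= C, 0 < r0 &
  forall x, normc x < r0 ->
    normc (f (z + x) - (f z + b * x + c * x ^+ 2)) <= C * normc x ^+ 3].

Definition cross_taylor2 phi z := exists (b c : R[i]) (C r0 : R),
  [/\ 0 <= C, 0 < r0 & forall r u, 0 < r -> r < r0 -> u ^+ 4 = 1 ->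
    normc (phi (z + r%:C * u) -
           (phi z + b * (r%:C * u) + c * (r%:C * u) ^+ 2)) <= C * r ^+ 3].

Lemma normc_root4 u : u ^+ 4 = 1 -> normc u = 1.
Proof.
move=> u4; have : normc u ^+ 4 = 1 by rewrite -normcX u4 Normc.normc1.
by move/eqP; rewrite pexpr_eq1 ?normc_ge0 // => /eqP.
Qed.

Lemma root4E u : u ^+ 4 = 1 -> [\/ u = 1, u = -1, u = 'i | u = - 'i].
Proof.
move=> u4; have i2 : ('i : R[i]) ^+ 2 = -1 by exact: sqr_i.
have : (u - 1) * ((u + 1) * ((u - 'i) * (u + 'i))) = 0.
  have -> : (u - 1) * ((u + 1) * ((u - 'i) * (u + 'i))) =
     u ^+ 4 - 1 - (u ^+ 2 - 1) * ('i ^+ 2 + 1) by ring.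
  by rewrite u4 i2 addNr mulr0 !subrr.
move/eqP; rewrite !mulf_eq0 !subr_eq0 !addr_eq0 => /or4P[] /eqP ->.
- by apply: Or41. - by apply: Or42. - by apply: Or43. - by apply: Or44.
Qed.

Lemma crossE phi z r : cross_prod phi z r =
  phi (z + r%:C * 1) * phi (z + r%:C * -1) *
  (phi (z + r%:C * 'i) * phi (z + r%:C * - 'i)).
Proof. by rewrite /cross_prod mulr1 !mulrN mulr1. Qed.

Let i4 : ('i : R[i]) ^+ 4 = 1.
Proof. by rewrite (exprM _ 2 2) sqr_i sqrrN expr1n. Qed.
Let n4 : (-1 : R[i]) ^+ 4 = 1.
Proof. by rewrite (exprM _ 2 2) sqrrN !expr1n. Qed.
Let ni4 : (- 'i : R[i]) ^+ 4 = 1.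
Proof. by rewrite (exprM _ 2 2) sqrrN sqr_i sqrrN expr1n. Qed.

Lemma taylor2_cross f z : taylor2 f z -> cross_taylor2 f z.
Proof.
move=> [b [c [C [r0 [C0 r00 fP]]]]]; exists b, c, C, r0; split => // r u r1 r2 u4.
have nr : normc (r%:C * u) = r.
  by rewrite normcM (normc_root4 u4) mulr1 normc_real gtr0_norm.
by have := fP (r%:C * u); rewrite nr; apply.
Qed.

Lemma taylor2_affine (a b z : R[i]) : taylor2 (fun z => a + b * z) z.
Proof.
exists b, 0, 0, 1; split => // x _.
rewrite mul0r addr0 mul0r (_ : _ - _ = 0) ?Normc.normc0 //; ring.
Qed.

Lemma cross_taylor2_affine (a b z : R[i]) : cross_taylor2 (fun z => a + b * z) z.
Proof. exact/taylor2_cross/taylor2_affine. Qed.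

(** The linear and the quadratic terms cancel over a cross, since the sums of
    the fourth roots of unity and of their squares vanish. *)
Lemma cross_taylor2_Re phi z : cross_taylor2 phi z ->
  add_harmonic (fun z => complex.Re (phi z)) z.
Proof.
move=> [b [c [C [r0 [C0 r00 fP]]]]]; exists (4 * C), r0; split => // [|r r1 r2].
  by rewrite mulr_ge0.
have := fP r 1 r1 r2 (expr1n _ _); have := fP r _ r1 r2 i4.
have := fP r _ r1 r2 ni4; have := fP r _ r1 r2 n4.
rewrite /cross_sum !mulrN !mulr1.
set w1 := _ - _ => h1; set w2 := _ - _ => h2; set w3 := _ - _ => h3.
set w4 := _ - _ => h4.
have -> : complex.Re (phi (z + r%:C)) + complex.Re (phi (z - r%:C)) +
  complex.Re (phi (z + r%:C * 'i)) + complex.Re (phi (z - r%:C * 'i)) -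
  4 * complex.Re (phi z) = complex.Re (w1 + w2 + w3 + w4).
  have -> : w1 + w2 + w3 + w4 = phi (z + r%:C) + phi (z - r%:C) +
    phi (z + r%:C * 'i) + phi (z - r%:C * 'i) - (phi z + phi z + phi z + phi z)
    - 2 * c * r%:C ^+ 2 * ('i ^+ 2 + 1).
    rewrite /w1 /w2 /w3 /w4; ring.
  rewrite sqr_i addNr mulr0 subr0.
  by rewrite !(raddfD, raddfN) /=; ring.
apply: le_trans (normc_ge_Re _) _.
apply: le_trans (normcD _ _) _; have := normcD (w1 + w2) w3.
have := normcD w1 w2; lra.
Qed.

Lemma prod_dist (x1 y1 x2 y2 : R[i]) (M e : R) :
  normc x1 <= M -> normc y1 <= M -> normc x2 <= M -> normc y2 <= M ->
  normc (x1 - y1) <= e -> normc (x2 - y2) <= e ->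
  normc (x1 * x2 - y1 * y2) <= 2 * M * e /\
  (normc (x1 * x2) <= M ^+ 2 /\ normc (y1 * y2) <= M ^+ 2).
Proof.
move=> a1 b1 a2 b2 d1 d2; split.
  have -> : x1 * x2 - y1 * y2 = (x1 - y1) * x2 + y1 * (x2 - y2) by ring.
  apply: le_trans (normcD _ _) _; rewrite !normcM -mulrA mulr_natl mulr2n.
  apply: lerD; last by rewrite ler_pM ?normc_ge0.
  by rewrite (mulrC M) ler_pM ?normc_ge0.
by rewrite !normcM expr2 !ler_pM ?normc_ge0.
Qed.

(** The product of a quadratic polynomial over a cross has no terms of degree
    one, two or three. *)
Lemma cross_quadratic (A b c x i : R[i]) : i ^+ 2 = -1 ->
  (A + b * (x * 1) + c * (x * 1) ^+ 2) *
  (A + b * (x * -1) + c * (x * -1) ^+ 2) *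
  ((A + b * (x * i) + c * (x * i) ^+ 2) *
   (A + b * (x * - i) + c * (x * - i) ^+ 2)) - A ^+ 4 =
  (2 * A ^+ 2 * c ^+ 2 - (2 * A * c - b ^+ 2) ^+ 2) * x ^+ 4 +
  c ^+ 4 * (x ^+ 4 * x ^+ 4).
Proof.
move=> i2.
have -> : (A + b * (x * i) + c * (x * i) ^+ 2) *
   (A + b * (x * - i) + c * (x * - i) ^+ 2) =
   (A + c * x ^+ 2 * i ^+ 2) ^+ 2 - b ^+ 2 * x ^+ 2 * i ^+ 2 by ring.
by rewrite i2; ring.
Qed.

Lemma cross_taylor2_mul phi z : cross_taylor2 phi z -> mul_harmonic phi z.
Proof.
move=> [b [c [C [r0 [C0 r00 fP]]]]].
set A := phi z; pose Q := normc A + normc b + normc c + C.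
have Q0 : 0 <= Q by rewrite !addr_ge0 ?normc_ge0.
pose p r u := A + b * (r%:C * u) + c * (r%:C * u) ^+ 2.
have pQ r u : 0 < r -> r < 1 -> u ^+ 4 = 1 -> normc (p r u) <= Q.
  move=> r1 r2 u4; rewrite /p; apply: le_trans (normcD _ _) _.
  have := normcD A (b * (r%:C * u)).
  rewrite !normcM !normc_real gtr0_norm // (normc_root4 u4) !mulr1.
  have := normc_ge0 b; have := normc_ge0 c; have : r * r <= 1 by nra.
  rewrite /Q; nra.
have fQ r u : 0 < r -> r < r0 -> r < 1 -> u ^+ 4 = 1 -> normc (phi (z + r%:C * u)) <= Q + C.
  move=> r1 r2 r3 u4; have := fP _ _ r1 r2 u4; have := pQ _ _ r1 r3 u4.
  rewrite -/(p r u) => h1 h2.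
  rewrite -(subrK (p r u) (phi _)); apply: le_trans (normcD _ _) _.
  have : C * r ^+ 3 <= C by rewrite ler_piMr // expr_le1 // ltW.
  lra.
pose D := normc (2 * A ^+ 2 * c ^+ 2 - (2 * A * c - b ^+ 2) ^+ 2) + normc (c ^+ 4).
exists (4 * C * (Q + C) ^+ 3 + D), (Num.min r0 1).
have D0 : 0 <= D by rewrite addr_ge0 ?normc_ge0.
split; first by apply: addr_ge0 => //; apply: mulr_ge0; [lra|apply: exprn_ge0; lra].
  by rewrite lt_min r00 ltr01.
move=> r r1; rewrite lt_min => /andP[r2 r3].
rewrite crossE.
set w1 := phi _; set w2 := phi _; set w3 := phi _; set w4 := phi _.
have e1 := fP r 1 r1 r2 (expr1n _ _); have e3 := fP r _ r1 r2 i4.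
have e4 := fP r _ r1 r2 ni4; have e2 := fP r _ r1 r2 n4.
rewrite -/w1 -/(p r 1) in e1; rewrite -/w2 -/(p r (-1)) in e2.
rewrite -/w3 -/(p r 'i) in e3; rewrite -/w4 -/(p r (-'i)) in e4.
have q1 := pQ _ _ r1 r3 (expr1n _ 4); have q2 := pQ _ _ r1 r3 n4.
have q3 := pQ _ _ r1 r3 i4; have q4 := pQ _ _ r1 r3 ni4.
have f1 := fQ _ _ r1 r2 r3 (expr1n _ 4); have f2 := fQ _ _ r1 r2 r3 n4.
have f3 := fQ _ _ r1 r2 r3 i4; have f4 := fQ _ _ r1 r2 r3 ni4.
rewrite -/w1 in f1; rewrite -/w2 in f2; rewrite -/w3 in f3; rewrite -/w4 in f4.
rewrite -(subrK (p r 1 * p r (-1) * (p r 'i * p r (- 'i))) (w1 * w2 * _)) -addrA.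
have -> : p r 1 * p r (-1) * (p r 'i * p r (- 'i)) - A ^+ 4 =
  (2 * A ^+ 2 * c ^+ 2 - (2 * A * c - b ^+ 2) ^+ 2) * r%:C ^+ 4 +
  c ^+ 4 * (r%:C ^+ 4 * r%:C ^+ 4).
  exact: (cross_quadratic _ _ _ _ (sqr_i R)).
have QC : Q <= Q + C by rewrite lerDl.
have r3' : 0 < r ^+ 3 by rewrite exprn_gt0.
have r4 : r ^+ 4 <= r ^+ 3 by rewrite exprS ler_piMl // ltW.
have r40 : 0 <= r ^+ 4 by rewrite exprn_ge0 // ltW.
have r41 : r ^+ 4 <= 1 by rewrite expr_le1 // ltW.
have [d1 m1] := prod_dist f1 (le_trans q1 QC) f2 (le_trans q2 QC) e1 e2.
have [d2 m2] := prod_dist f3 (le_trans q3 QC) f4 (le_trans q4 QC) e3 e4.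
have [d3 _] := prod_dist m1.1 m1.2 m2.1 m2.2 d1 d2.
have n4r : normc (r%:C ^+ 4) = r ^+ 4.
  by rewrite normcX normc_real gtr0_norm.
apply: le_trans (normcD _ _) _; rewrite [leRHS]mulrDl; apply: lerD.
  by apply: le_trans d3 _; rewrite le_eqVlt; apply/orP; left; apply/eqP; ring.
apply: le_trans (normcD _ _) _; rewrite normcM (normcM (c ^+ 4)) (normcM (r%:C ^+ 4)) n4r /D [leRHS]mulrDl.
apply: lerD; first by rewrite ler_wpM2l ?normc_ge0.
rewrite ler_wpM2l ?normc_ge0 //; apply: le_trans r4.
by rewrite ler_piMr.
Qed.


Lemma cross_taylor2_comp f phi z :
  taylor2 f (phi z) -> cross_taylor2 phi z -> cross_taylor2 (f \o phi) z.
Proof.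
move=> [b [c [C [r0 [C0 r00 fP]]]]] [b' [c' [C' [r1 [C'0 r10 pP]]]]].
pose Q := normc b' + normc c' + C'.
have Q0 : 0 <= Q by rewrite !addr_ge0 ?normc_ge0.
exists (b * b'), (b * c' + c * b' ^+ 2).
pose D := C * Q ^+ 3 + normc b * C' + normc c * (normc (2 * b' * c') + normc (c' ^+ 2) + 2 * Q * C').
exists D, (Num.min r1 (Num.min 1 (r0 / (Q + 1)))).
have Q1 : 0 < Q + 1 by lra.
split.
- rewrite /D; have := normc_ge0 b; have := normc_ge0 c.
  have := normc_ge0 (2 * b' * c'); have := normc_ge0 (c' ^+ 2).
  have : 0 <= Q ^+ 3 by rewrite exprn_ge0.
  move=> a1 a2 a3 a4 a5; have := mulr_ge0 C0 a1; have := mulr_ge0 a5 C'0.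
  have : 0 <= normc (2 * b' * c') + normc (c' ^+ 2) + 2 * Q * C'.
    by have := mulr_ge0 Q0 C'0; lra.
  by move=> /(mulr_ge0 a4); lra.
- by rewrite !lt_min r10 ltr01 divr_gt0.
move=> r u rp; rewrite !lt_min => /and3P[rr1 rr2 rr3] u4.
rewrite ltr_pdivlMr // in rr3.
have nx : normc (r%:C * u) = r.
  by rewrite normcM (normc_root4 u4) mulr1 normc_real gtr0_norm.
set x := r%:C * u in nx *.
have := pP _ _ rp rr1 u4; rewrite -/x.
set w := phi (z + x) - phi z.
have -> : phi (z + x) - (phi z + b' * x + c' * x ^+ 2) =
  w - (b' * x + c' * x ^+ 2) by rewrite /w; ring.
set p := b' * x + c' * x ^+ 2 => wp.
have r2 : r ^+ 2 <= r by rewrite expr2 ler_piMl // ltW.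
have r3 : r ^+ 3 <= r by rewrite exprS ler_piMr ?ltW // (le_lt_trans r2).
have r30 : 0 <= r ^+ 3 by rewrite exprn_ge0 // ltW.
have n2 : normc (x ^+ 2) = r ^+ 2 by rewrite normcX nx.
have pn : normc p <= (normc b' + normc c') * r.
  apply: le_trans (normcD _ _) _; rewrite (normcM b') (normcM c') nx n2 mulrDl.
  by rewrite lerD2l ler_wpM2l ?normc_ge0.
have wn : normc w <= Q * r.
  rewrite -(subrK p w); apply: le_trans (normcD _ _) _.
  have : C' * r ^+ 3 <= C' * r by rewrite ler_wpM2l.
  rewrite /Q; lra.
have wr0 : normc w < r0 by nra.
have wz : phi z + w = phi (z + x) by rewrite /w addrC subrK.
have := fP _ wr0; rewrite wz => fw.
have -> : (f \o phi) (z + x) - ((f \o phi) z + b * b' * x + (b * c' + c * b' ^+ 2) * x ^+ 2)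
  = (f (phi (z + x)) - (f (phi z) + b * w + c * w ^+ 2)) + b * (w - p) +
    c * ((w - p) * (w + p) + (2 * b' * c' * (x ^+ 2 * x) + c' ^+ 2 * (x ^+ 2 * x ^+ 2))).
  by rewrite /p /=; ring.
apply: le_trans (normcD _ _) _; rewrite /D [leRHS]mulrDl [X in _ <= X + _]mulrDl; apply: lerD; first apply: le_trans (normcD _ _) _; first apply: lerD.
- apply: le_trans fw _; rewrite -mulrA ler_wpM2l // -exprMn.
  by rewrite ler_pXn2r ?nnegrE ?normc_ge0 // mulr_ge0 // ltW.
- by rewrite normcM -mulrA ler_wpM2l ?normc_ge0.
rewrite normcM -[leRHS]mulrA ler_wpM2l ?normc_ge0 //.
apply: le_trans (normcD _ _) _; rewrite [leLHS]addrC [leRHS]mulrDl; apply: lerD.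
  apply: le_trans (normcD _ _) _; rewrite (normcM (2 * b' * c')) (normcM (c' ^+ 2)).
  rewrite (normcM (x ^+ 2) x) (normcM (x ^+ 2) (x ^+ 2)) n2 nx [leRHS]mulrDl.
  rewrite -exprSr -exprD; apply: lerD => //; rewrite ler_wpM2l ?normc_ge0 //.
  by rewrite [leLHS]exprS ler_piMl // ltW.
have wpn : normc (w + p) <= 2 * Q.
  apply: le_trans (normcD _ _) _.
  have : Q * r <= Q by rewrite ler_piMr // ltW.
  have : (normc b' + normc c') * r <= normc b' + normc c'.
    by rewrite ler_piMr ?addr_ge0 ?normc_ge0 // ltW.
  have : normc b' + normc c' <= Q by rewrite /Q lerDl.
  lra.
by rewrite normcM mulrC -[leRHS]mulrA; apply: ler_pM; rewrite ?normc_ge0.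
Qed.

(** Away from the zeros of [phi], the logarithm of [|phi|] is harmonic: take
    logarithms of the product over a cross. *)
Lemma add_harmonic_lnnorm phi z : mul_harmonic phi z -> phi z != 0 ->
  add_harmonic (fun z => ln (normc (phi z))) z.
Proof.
move=> [C [r0 [C0 r00 fP]]] pz; rewrite -normc_gt0 in pz.
set A := normc (phi z) in pz.
have A4 : 0 < A ^+ 4 by rewrite exprn_gt0.
exists (2 * (C / A ^+ 4)), (Num.min r0 (Num.min 1 (A ^+ 4 / (2 * C + 1)))).
split; first by rewrite mulr_ge0 // divr_ge0 // ltW.
  by rewrite !lt_min r00 ltr01 divr_gt0 //; lra.
move=> r rp; rewrite !lt_min => /and3P[rr0 rr1 rr2].
rewrite ltr_pdivlMr in rr2; last by lra.
have h1 := fP _ rp rr0.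
have := le_trans (ler_dist_normc _ _) h1; rewrite normcX -/A.
set P := normc (cross_prod phi z r) => h2.
have Cr : C * r ^+ 3 <= A ^+ 4 / 2.
  have : r ^+ 3 <= r by rewrite exprS ler_piMr ?ltW // exprn_ilt1 // ltW.
  have : 0 <= r ^+ 3 by rewrite exprn_ge0 // ltW.
  nra.
have P0 : 0 < P by move: h2; rewrite ler_norml => /andP[+ _]; lra.
have ls : cross_sum (fun z => ln (normc (phi z))) z r = ln P.
  move: P0; rewrite /P /cross_prod /cross_sum !normcM.
  set a1 := normc _; set a2 := normc _; set a3 := normc _; set a4 := normc _.
  have [a10 a20 a30 a40] : [/\ 0 <= a1, 0 <= a2, 0 <= a3 & 0 <= a4].
    by split; exact: normc_ge0.
  move=> P0; have a_neq0 : [/\ a1 != 0, a2 != 0, a3 != 0 & a4 != 0].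
    split; apply: contraTN P0 => /eqP ->; rewrite ?(mul0r, mulr0) ltxx //.
  case: a_neq0 => k1 k2 k3 k4.
  have {}a10 : 0 < a1 by rewrite lt_def k1.
  have {}a20 : 0 < a2 by rewrite lt_def k2.
  have {}a30 : 0 < a3 by rewrite lt_def k3.
  have {}a40 : 0 < a4 by rewrite lt_def k4.
  by rewrite !lnM ?posrE ?mulr_gt0 // !addrA.
rewrite ls (_ : 4 * ln A = ln (A ^+ 4)); last by rewrite lnXn // mulr_natl.
rewrite -ln_div ?posrE //.
have q : `|P / A ^+ 4 - 1| <= C / A ^+ 4 * r ^+ 3.
  rewrite -[X in _ - X](divff (lt0r_neq0 A4)) -mulrBl normrM (gtr0_norm (x := _^-1)) ?invr_gt0 //.
  by rewrite mulrAC ler_pM2r ?invr_gt0.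
have q2 : C / A ^+ 4 * r ^+ 3 <= 1 / 2.
  by rewrite mulrAC ler_pdivrMr // mulrC; lra.
set y := P / A ^+ 4 in q *; set e := C / A ^+ 4 * r ^+ 3 in q q2 *.
have y0 : 0 < y by rewrite divr_gt0.
have e0 : 0 <= e by rewrite mulr_ge0 ?divr_ge0 ?exprn_ge0 // ltW.
rewrite -mulrA -/e; move: q; rewrite !ler_norml => /andP[q3 q4].
apply/andP; split; last first.
  have := @le_ln1Dx _ (y - 1); rewrite (addrC 1) subrK => /(_ ltac:(lra)); lra.
have iy : 0 < y^-1 by rewrite invr_gt0.
have := @le_ln1Dx _ (y^-1 - 1); rewrite (addrC 1) subrK => /(_ ltac:(lra)).
rewrite lnV ?posrE // => h3.
have : y^-1 - 1 <= 2 * e.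
  rewrite lerBlDr -(ler_pM2r y0) mulVf ?gt_eqF //; nra.
lra.
Qed.

Lemma add_harmonicD h1 h2 z : add_harmonic h1 z -> add_harmonic h2 z ->
  add_harmonic (fun z => h1 z + h2 z) z.
Proof.
move=> [C1 [r1 [C10 r10 H1]]] [C2 [r2 [C20 r20 H2]]].
exists (C1 + C2), (Num.min r1 r2); split; [by rewrite addr_ge0|by rewrite lt_min r10|].
move=> r r0; rewrite lt_min => /andP[/(H1 _ r0) {}H1 /(H2 _ r0) {}H2].
have -> : cross_sum (fun z => h1 z + h2 z) z r - 4 * (h1 z + h2 z) =
  (cross_sum h1 z r - 4 * h1 z) + (cross_sum h2 z r - 4 * h2 z).
  by rewrite /cross_sum; ring.
by apply: le_trans (ler_normD _ _) _; rewrite [leRHS]mulrDl lerD.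
Qed.

Lemma add_harmonicZ (a : R) h z : add_harmonic h z ->
  add_harmonic (fun z => a * h z) z.
Proof.
move=> [C [r1 [C0 r10 H]]].
exists (`|a| * C), r1; split => // [|r r0 /(H _ r0) {}H]; first by rewrite mulr_ge0.
have -> : cross_sum (fun z => a * h z) z r - 4 * (a * h z) =
  a * (cross_sum h z r - 4 * h z) by rewrite /cross_sum; ring.
by rewrite normrM -mulrA ler_wpM2l.
Qed.

Lemma add_harmonic_cst (a : R) z : add_harmonic (fun=> a) z.
Proof.
exists 0, 1; split => // r _ _; rewrite (_ : _ - _ = 0) ?normr0 ?mul0r //.
by rewrite /cross_sum; ring.
Qed.

Lemma add_harmonic_sum (n : nat) (F : nat -> R[i] -> R) z :
  (forall i, (i < n)%N -> add_harmonic (F i) z) ->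
  add_harmonic (fun z => \sum_(i < n) F i z) z.
Proof.
elim: n => [_|n ih FP].
  by under eq_fun do rewrite big_ord0; exact: add_harmonic_cst.
under eq_fun do rewrite big_ord_recr /=.
apply: add_harmonicD; last exact: FP.
by apply: ih => i /ltnW; exact: FP.
Qed.

End second_order_expansions.

(** * The complex exponential *)

Section complex_exponential.
Context {R : realType}.
Implicit Types (z w u : R[i]) (s t x : R).

Definition cexp z : R[i] :=
  (expR (complex.Re z) * cos (complex.Im z)) +i*
  (expR (complex.Re z) * sin (complex.Im z)).

Lemma cexpD z w : cexp (z + w) = cexp z * cexp w.
Proof.
case: z w => a b [c d]; rewrite /cexp /= expRD cosD sinD.
by apply/eqP; rewrite eq_complex /=; apply/andP; split; apply/eqP; ring.
Qed.

Lemma normc_cexp z : normc (cexp z) = expR (complex.Re z).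
Proof.
apply/eqP; rewrite -(@eqrXn2 _ 2%N) ?normc_ge0 ?expR_ge0 // sqr_normcE /=.
by rewrite !exprMn -mulrDr cos2Dsin2 mulr1.
Qed.

(** One integration step of Taylor's formula; iterating it gives the expansions
    of the sine, the cosine and the exponential. *)
Lemma mean_value_bound (F F' : R -> R) (C : R) n : F 0 = 0 ->
  (forall x, is_derive x 1 F (F' x)) ->
  (forall x, `|x| <= 1 -> `|F' x| <= C * `|x| ^+ n) ->
  forall x, `|x| <= 1 -> `|F x| <= C * `|x| ^+ n.+1.
Proof.
move=> F0 dF bF x x1.
have C0 : 0 <= C.
  by have := bF 1; rewrite normr1 expr1n mulr1 lexx => /(_ isT); apply: le_trans.
have cF a b : {within `[a, b], continuous F}.
  apply: continuous_subspaceT => y.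
  by apply: differentiable_continuous; apply/derivable1_diffP; exact: ex_derive.
have bnd c : `|c| <= `|x| -> `|F' c * x| <= C * `|x| ^+ n.+1.
  move=> cx; rewrite normrM exprSr mulrA ler_wpM2r //.
  apply: le_trans (bF _ (le_trans cx x1)) _; rewrite ler_wpM2l //.
  by rewrite lerXn2r ?nnegrE.
have [x0|x0|->] := ltgtP x 0; last by rewrite F0 normr0 mulr_ge0 ?exprn_ge0.
- have [//|c] := MVT x0 (fun y _ => dF y); rewrite in_itv /= => /andP[c1 c2].
  rewrite F0 sub0r sub0r => h; rewrite -normrN h mulrN normrN.
  by apply: bnd; rewrite !ltr0_norm // lerN2 ltW.
- have [//|c] := MVT x0 (fun y _ => dF y); rewrite in_itv /= => /andP[c1 c2].
  rewrite F0 !subr0 => ->.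
  by apply: bnd; rewrite !gtr0_norm // ltW.
Qed.

Lemma sin_approx x : `|x| <= 1 -> `|sin x - x| <= `|x| ^+ 3 /\
   `|cos x - 1 + x ^+ 2 / 2| <= `|x| ^+ 3.
Proof.
have a1 : forall y : R, `|y| <= 1 -> `|sin y| <= 1 * `|y| ^+ 1.
  apply: (@mean_value_bound sin cos 1 0); first exact: sin0.
  - by move=> z _; rewrite mul1r expr0 ler_norml cos_geN1 cos_le1.
have a2 : forall y : R, `|y| <= 1 -> `|cos y - 1| <= 1 * `|y| ^+ 2.
  apply: (@mean_value_bound (cos - cst 1) (fun y => - sin y - 0) 1 1).
  - by change (cos 0 - 1 = 0 :> R); rewrite cos0 subrr.
  - by move=> z /a1; rewrite subr0 normrN.
have a3 : forall y : R, `|y| <= 1 -> `|sin y - y| <= 1 * `|y| ^+ 3.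
  apply: (@mean_value_bound (@sin R - id) (fun y => cos y - 1) 1 2).
  - by change (sin 0 - 0 = 0 :> R); rewrite sin0 subrr.
  - by move=> z /a2.
have a4 : forall y : R, `|y| <= 1 -> `|cos y - 1 + y ^+ 2 / 2| <= 1 * `|y| ^+ 3.
  have d2 (y : R) : is_derive y 1 (fun t : R => t ^+ 2 / 2) y.
    rewrite [X in is_derive _ _ X](_ : _ = 2^-1 *: (fun t : R => t ^+ 2)); last first.
      by apply/funext => t /=; rewrite mulrC.
    by apply: is_derive_eq; rewrite /GRing.scale /=; field.
  have d1 (y : R) : is_derive y 1 (fun t : R => cos t - 1) (- sin y).
    by rewrite -[- sin y]subr0; exact: is_deriveB.
  apply: (@mean_value_bound (fun t : R => cos t - 1 + t ^+ 2 / 2)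
     (fun y => - sin y + y) 1 2).
  - by rewrite cos0 subrr expr0n mul0r addr0.
  - move=> z z1; rewrite addrC distrC; apply: le_trans (a3 _ z1) _.
    by rewrite !mul1r [leLHS]exprS ler_piMl ?exprn_ge0.
move=> x1; split; first by rewrite -[leRHS]mul1r a3.
by rewrite -[leRHS]mul1r a4.
Qed.

Lemma expR_approx x : `|x| <= 1 ->
  `|expR x - 1 - x - x ^+ 2 / 2| <= expR 1 * `|x| ^+ 3.
Proof.
have a0 : forall y : R, `|y| <= 1 -> `|expR y - 1| <= expR 1 * `|y| ^+ 1.
  apply: (@mean_value_bound (expR - cst 1) (fun y => expR y - 0) (expR 1) 0).
  - by change (expR 0 - 1 = 0 :> R); rewrite expR0 subrr.
  - move=> y; rewrite ler_norml => /andP[_ y1].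
    by rewrite subr0 ger0_norm ?expR_ge0 // expr0 mulr1 ler_expR.
have a1 : forall y : R, `|y| <= 1 -> `|expR y - 1 - y| <= expR 1 * `|y| ^+ 2.
  apply: (@mean_value_bound (expR - cst 1 - id) (fun y => expR y - 0 - 1) (expR 1) 1).
  - by change (expR 0 - 1 - 0 = 0 :> R); rewrite expR0 !subrr.
  - by move=> y /a0; rewrite subr0.
rewrite (mulrC _ 2^-1); move: x.
apply: (@mean_value_bound (expR - cst 1 - id - 2^-1 *: (@idfun R ^+ 2))
   (fun y => expR y - 1 - y) (expR 1) 2).
- change (expR 0 - 1 - 0 - 2^-1 * (0 ^+ 2) = 0 :> R).
  by rewrite expR0 !subrr expr0n mulr0 subr0.
- move=> y; apply: is_derive_eq.
  by rewrite expr1 /GRing.scale /=; field.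
- by move=> z /a1.
Qed.

Lemma cexp_approx t u : `|t| <= 1 -> u ^+ 4 = 1 ->
  normc (cexp (t%:C * u) - (1 + t%:C * u + (t%:C * u) ^+ 2 / 2%:R)) <=
  (expR 1 + 2) * `|t| ^+ 3.
Proof.
move=> t1 u4.
have t3 : 0 <= `|t| ^+ 3 by rewrite exprn_ge0.
have [s1 s2] := sin_approx t1.
have e1 := expR_approx t1.
have e2 : `|expR (- t) - 1 + t - t ^+ 2 / 2| <= expR 1 * `|t| ^+ 3.
  by have := @expR_approx (- t); rewrite normrN sqrrN opprK; apply.
have E0 : 0 <= expR 1 * `|t| ^+ 3 by rewrite mulr_ge0 ?expR_ge0.
have inv2 (a : R) : (a%:C ^+ 2 / 2%:R : R[i]) = (a ^+ 2 / 2)%:C.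
  by rewrite rmorphM fmorphV rmorph_nat rmorphXn.
have fin (a b : R) : `|a| + `|b| <= (expR 1 + 2) * `|t| ^+ 3 ->
    normc (a +i* b) <= (expR 1 + 2) * `|t| ^+ 3.
  by apply: le_trans; exact: normc_le_sum.
case: (root4E u4) => ->.
- have -> : cexp (t%:C * 1) - (1 + t%:C * 1 + (t%:C * 1) ^+ 2 / 2%:R) =
      (expR t - 1 - t - t ^+ 2 / 2) +i* 0.
    rewrite mulr1 inv2 /cexp /= cos0 sin0.
    by apply/eqP; rewrite eq_complex /=; apply/andP; split; apply/eqP; ring.
  by apply: fin; rewrite normr0; lra.
- have -> : cexp (t%:C * -1) - (1 + t%:C * -1 + (t%:C * -1) ^+ 2 / 2%:R) =
      (expR (- t) - 1 + t - t ^+ 2 / 2) +i* 0.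
    rewrite mulrN1 sqrrN inv2 /cexp /= oppr0 cos0 sin0.
    by apply/eqP; rewrite eq_complex /=; apply/andP; split; apply/eqP; ring.
  by apply: fin; rewrite normr0; lra.
- have -> : cexp (t%:C * 'i) - (1 + t%:C * 'i + (t%:C * 'i) ^+ 2 / 2%:R) =
      (cos t - 1 + t ^+ 2 / 2) +i* (sin t - t).
    rewrite exprMn sqr_i mulrN1 mulNr inv2 /cexp /= !(mul0r, mulr0, mulr1, add0r, subr0, addr0, oppr0).
    rewrite expR0.
    by apply/eqP; rewrite eq_complex /=; apply/andP; split; apply/eqP; ring.
  by apply: fin; lra.
- have -> : cexp (t%:C * - 'i) - (1 + t%:C * - 'i + (t%:C * - 'i) ^+ 2 / 2%:R) =
      (cos t - 1 + t ^+ 2 / 2) +i* (- (sin t - t)).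
    rewrite mulrN sqrrN exprMn sqr_i mulrN1 mulNr inv2 /cexp /=.
    rewrite !(mul0r, mulr0, mulr1, add0r, subr0, addr0, oppr0) expR0 cosN sinN.
    by apply/eqP; rewrite eq_complex /=; apply/andP; split; apply/eqP; ring.
  by apply: fin; rewrite normrN; lra.
Qed.

Lemma cross_taylor2_cexp s z : cross_taylor2 (fun w => cexp (s%:C * w)) z.
Proof.
set A := cexp (s%:C * z).
exists (A * s%:C), (A * s%:C ^+ 2 / 2%:R).
exists (normc A * ((expR 1 + 2) * `|s| ^+ 3)), (`|s| + 1)^-1.
have s0 : 0 < `|s| + 1 by rewrite ltr_wpDl.
split; [|by rewrite invr_gt0|].
  by rewrite mulr_ge0 ?normc_ge0 // mulr_ge0 ?exprn_ge0 // addr_ge0 ?expR_ge0.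
move=> r u r0 r1 u4.
rewrite mulrDr cexpD -/A.
have -> : s%:C * (r%:C * u) = (s * r)%:C * u by rewrite mulrA rmorphM.
set v := cexp _.
have -> : A * v - (A + A * s%:C * (r%:C * u) + A * s%:C ^+ 2 / 2%:R * (r%:C * u) ^+ 2)
  = A * (v - (1 + (s * r)%:C * u + ((s * r)%:C * u) ^+ 2 / 2%:R)).
  by rewrite rmorphM /=; ring.
rewrite normcM -[leRHS]mulrA ler_wpM2l ?normc_ge0 //.
apply: le_trans (cexp_approx _ u4) _.
  rewrite normrM (gtr0_norm r0); move: r1; rewrite -[ltRHS]mul1r ltr_pdivlMr //.
  have := normr_ge0 s; nra.
by rewrite normrM exprMn (gtr0_norm r0) mulrA.
Qed.

End complex_exponential.

(** * Expansions of analytic functions *)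

Section analytic_expansions.
Context {R : realType}.
Implicit Types (z : R[i]) (f : R[i] -> R[i]).

Lemma ltc_pos (e : R[i]) : 0 < e -> exists2 r : R, 0 < r & e = r%:C.
Proof.
by case: e => r s; rewrite ltcE /= => /andP[/eqP -> r0]; exists r.
Qed.

Lemma cvgc_normc (u : nat -> R[i]) (l : R[i]) : u @ \oo --> l ->
  forall e, 0 < e -> exists N, forall n, (N <= n)%N -> normc (u n - l) < e.
Proof.
move=> /cvgrPdist_lt ul e e0.
have /ul [N _ NP] : 0 < e%:C by rewrite ltcR.
exists N => n /NP /=; rewrite normcBC; by rewrite ltcR.
Qed.

(** The terms of the power series are bounded at radius [q = e / 2], so that its
    tail after three terms is dominated on [|x| < q / 2] by a geometric
    series. *)
Lemma analytic_taylor2 f z : analytic_on unit_disc f -> normc z < 1 ->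
  taylor2 f z.
Proof.
move=> /(_ z) /[apply] -[a /nbhs_ballP[e0 /= /ltc_pos[e e_gt0 ->] aP]].
have {}aP x : normc x < e ->
    series (fun n => a n * x ^+ n) @ \oo --> f (z + x).
  move=> xe; have := aP (z + x); rewrite (addrC z x) addrK; apply.
  by rewrite /ball /= (addrC x) opprD addrA subrr add0r normrN ltcR.
pose q := e / 2.
have q0 : 0 < q by rewrite divr_gt0.
have [C [C0 aC]] : exists C, 0 <= C /\ forall n, normc (a n) * q ^+ n <= C.
  have qe : normc q%:C < e by rewrite normc_real gtr0_norm // /q; lra.
  have [N NP] := cvgc_normc (aP _ qe) ltr01.
  exists (2 + \sum_(i < N) normc (a i) * q ^+ i).
  have t0 (i : nat) : 0 <= normc (a i) * q ^+ i.
    by rewrite mulr_ge0 ?normc_ge0 // exprn_ge0 // ltW.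
  split; first by rewrite addr_ge0 // sumr_ge0.
  move=> n; have [nN|Nn] := ltnP n N.
    rewrite (bigD1 (Ordinal nN)) //= addrCA lerDl addr_ge0 // sumr_ge0 //.
  apply: (@le_trans _ _ 2); last by rewrite lerDl sumr_ge0.
  have h1 := NP _ Nn; have h2 := NP _ (leqW Nn).
  have -> : normc (a n) * q ^+ n = normc (a n * q%:C ^+ n).
    by rewrite normcM normcX normc_real gtr0_norm.
  have -> : a n * q%:C ^+ n = (series (fun n => a n * q%:C ^+ n) n.+1 - f (z + q%:C)) -
      (series (fun n => a n * q%:C ^+ n) n - f (z + q%:C)).
    by rewrite seriesSr; ring.
  by apply: le_trans (normcB _ _) _; lra.
pose S x n := series (fun n => a n * x ^+ n) n.
have tail x n : normc x <= q / 2 ->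
    normc (S x n.+3 - (a 0%N + a 1%N * x + a 2%N * x ^+ 2)) <=
    C * (normc x / q) ^+ 3 * (2 - 2 * (1 / 2) ^+ n).
  move=> xq; elim: n => [|n ih].
    rewrite /S !seriesSr /series /= big_geq // !expr0 !mulr1.
    by rewrite (_ : _ - _ = 0) ?Normc.normc0; [rewrite subrr mulr0|ring].
  rewrite /S seriesSr -/(S x n.+3).
  set P := a 0%N + _ + _ in ih *.
  rewrite addrAC; apply: le_trans (normcD _ _) _.
  have y0 : 0 <= normc x / q by rewrite divr_ge0 ?normc_ge0 // ltW.
  have y1 : normc x / q <= 1 / 2 by rewrite ler_pdivrMr // mulrC; lra.
  have an : normc (a n.+3 * x ^+ n.+3) <= C * (normc x / q) ^+ 3 * (1 / 2) ^+ n.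
    have -> : normc (a n.+3 * x ^+ n.+3) =
        normc (a n.+3) * q ^+ n.+3 * ((normc x / q) ^+ 3 * (normc x / q) ^+ n).
      rewrite -exprD addnC addn3 normcM normcX -[RHS]mulrA -exprMn (mulrC q).
      by rewrite divfK // gt_eqF.
    rewrite -[leRHS]mulrA; apply: ler_pM => //.
    - by rewrite mulr_ge0 ?normc_ge0 // exprn_ge0 // ltW.
    - by rewrite mulr_ge0 // exprn_ge0.
    - by rewrite ler_wpM2l ?exprn_ge0 // lerXn2r // nnegrE // divr_ge0.
  apply: le_trans (lerD ih an) _; rewrite [(1 / 2) ^+ n.+1]exprS.
  rewrite le_eqVlt; apply/orP; left; apply/eqP.
  by move: (normc x / q) => y; field.
have near x : normc x <= q / 2 ->
    normc (f (z + x) - (a 0%N + a 1%N * x + a 2%N * x ^+ 2)) <=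
    C * (normc x / q) ^+ 3 * 2.
  move=> xq; apply/ler_addgt0Pr => d d0.
  have xe : normc x < e by apply: le_lt_trans xq _; rewrite /q; lra.
  have [N NP] := cvgc_normc (aP _ xe) d0.
  have := NP N.+3 ltac:(by rewrite -addn3 leq_addr); rewrite -/(S x N.+3) => h1.
  have h2 := tail x N xq.
  have h3 : C * (normc x / q) ^+ 3 * (2 - 2 * (1 / 2) ^+ N) <= C * (normc x / q) ^+ 3 * 2.
    have y0 : 0 <= normc x / q by rewrite divr_ge0 ?normc_ge0 // ltW.
    apply: ler_wpM2l; first by apply: mulr_ge0 => //; exact: exprn_ge0.
    by rewrite lerBlDr lerDl mulr_ge0 // exprn_ge0.
  set P := a 0%N + _ + _ in h2 *.
  have -> : f (z + x) - P = (S x N.+3 - P) - (S x N.+3 - f (z + x)) by ring.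
  by apply: le_trans (normcB _ _) _; lra.
have fz : f z = a 0%N.
  have n0 : normc (0 : R[i]) = 0 by exact: Normc.normc0.
  have h := near 0 ltac:(rewrite n0; lra); move: h.
  have -> : C * (normc (0 : R[i]) / q) ^+ 3 * 2 = 0.
    by rewrite n0 (mul0r q^-1) (expr0n _ 3) mulr0 mul0r.
  rewrite addr0 mulr0 expr0n mulr0 !addr0 => h.
  by apply/eqP; rewrite -subr_eq0 -normc_eq0 eq_le normc_ge0 andbT.
exists (a 1%N), (a 2%N), (2 * C / q ^+ 3), (q / 2); split.
- by apply: divr_ge0; [exact: mulr_ge0|apply: exprn_ge0; exact: ltW].
- by rewrite divr_gt0.
move=> x xq; rewrite fz; apply: le_trans (near _ (ltW xq)) _.
rewrite expr_div_n le_eqVlt; apply/orP; left; apply/eqP; field.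
by rewrite gt_eqF.
Qed.

End analytic_expansions.

(** * Continuity on compact sets *)

Section continuity_on_compacts.
Context {R : realType}.
Implicit Types (z w : R[i]) (K : set R[i]) (h : R[i] -> R) (phi : R[i] -> R[i]).

Lemma ctn_inP K h :
  ctn_in K h <-> forall z, K z -> h w @[w --> within K (nbhs z)] --> h z.
Proof.
split=> H z Kz.
  apply/cvgrPdist_lt => e e0; have [d d0 dP] := H z Kz e e0.
  rewrite near_withinE; apply/nbhs_ballP; exists d%:C; first by rewrite /= ltcR.
  move=> w; rewrite /ball /= => zw Kw; rewrite distrC; apply: dP => //.
  by move: zw; rewrite normcBC ltcR.
move=> e e0; have /cvgrPdist_lt/(_ e e0) := H z Kz.
rewrite near_withinE => /nbhs_ballP[d0 /= /ltc_pos[d d_gt0 ->] dP].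
exists d => // w Kw wz; rewrite distrC; apply: dP => //.
by rewrite /ball /= ltcR -/(normc _) normcBC.
Qed.

Lemma ctn_inM K h1 h2 : ctn_in K h1 -> ctn_in K h2 ->
  ctn_in K (fun z => h1 z * h2 z).
Proof. by move=> /ctn_inP H1 /ctn_inP H2; apply/ctn_inP => z Kz; apply: cvgM; auto. Qed.

Lemma ctn_inD K h1 h2 : ctn_in K h1 -> ctn_in K h2 ->
  ctn_in K (fun z => h1 z + h2 z).
Proof. by move=> /ctn_inP H1 /ctn_inP H2; apply/ctn_inP => z Kz; apply: cvgD; auto. Qed.

Lemma ctn_in_cst K (a : R) : ctn_in K (fun=> a).
Proof. by move=> z Kz e e0; exists 1 => // w _ _; rewrite subrr normr0. Qed.

Lemma ctn_in_sum K n (F : nat -> R[i] -> R) :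
  (forall i, (i < n)%N -> ctn_in K (F i)) ->
  ctn_in K (fun z => \sum_(i < n) F i z).
Proof.
elim: n => [_|n ih FP].
  by under eq_fun do rewrite big_ord0; exact: ctn_in_cst.
under eq_fun do rewrite big_ord_recr /=.
apply: ctn_inD; last exact: FP.
by apply: ih => i /ltnW; exact: FP.
Qed.

Lemma ctn_in_comp K h (g : R -> R) : ctn_in K h ->
  (forall z, K z -> {for (h z), continuous g}) -> ctn_in K (fun z => g (h z)).
Proof.
move=> /ctn_inP H cg; apply/ctn_inP => z Kz.
by apply: (@cvg_comp _ _ _ h g _ (nbhs (h z))); [exact: H|exact: cg].
Qed.

Lemma taylor2_continuous phi z : taylor2 phi z -> forall e, 0 < e ->
  exists2 d, 0 < d & forall w, normc (w - z) < d -> normc (phi w - phi z) < e.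
Proof.
move=> [b [c [C [r0 [C0 r00 fP]]]]] e e0.
pose L := normc b + normc c + C + 1.
have L0 : 0 < L by rewrite /L; have := normc_ge0 b; have := normc_ge0 c; lra.
exists (Num.min r0 (Num.min 1 (e / L))); first by rewrite !lt_min r00 ltr01 divr_gt0.
move=> w; rewrite !lt_min ltr_pdivlMr // => /and3P[w1 w2 w3].
have := fP _ w1; rewrite (addrC z) subrK; set x := w - z in w1 w2 w3 * => h.
have -> : phi w - phi z = (phi w - (phi z + b * x + c * x ^+ 2)) +
   (b * x + c * x ^+ 2) by ring.
apply: le_lt_trans w3; apply: le_trans (normcD _ _) _.
have := normcD (b * x) (c * x ^+ 2); rewrite (normcM b) (normcM c) normcX => h2.
have x0 := normc_ge0 x; have x2 : normc x ^+ 2 <= normc x by rewrite expr2 ler_piMr // ltW.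
have x3 : normc x ^+ 3 <= normc x.
  by rewrite exprS ler_piMr // expr_le1 // ltW.
have := ler_wpM2l (normc_ge0 c) x2; have := ler_wpM2l C0 x3.
rewrite /L; lra.
Qed.

Lemma taylor2_ctn K phi : (forall z, K z -> taylor2 phi z) ->
  ctn_in K (fun z => normc (phi z)).
Proof.
move=> H z Kz e e0; have [d d0 dP] := taylor2_continuous (H z Kz) e0.
exists d => // w _ wz; exact: le_lt_trans (ler_dist_normc _ _) (dP _ wz).
Qed.

Lemma ctn_in_unif K h (L : R) :
  (forall z, K z -> normc z <= L) -> (forall z, ~ K z -> open_at (~` K) z) ->
  ctn_in K h -> forall e, 0 < e -> exists2 d, 0 < d &
    forall z w, K z -> K w -> normc (w - z) < d -> `|h w - h z| < e.
Proof.
move=> bK cK ch e e0.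
have /compact_near_coveringP/near_covering_withinP cov := compact_cx bK cK.
pose P (d : R) (p : R * R) := forall w, K w -> normc (w - cx p) < d ->
   `|h w - h (cx p)| < e.
have {}cov : \forall d \near (0:R)^'+, [set p | K (cx p)] `<=` P d.
  apply: cov => p Kp.
  have [d d0 dP] := ch _ Kp _ (divr_gt0 e0 (ltr0n R 2)).
  exists (ball p (d / 4), [set i | i < d / 2]) => /=.
    split; first by apply: nbhsx_ballx; rewrite divr_gt0.
    by apply: nbhs_right_lt; rewrite divr_gt0.
  move=> [q i] /= [[q1 q2] id2] Kq w Kw wq.
  have qp : normc (cx q - cx p) < d / 2.
    apply: le_lt_trans (normc_le_sum _) _; rewrite /= distrC (distrC q.2).
    by move: q1 q2; rewrite /ball /=; lra.
  have h1 := dP _ Kq ltac:(lra).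
  have h2 : `|h w - h (cx p)| < e / 2.
    apply: dP => //; rewrite -(subrK (cx q) w) -addrA.
    by apply: le_lt_trans (normcD _ _) _; lra.
  move: h1 h2; rewrite !ltr_norml => /andP[a1 a2] /andP[a3 a4].
  by apply/andP; split; lra.
near (0 : R)^'+ => d.
exists d => [//|z w Kz Kw wz].
have /(_ (complex.Re z, complex.Im z)) : [set p | K (cx p)] `<=` P d by near: d.
by rewrite /P /cx /=; case: z Kz wz => u v Kz wz; apply.
Unshelve. all: end_near. Qed.

End continuity_on_compacts.

(** * Two elementary sums *)

Section logarithmic_sums.
Context {R : realType}.

(** This is [n! >= (n / exp 1)^n], by induction and [ln (1 + 1/n) <= 1/n]. *)
Lemma sum_ln_ratio n : (0 < n)%N ->
  \sum_(0 <= k < n) ln (n%:R / k.+1%:R : R) <= n%:R.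
Proof.
case: n => // n _; elim: n => [|n ih].
  by rewrite big_nat1 divff // ln1.
rewrite big_nat_recr //= divff ?ln1 ?addr0; last by rewrite pnatr_eq0.
have -> : \sum_(0 <= k < n.+1) ln (n.+2%:R / k.+1%:R : R) =
  n.+1%:R * ln (n.+2%:R / n.+1%:R) + \sum_(0 <= k < n.+1) ln (n.+1%:R / k.+1%:R : R).
  rewrite -[X in X%:R * _](subn0 n.+1) mulr_natl -sumr_const_nat -big_split /=.
  apply: eq_bigr => k _; rewrite -lnM ?posrE ?divr_gt0 //; congr ln.
  by rewrite mulrA divfK // pnatr_eq0.
have : n.+1%:R * ln (n.+2%:R / n.+1%:R) <= 1 :> R.
  rewrite -ler_pdivlMl // mulr1.
  have -> : n.+2%:R / n.+1%:R = 1 + n.+1%:R^-1 :> R.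
    by rewrite -(natr1 n.+1) mulrDl divff ?pnatr_eq0 // mul1r.
  by apply: le_ln1Dx; apply: (@lt_trans _ _ 0); rewrite ?invr_gt0 // ltrN10.
by move=> h; rewrite -[leRHS](natr1 n.+1) [leRHS]addrC; apply: lerD.
Qed.

(** Each distance to [j] occurs at most twice. *)
Lemma sum_dist_le (g : nat -> R) (n j : nat) : (forall k, 0 <= g k) -> (j < n)%N ->
  \sum_(i < n) g (maxn (i - j) (j - i)) <= 2 * \sum_(0 <= k < n) g k.
Proof.
move=> g0 jn; rewrite -(big_mkord xpredT (fun i => g (maxn (i - j) (j - i)))).
rewrite (big_cat_nat (n := j)) //=; last exact: ltnW.
rewrite mulr_natl mulr2n; apply: lerD.
  rewrite big_nat_rev /= add0n.
  rewrite (big_cat_nat (n := j.+1) (leq0n _) jn) /=.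
  rewrite big_nat_recl //= -addrA; apply: (@le_trans _ _ (\sum_(0 <= i < j) g i.+1)).
    rewrite le_eqVlt; apply/orP; left; apply/eqP/eq_big_nat => i /andP[_ ij].
    congr g; rewrite subKn // (_ : j - i.+1 - j = 0)%N ?max0n //.
    by apply/eqP; rewrite subn_eq0 leq_subr.
  by rewrite addrCA lerDl addr_ge0 // sumr_ge0.
rewrite -{1}(add0n j) big_addn.
rewrite (big_cat_nat (n := n - j) (leq0n _) (leq_subr _ _)) /=.
apply: (@le_trans _ _ (\sum_(0 <= i < n - j) g i)); last by rewrite lerDl sumr_ge0.
rewrite le_eqVlt; apply/orP; left; apply/eqP/eq_big_nat => i _.
by rewrite addnK (_ : j - (i + j) = 0)%N ?maxn0 //; apply/eqP; rewrite subn_eq0 leq_addl.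
Qed.

End logarithmic_sums.

(** * The Green function of a disc *)

Section green_function.
Context {R : realType}.
Implicit Types (a z w : R[i]) (rho : R).

Definition cconj a : R[i] := complex.Re a +i* - complex.Im a.

Definition green rho a z : R :=
  ln (normc ((rho ^+ 2)%:C - cconj a * z)) - ln (normc (rho%:C * (z - a))).

(** The identity behind the Blaschke factors: it gives the sign of the Green
    function, its zero boundary values and its lower bounds. *)
Lemma blaschke_identity rho a z :
  normc ((rho ^+ 2)%:C - cconj a * z) ^+ 2 =
  normc (rho%:C * (z - a)) ^+ 2 +
  (rho ^+ 2 - normc a ^+ 2) * (rho ^+ 2 - normc z ^+ 2).
Proof. by case: a z => a b [c d]; rewrite !sqr_normcE /=; ring. Qed.

Lemma blaschke_num_gt0 rho a z : 0 < rho -> normc a < rho -> normc z <= rho ->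
  z != a -> 0 < normc ((rho ^+ 2)%:C - cconj a * z).
Proof.
move=> r0 ar zr za; rewrite lt_def normc_ge0 andbT.
rewrite -sqrf_eq0 blaschke_identity gt_eqF // ltr_wpDr //.
  rewrite mulr_ge0 // subr_ge0 lerXn2r // ?nnegrE ?normc_ge0 ?(ltW r0) //.
  exact: ltW.
rewrite exprn_gt0 // normcM mulr_gt0 // normc_gt0 ?subr_eq0 //.
by apply: contraTneq r0 => -[->]; rewrite ltxx.
Qed.

Lemma blaschke_den_gt0 rho a z : 0 < rho -> z != a ->
  0 < normc (rho%:C * (z - a)).
Proof.
move=> r0 za; rewrite normcM mulr_gt0 // normc_gt0 ?subr_eq0 //.
by apply: contraTneq r0 => -[->]; rewrite ltxx.
Qed.

Lemma green_ge rho a z (x : R) : 0 < rho -> normc a < rho -> normc z <= rho ->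
  z != a -> 0 <= x ->
  x * normc (rho%:C * (z - a)) ^+ 2 <=
    (rho ^+ 2 - normc a ^+ 2) * (rho ^+ 2 - normc z ^+ 2) ->
  ln (1 + x) / 2 <= green rho a z.
Proof.
move=> r0 ar zr za x0 xle.
have n0 := blaschke_num_gt0 r0 ar zr za; have d0 := blaschke_den_gt0 r0 za.
rewrite /green ler_pdivrMr // mulr_natr mulrnBl -!lnXn // -ln_div ?posrE ?exprn_gt0 //.
rewrite ler_ln ?posrE ?divr_gt0 ?exprn_gt0 //; last by lra.
rewrite ler_pdivlMr ?exprn_gt0 // mulrDl mul1r blaschke_identity lerD2l.
exact: xle.
Qed.

Lemma green_boundary rho a z : 0 < rho -> normc z = rho -> green rho a z = 0.
Proof.
move=> r0 zr; apply/eqP; rewrite /green subr_eq0; apply/eqP; congr ln.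
apply/eqP; rewrite -(@eqrXn2 _ 2%N) ?normc_ge0 // blaschke_identity zr.
by rewrite subrr mulr0 addr0.
Qed.

Lemma green_le rho a z (D : R) : 0 < rho -> normc a < rho -> normc z <= rho ->
  z != a -> rho ^+ 2 - normc a ^+ 2 + rho * normc (z - a) <= rho * D ->
  green rho a z <= ln (D / normc (z - a)).
Proof.
move=> r0 ar zr za le.
have n0 := blaschke_num_gt0 r0 ar zr za; have d0 := blaschke_den_gt0 r0 za.
have za0 : 0 < normc (z - a) by rewrite normc_gt0 subr_eq0.
have nle : normc ((rho ^+ 2)%:C - cconj a * z) <= rho * D.
  apply: le_trans le.
  have -> : (rho ^+ 2)%:C - cconj a * z =
     (rho ^+ 2 - normc a ^+ 2)%:C - cconj a * (z - a).
    rewrite sqr_normcE; case: a z {ar za n0 d0 za0 zr} => a b [c d]; rewrite /cconj /=.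
    by apply/eqP; rewrite eq_complex /=; apply/andP; split; apply/eqP; ring.
  apply: le_trans (normcB _ _) _; rewrite normc_real normcM ger0_norm; last first.
    by rewrite subr_ge0 lerXn2r // ?nnegrE ?normc_ge0 ?(ltW r0) // ltW.
  rewrite lerD2l ler_wpM2r ?normc_ge0 // /cconj.
  by move: ar; case: (a) => u v /= /ltW; rewrite sqrrN.
have D0 : 0 < D by rewrite -(pmulr_rgt0 _ r0); exact: lt_le_trans nle.
rewrite /green -ln_div ?posrE // ler_ln ?posrE ?divr_gt0 //.
rewrite normcM normc_real (gtr0_norm r0) invfM mulrA ler_pM2r ?invr_gt0 //.
by rewrite ler_pdivrMr // (mulrC D).
Qed.

Lemma green_harmonic rho a z : 0 < rho -> normc a < rho -> normc z <= rho ->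
  z != a -> add_harmonic (green rho a) z.
Proof.
move=> r0 ar zr za.
have -> : green rho a = fun z =>
   ln (normc ((rho ^+ 2)%:C + - cconj a * z)) +
   -1 * ln (normc (- (rho%:C * a) + rho%:C * z)).
  by apply/funext => w; rewrite /green mulN1r mulNr mulrBr (addrC (- _)).
apply: add_harmonicD; last apply: add_harmonicZ.
  apply: add_harmonic_lnnorm; first exact/cross_taylor2_mul/cross_taylor2_affine.
  by rewrite mulNr -normc_gt0; exact: blaschke_num_gt0.
apply: add_harmonic_lnnorm; first exact/cross_taylor2_mul/cross_taylor2_affine.
by rewrite addrC -mulrBr -normc_gt0; exact: blaschke_den_gt0.
Qed.

Lemma green_ctn (K : set R[i]) rho a : 0 < rho -> normc a < rho ->
  (forall z, K z -> normc z <= rho /\ z != a) -> ctn_in K (green rho a).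
Proof.
move=> r0 ar Ka.
have -> : green rho a = fun z =>
   ln (normc ((rho ^+ 2)%:C + - cconj a * z)) +
   -1 * ln (normc (- (rho%:C * a) + rho%:C * z)).
  by apply/funext => w; rewrite /green mulN1r mulNr mulrBr (addrC (- _)).
apply: ctn_inD; last apply: ctn_inM; first 2 last.
- apply: (@ctn_in_comp _ _ (fun z => normc (- (rho%:C * a) + rho%:C * z))).
    by apply: taylor2_ctn => z _; exact: taylor2_affine.
  move=> z /Ka[zr za]; apply: continuous_ln.
  by rewrite addrC -mulrBr; exact: blaschke_den_gt0.
- apply: (@ctn_in_comp _ _ (fun z => normc ((rho ^+ 2)%:C + - cconj a * z))).
    by apply: taylor2_ctn => z _; exact: taylor2_affine.
  move=> z /Ka[zr za]; apply: continuous_ln.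
  by rewrite mulNr; exact: blaschke_num_gt0.
- exact: ctn_in_cst.
Qed.

End green_function.

(** * Functions that are small at spread points *)

Section spread_small_values.
Context {R : realType}.
Implicit Types (f : R[i] -> R[i]) (z w : R[i]).

Lemma finite_pos_min n (g : nat -> R) : (forall i, (i < n)%N -> 0 < g i) ->
  exists2 d, 0 < d & forall i, (i < n)%N -> d <= g i.
Proof.
elim: n => [_|n ih gP]; first by exists 1.
have [i /ltnW /gP //|d d0 dP] := ih.
exists (Num.min d (g n)); first by rewrite lt_min d0 gP.
move=> i; rewrite ltnS leq_eqVlt => /predU1P[->|/dP]; rewrite ge_min ?lexx ?orbT //.
by move=> ->.
Qed.

(** If [f] is at most [exp (- Lam)] at arbitrarily many points with gaps
    [mu / n], then it is small at [zs].  Compare [log |f|] with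
    [M - c G], where [G] is the sum of the Green functions with poles at the
    [n] points.  On a circle of radius [mu / (2 n)] around one of them, the gaps
    give [G <= n (ln (12 D / mu) + 2)], and uniform continuity transfers the
    smallness of [f] from the points to these circles as soon as [n] is large
    enough; on the rest of the boundary [G = 0].  The first alternative of the
    conclusion covers the case in which [Lam] is already small. *)
Lemma small_values_spread f (rho M Lam Kb kap D mu : R) (zs : R[i]) :
  0 < rho -> (forall z, normc z <= rho -> taylor2 f z) ->
  (forall z, normc z <= rho -> normc (f z) <= expR M) -> 1 <= M ->
  normc zs <= rho -> expR (- Kb) <= normc (f zs) -> 0 <= Kb ->
  0 < mu -> mu <= D ->
  (forall n, (0 < n)%N -> exists a : nat -> R[i],
     (forall i, (i < n)%N -> [/\ normc (a i) < rho, normc (f (a i)) <= expR (- Lam),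
        rho ^+ 2 - normc (a i) ^+ 2 <= rho * D &
        zs != a i -> kap <= green rho (a i) zs]) /\
     (forall i j, (i < n)%N -> (j < n)%N ->
        (maxn (i - j) (j - i))%:R * (mu / n%:R) <= normc (a i - a j) <= D)) ->
  Lam <= Kb \/ Lam * kap <= (Kb + M) * (ln (12 * D / mu) + 2).
Proof.
move=> rho0 tf bf M1 zs_rho fzs Kb0 mu0 muD pts.
have [LK|KL] := leP Lam Kb; [by left|right].
have Lam0 : 0 < Lam by exact: le_lt_trans KL.
have D0 : 0 < D by exact: lt_le_trans muD.
set S := ln (12 * D / mu) + 2.
have S0 : 0 < S.
  by rewrite /S ltr_wpDl // ln_ge0 // ler_pdivlMr // mul1r; lra.
pose disc : set R[i] := [set z | normc z <= rho].
have disc_closed z : ~ disc z -> open_at (~` disc) z by exact: disc_compl_open.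
have ctf : ctn_in disc (fun z => normc (f z)) by apply: taylor2_ctn.
have bdisc z : disc z -> normc z <= rho by [].
pose e := Num.min (expR (- Lam)) (expR (- Kb) - expR (- Lam)).
have e0 : 0 < e.
  by rewrite lt_min expR_gt0 subr_gt0 ltr_expR ltrN2.
have [d d0 dP] := ctn_in_unif bdisc disc_closed ctf e0.
pose n := (Num.truncn (mu / d)).+1.
have nd : mu / n%:R < d.
  have := Num.Theory.truncnS_gt (mu / d); rewrite -/n ltr_pdivrMr // => h.
  by rewrite ltr_pdivrMr // mulrC.
have n0 : (0 : R) < n%:R by rewrite ltr0n.
have [//|a [aP aD]] := pts n.
pose eta := mu / n%:R / 2.
have mn0 : 0 < mu / n%:R by rewrite divr_gt0.
have eta0 : 0 < eta by rewrite divr_gt0.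
have mnmu : mu / n%:R <= mu by rewrite ler_pdivrMr // ler_peMr ?ler1n // ltW.
have etad : eta < d by rewrite /eta; lra.
have near_small i z : (i < n)%N -> normc z <= rho -> normc (z - a i) <= eta ->
    normc (f z) <= 2 * expR (- Lam) /\ normc (f z) < expR (- Kb).
  move=> ni zr za; have [ar fa _ _] := aP _ ni.
  have := dP (a i) z (ltW ar) zr (le_lt_trans za etad).
  rewrite ltr_norml ltrBlDr /e => /andP[_]; rewrite -ltrBlDr lt_min.
  by move=> /andP[h1 h2]; split; lra.
have zs_far i : (i < n)%N -> eta < normc (zs - a i).
  move=> ni; rewrite ltNge; apply/negP => /(near_small _ _ ni zs_rho)[_].
  by rewrite ltNge fzs.
pose K : set R[i] := [set z | normc z <= rho /\
  forall i, (i < n)%N -> eta <= normc (z - a i)].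
pose B : set R[i] := [set z | rho <= normc z \/
  exists2 i, (i < n)%N & normc (z - a i) <= eta].
pose c := Lam / (n%:R * S).
have c0 : 0 < c by rewrite divr_gt0 // mulr_gt0.
pose G z := \sum_(i < n) green rho (a i) z.
have Ka i z : (i < n)%N -> K z -> z != a i.
  move=> ni [_ /(_ _ ni)]; apply: contraTneq => ->.
  by rewrite subrr Normc.normc0 -ltNge.
(* the weight is chosen so that [c G <= Lam] near the poles *)
have step : forall z, K z -> normc (f z) * expR (c * G z) <= expR M.
  apply: (@max_principle _ K B _ _ _ rho).
  - by move=> z [].
  - move=> z nK; have [zr|zr] := leP (normc z) rho; last first.
      have [|d' d'0 d'P] := disc_closed z; first by apply/negP; rewrite -ltNge.
      by exists d' => // w /d'P nw [].
    have [i [ni zi]] : exists i, (i < n)%N /\ normc (z - a i) < eta.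
      apply: contrapT => H; apply: nK; split=> // i ni; rewrite leNgt; apply/negP => zi.
      by apply: H; exists i.
    exists (eta - normc (z - a i)); first by rewrite subr_gt0.
    move=> w wz [_ /(_ _ ni)]; have := normcD (w - z) (z - a i).
    rewrite addrA subrK; lra.
  - apply: ctn_inM; first by apply: taylor2_ctn => z [/tf].
    apply: (@ctn_in_comp _ _ (fun z => c * G z)); last by move=> z _; exact: continuous_expR.
    apply: ctn_inM; first exact: ctn_in_cst.
    apply: (@ctn_in_sum _ _ _ (fun i z => green rho (a i) z)) => i ni; apply: green_ctn => //.
      by have [] := aP _ ni.
    by move=> z Kz; split; [case: Kz|exact: Ka].
  - move=> z Kz nB; split.
    + have [d1 d10 d1P] : exists2 d, 0 < d & forall i, (i < n)%N ->
          d <= normc (z - a i) - eta.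
        apply: finite_pos_min => i ni; rewrite subr_gt0 ltNge; apply/negP => zi.
        by apply: nB; right; exists i.
      have zr : normc z < rho by rewrite ltNge; apply/negP => zr; apply: nB; left.
      exists (Num.min d1 (rho - normc z)); first by rewrite lt_min d10 subr_gt0.
      move=> w; rewrite lt_min => /andP[w1 w2]; split.
        by have := normcD (w - z) z; rewrite subrK; lra.
      move=> i ni; have := d1P _ ni; have := normcB (w - a i) (w - z).
      have -> : w - a i - (w - z) = z - a i by ring.
      lra.
    + by apply/cross_taylor2_mul/taylor2_cross/tf; case: Kz.
    + apply: add_harmonicZ; apply: (@add_harmonic_sum _ _ (fun i => green rho (a i))) => i ni.
      by apply: green_harmonic => //; [have [] := aP _ ni|case: Kz|exact: Ka].
  - move=> z Kz [zr|[j nj zj]].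
      have {}zr : normc z = rho by apply/eqP; rewrite eq_le zr andbT; case: Kz.
      rewrite (_ : G z = 0) ?mulr0 ?expR0 ?mulr1; first by apply: bf; rewrite zr.
      by rewrite /G big1 // => i _; exact: green_boundary.
    have GS : G z <= n%:R * S.
      have term (i : 'I_n) : green rho (a i) z <= ln (12 * D / mu) +
          ln (n%:R / (maxn (i - j) (j - i)).+1%:R).
        have ni := ltn_ord i.
        have [ar _ aD' _] := aP _ ni.
        have /andP[s1 s2] := aD _ _ ni nj.
        have zi0 : eta <= normc (z - a i) by case: Kz => _; apply.
        have zi1 : normc (z - a i) <= 2 * D.
          have := normcB (z - a j) (a i - a j).
          have -> : z - a j - (a i - a j) = z - a i by ring.
          rewrite /eta in zj; lra.
        apply: le_trans (@green_le _ rho (a i) z (3 * D) _ _ _ _ _) _ => //.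
        - by case: Kz.
        - exact: Ka.
        - have : rho * normc (z - a i) <= rho * (2 * D) by rewrite ler_pM2l.
          lra.
        (* for [i = j] the radius of the circle itself gives the bound *)
        have zi : (maxn (i - j) (j - i)).+1%:R * (mu / n%:R / 4) <= normc (z - a i).
          have := normcB (z - a j) (z - a i).
          have -> : z - a j - (z - a i) = a i - a j by ring.
          move=> h.
          rewrite -natr1; case: (posnP (maxn (i - j) (j - i))) s1 => [->|].
            by rewrite add0r mul1r /eta in zi0 *; lra.
          rewrite -(ler1n R); set m : R := _%:R => m1 s1.
          have : mu / n%:R <= m * (mu / n%:R) by rewrite ler_peMl // ltW.
          rewrite /eta in zj; lra.
        have zi_gt : 0 < normc (z - a i) by exact: lt_le_trans zi0.
        set m := (_.+1)%:R in zi *.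
        have m0 : 0 < m by rewrite ltr0n.
        have q0 : 0 < 12 * D / mu by rewrite divr_gt0 // mulr_gt0.
        have q1 : 0 < n%:R / m by rewrite divr_gt0.
        have q2 : 0 < 3 * D / normc (z - a i) by rewrite divr_gt0 // mulr_gt0.
        rewrite -lnM ?posrE // ler_ln ?posrE ?(mulr_gt0 q0 q1) //.
        rewrite ler_pdivrMr //.
        apply: (@le_trans _ _ (12 * D / mu * (n%:R / m) * (m * (mu / n%:R / 4)))).
          rewrite le_eqVlt; apply/orP; left; apply/eqP; field.
          by rewrite !gt_eqF.
        by rewrite ler_pM2l // mulr_gt0.
      apply: (@le_trans _ _ (\sum_(i < n) (ln (12 * D / mu) +
          ln (n%:R / (maxn (i - j) (j - i)).+1%:R)))).
        by apply: ler_sum => i _; exact: term.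
      rewrite big_split /= sumr_const card_ord -[X in X + _ <= _]mulr_natl /S.
      rewrite [leRHS]mulrDr lerD2l.
      pose g (k : nat) : R := if (k < n)%N then ln (n%:R / k.+1%:R) else 0.
      have g0 k : 0 <= g k.
        rewrite /g; case: ifP => // kn.
        by rewrite ln_ge0 // ler_pdivlMr ?ltr0n // mul1r ler_nat.
      have -> : \sum_(i < n) ln (n%:R / (maxn (i - j) (j - i)).+1%:R) =
          \sum_(i < n) g (maxn (i - j) (j - i)).
        apply: eq_bigr => i _.
        rewrite /g gtn_max (leq_ltn_trans (leq_subr _ _) (ltn_ord i)).
        by rewrite (leq_ltn_trans (leq_subr _ _) nj).
      apply: le_trans (sum_dist_le g0 nj) _; rewrite mulrC ler_pM2r //.
      rewrite (_ : \sum_(0 <= k < n) g k = \sum_(0 <= k < n) ln (n%:R / k.+1%:R)).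
        exact: sum_ln_ratio.
      by apply: eq_big_nat => k /andP[_ kn]; rewrite /g kn.
    have [zr _] := Kz.
    have [h1 _] := near_small _ _ nj zr zj.
    have : expR (c * G z) <= expR Lam.
      rewrite ler_expR /c mulrAC ler_pdivrMr ?mulr_gt0 // ler_pM2l //.
    move=> h2; apply: le_trans (ler_pM (normc_ge0 _) (expR_ge0 _) h1 h2) _.
    rewrite -mulrA -expRD addNr expR0 mulr1.
    apply: (@le_trans _ _ (1 + M)); [lra|exact: expR_ge1Dx].
  - exact: expR_ge0.
have Kzs : K zs by split => // i /zs_far/ltW.
have := step _ Kzs.
have Gk : n%:R * kap <= G zs.
  rewrite -[X in X%:R * _]card_ord mulr_natl -sumr_const; apply: ler_sum => i _.
  have [_ _ _] := aP _ (ltn_ord i); apply; exact: Ka.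
have : expR (- Kb) * expR (c * (n%:R * kap)) <= normc (f zs) * expR (c * G zs).
  by rewrite ler_pM ?expR_ge0 // ler_expR ler_pM2l.
move=> /le_trans /[apply]; rewrite -expRD ler_expR.
have -> : c * (n%:R * kap) = Lam * kap / S.
  by rewrite /c; field; rewrite !gt_eqF.
by move=> h; rewrite -ler_pdivrMr //; lra.
Qed.

End spread_small_values.

(** * Sectors with vertex on the unit circle *)

Section sector_estimate.
Context {R : realType}.
Implicit Types (f Phi : R[i] -> R[i]) (z w E : R[i]) (K : set R[i]).

Lemma cos_ge_cos (x y : R) : `|y| <= x -> x <= pi -> cos x <= cos y.
Proof.
move=> yx xpi; have x0 : 0 <= x by exact: le_trans yx.
have [y0|y0] := leP 0 y.
  rewrite ger0_norm // in yx.
  by rewrite leNgt ltr_cos -?leNgt // ?in_itv /=; apply/andP; split; lra.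
rewrite ltr0_norm // in yx.
by rewrite -(cosN y) leNgt ltr_cos -?leNgt // ?in_itv /=; apply/andP; split; lra.
Qed.

Lemma cexp_near0 w : normc w <= 1 ->
  normc (cexp w - 1) <= (2 + 5 * expR 1) * normc w.
Proof.
case: w => x y w1; set r := normc _ in w1 *.
have xr : `|x| <= r by exact: (normc_ge_Re (x +i* y)).
have yr : `|y| <= r by exact: (normc_ge_Im (x +i* y)).
have cub (u v : R) : 0 <= u -> u <= v -> v <= 1 -> u ^+ 3 <= v /\ u ^+ 2 <= v.
  move=> u0 uv v1; split.
    by apply: (le_trans _ uv); rewrite exprS ler_piMr // expr_le1 // (le_trans uv).
  by apply: (le_trans _ uv); rewrite expr2 ler_piMr // (le_trans uv).
have x1 := le_trans xr w1; have y1 := le_trans yr w1.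
have [s1 s2] := sin_approx y1; have e1 := expR_approx x1.
have [x3 x2] := cub _ _ (normr_ge0 x) xr w1.
have [y3 y2] := cub _ _ (normr_ge0 y) yr w1.
rewrite real_normK ?num_real // in x2; rewrite real_normK ?num_real // in y2.
have E1 : expR x <= expR 1 by rewrite ler_expR; apply: le_trans (ler_norm _) _.
have E0 := expR_gt0 x.
apply: le_trans (normc_le_sum _) _; rewrite /=.
have -> : expR x * sin y - 0 = expR x * sin y by rewrite subr0.
have ax : `|expR x - 1| <= (2 + expR 1) * r.
  have -> : expR x - 1 = (expR x - 1 - x - x ^+ 2 / 2) + x + x ^+ 2 / 2 by ring.
  apply: le_trans (ler_normD _ _) _; apply: le_trans (lerD (ler_normD _ _) (lexx _)) _.
  have : `|x ^+ 2 / 2| <= r by rewrite ger0_norm ?divr_ge0 ?sqr_ge0 //; have := sqr_ge0 x; lra.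
  have : expR 1 * `|x| ^+ 3 <= expR 1 * r by rewrite ler_wpM2l ?expR_ge0.
  lra.
have ac : `|cos y - 1| <= 2 * r.
  have -> : cos y - 1 = (cos y - 1 + y ^+ 2 / 2) - y ^+ 2 / 2 by ring.
  apply: le_trans (ler_normB _ _) _.
  have : `|y ^+ 2 / 2| <= r by rewrite ger0_norm ?divr_ge0 ?sqr_ge0 //; have := sqr_ge0 y; lra.
  lra.
have as_ : `|sin y| <= 2 * r.
  have -> : sin y = (sin y - y) + y by ring.
  by apply: le_trans (ler_normD _ _) _; lra.
have r0 : 0 <= r by exact: normc_ge0.
have p1 : `|expR x * sin y| <= expR 1 * (2 * r).
  by rewrite normrM (gtr0_norm E0); apply: ler_pM => //; exact: ltW.
have p2 : `|expR x * cos y - 1| <= expR 1 * (2 * r) + (2 + expR 1) * r.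
  have -> : expR x * cos y - 1 = expR x * (cos y - 1) + (expR x - 1) by ring.
  apply: le_trans (ler_normD _ _) _; apply: lerD => //.
  by rewrite normrM (gtr0_norm E0); apply: ler_pM => //; exact: ltW.
have := lerD p2 p1; lra.
Qed.

Lemma cexp_continuous z e : 0 < e -> exists2 d, 0 < d &
  forall w, normc (w - z) < d -> normc (cexp w - cexp z) < e.
Proof.
move=> e0; set A := normc (cexp z); pose L := (A + 1) * (2 + 5 * expR 1).
have A0 : 0 <= A by exact: normc_ge0.
have E0 := expR_ge0 (1 : R).
have B0 : 0 < 2 + 5 * expR 1 :> R by lra.
have L0 : 0 < L by rewrite mulr_gt0 //; lra.
exists (Num.min 1 (e / L)); first by rewrite lt_min ltr01 divr_gt0.
move=> w; rewrite lt_min ltr_pdivlMr // => /andP[w1 w2].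
have -> : cexp w - cexp z = cexp z * (cexp (w - z) - 1).
  by rewrite mulrBr mulr1 -cexpD (addrC z) subrK.
rewrite normcM -/A; apply: le_lt_trans w2.
apply: le_trans (ler_wpM2l A0 (cexp_near0 (ltW w1))) _.
rewrite [leRHS]mulrC /L -!mulrA; apply: ler_pM => //; last by lra.
by rewrite mulr_ge0 ?normc_ge0 // ltW.
Qed.

(** Logarithmic coordinates in a sector with vertex [E]: the real part of the
    argument is the logarithm of the distance to the vertex and its imaginary
    part the angle.  Powers of the distance become exponentials. *)
Definition sector_map E z : R[i] := E * (1 - cexp z).

Lemma sector_map_continuous E z e : 0 < e -> exists2 d, 0 < d &
  forall w, normc (w - z) < d -> normc (sector_map E w - sector_map E z) < e.
Proof.
move=> e0; have E0 := normc_ge0 E; have E1 : 0 < normc E + 1 by lra.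
have [d d0 dP] := cexp_continuous z (divr_gt0 e0 E1).
exists d => // w /dP; rewrite ltr_pdivlMr // => h.
have -> : sector_map E w - sector_map E z = - (E * (cexp w - cexp z)).
  by rewrite /sector_map; ring.
rewrite normcN normcM; apply: le_lt_trans h.
by rewrite mulrDr mulr1 mulrC lerDl normc_ge0.
Qed.

Lemma sector_map_taylor2 E z : cross_taylor2 (sector_map E) z.
Proof.
have -> : sector_map E = (fun w => E + - E * w) \o (fun w => cexp (1%:C * w)).
  by apply/funext => w; rewrite /sector_map /= mul1r mulrBr mulr1 mulNr.
by apply: cross_taylor2_comp; [exact: taylor2_affine|exact: cross_taylor2_cexp].
Qed.

Lemma ctn_sector K f E : (forall z, K z -> taylor2 f (sector_map E z)) ->
  ctn_in K (fun z => normc (f (sector_map E z))).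
Proof.
move=> tf z Kz e e0.
have [d d0 dP] := taylor2_continuous (tf _ Kz) e0.
have [d' d'0 d'P] := sector_map_continuous E z d0.
exists d' => // w _ /d'P/dP; exact/le_lt_trans/ler_dist_normc.
Qed.

Lemma Re_cexpZ (s : R) z : complex.Re (cexp (s%:C * z)) =
  expR (s * complex.Re z) * cos (s * complex.Im z).
Proof. by case: z => x y; rewrite /= !mul0r subr0 addr0. Qed.

(** In the sector of half-angle [al] with vertex on the unit circle, the
    distance to the circle is comparable to the distance to the vertex. *)
Lemma sector_map_norm E (al : R) z : normc E = 1 -> 0 <= al <= pi / 2 ->
  `|complex.Im z| <= al -> expR (complex.Re z) <= cos al ->
  normc (sector_map E z) <= 1 - cos al / 2 * expR (complex.Re z).
Proof.
move=> E1 /andP[al0 al2]; case: z => x y /=; rewrite normcM E1 mul1r => yal rT.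
set r := expR x in rT *.
have r0 : 0 < r by exact: expR_gt0.
have pi0 := pi_gt0 R.
have cy : cos al <= cos y by apply: cos_ge_cos; lra.
have ca1 := cos_le1 al.
rewrite -(@ler_pXn2r _ 2%N) ?nnegrE ?normc_ge0 //; last by nra.
rewrite sqr_normcE /= -/r sub0r.
have -> : (1 - r * cos y) ^+ 2 + (- (r * sin y)) ^+ 2 =
  1 - 2 * r * cos y + r ^+ 2 * (cos y ^+ 2 + sin y ^+ 2) by ring.
rewrite cos2Dsin2 mulr1.
have h1 : r * cos al <= r * cos y by rewrite ler_pM2l.
have h2 : r ^+ 2 <= r * cos al by rewrite expr2 ler_pM2l.
have -> : (1 - cos al / 2 * r) ^+ 2 = 1 - r * cos al + (cos al / 2 * r) ^+ 2 by field.
have := sqr_ge0 (cos al / 2 * r); lra.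
Qed.

End sector_estimate.

(** * Two constants in a sector *)

Section sector_two_constants.
Context {R : realType}.
Implicit Types (f : R[i] -> R[i]) (z w E : R[i]).

Lemma powR_expR_ln (a x : R) : 0 < a -> a `^ x = expR (x * ln a).
Proof. by move=> a0; rewrite /powR gt_eqF. Qed.

(** In logarithmic coordinates the sector is the rectangle [K].  There
    [C1 Re (w^-g)] dominates [log |f|], because the angle stays below
    [pi / (2 g)].  The function [Re (w^-g') - T^-g'] is at most 0 on the sides,
    where [cos (g' al) = 0], and on the far arc [|w| = T]; on the near arc
    [|w| = delta] it is at most [delta^-g'].  So if [f] is at most [exp (- Kc)] on the near
    arc, adding [Kc delta^g'] times it to the exponent keeps the product below
    1 on the whole boundary; the conclusion is the resulting inequality at the
    point [w = b]. *)
Lemma sector_two_constants f (g g' : R) E (delta b T Q Kc L0 : R) :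
  let al := pi / (2 * g') in let ca := cos al / 2 in
  (forall z, normc z < 1 -> taylor2 f z) -> normc E = 1 ->
  0 < g -> g < g' -> 1 < g' ->
  0 < delta -> delta <= b -> b <= T -> T <= cos al -> 0 <= Q ->
  (forall z, normc z <= 1 - ca * delta ->
     normc (f z) <= expR (Q * (1 - normc z) `^ (- g))) ->
  (forall y, `|y| <= al ->
     normc (f (sector_map E (ln delta +i* y))) <= expR (- Kc)) -> 0 <= Kc ->
  expR (- L0) <= normc (f (E * (1 - b%:C))) ->
  Kc * (delta `^ g' * (b `^ (- g') - T `^ (- g'))) <=
    ca `^ (- g) / cos (g * al) * Q * b `^ (- g) + L0.
Proof.
move=> al ca tf E1 g0 gg' g'1 d0 db bT Tca Q0 bf nf Kc0 base.
have pi0 := pi_gt0 R.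
have g'0 : 0 < g' by lra.
have alE : g' * al = pi / 2 by rewrite /al; field; rewrite gt_eqF.
have al0 : 0 < al by rewrite divr_gt0 // mulr_gt0.
have al2 : al < pi / 2 by rewrite -alE ltr_pMl.
have gal : 0 <= g * al < pi / 2.
  by rewrite mulr_ge0 ?(ltW g0) ?(ltW al0) //= -alE ltr_pM2r.
have cg0 : 0 < cos (g * al) by apply: cos_gt0_pihalf; lra.
have ca0 : 0 < ca by rewrite divr_gt0 // cos_gt0_pihalf //; lra.
have ca1 : ca <= 1 / 2 by rewrite /ca ler_pM2r ?invr_gt0 // cos_le1.
have b0 : 0 < b by exact: lt_le_trans db.
have T0 : 0 < T by exact: lt_le_trans bT.
have T1 : T <= 1 by apply: le_trans Tca (cos_le1 _).
pose K : set R[i] := [set z | [/\ ln delta <= complex.Re z, complex.Re z <= ln T &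
   `|complex.Im z| <= al]].
pose B : set R[i] := [set z | [\/ complex.Re z <= ln delta, ln T <= complex.Re z |
   al <= `|complex.Im z|]].
pose C1 := ca `^ (- g) / cos (g * al) * Q.
have C10 : 0 <= C1 by rewrite mulr_ge0 // divr_ge0 ?powR_ge0 // ltW.
pose A := Kc * delta `^ g'.
have A0 : 0 <= A by rewrite mulr_ge0 // powR_ge0.
pose h z := - C1 * complex.Re (cexp ((- g)%:C * z)) +
   A * (complex.Re (cexp ((- g')%:C * z)) + - T `^ (- g')).
have Kr z : K z -> expR (complex.Re z) <= T.
  by move=> [_ + _]; rewrite -ler_expR lnK.
have Kd z : K z -> delta <= expR (complex.Re z).
  by move=> [+ _ _]; rewrite -ler_expR lnK.
have Knorm z : K z -> normc (sector_map E z) <= 1 - ca * expR (complex.Re z).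
  move=> Kz; apply: sector_map_norm => //; first by lra.
  - by case: Kz.
  - exact: le_trans (Kr _ Kz) Tca.
have K1 z : K z -> normc (sector_map E z) < 1.
  move=> /Knorm /le_lt_trans; apply; have := expR_gt0 (complex.Re z); nra.
pose phi z := f (sector_map E z).
have phi_le z : K z -> normc (phi z) <= expR (C1 * complex.Re (cexp ((- g)%:C * z))).
  move=> Kz; have r0 := expR_gt0 (complex.Re z).
  have n1 := Knorm _ Kz.
  have cr : 0 < ca * expR (complex.Re z) by rewrite mulr_gt0.
  apply: le_trans (bf _ _) _.
    by apply: le_trans n1 _; rewrite lerD2l lerN2 ler_pM2l // Kd.
  rewrite ler_expR Re_cexpZ.
  have h1 : (1 - normc (sector_map E z)) `^ (- g) <= (ca * expR (complex.Re z)) `^ (- g).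
    rewrite !powRN lef_pV2 ?posrE ?powR_gt0 //; last by lra.
    by rewrite ge0_ler_powR ?nnegrE ?(ltW g0) // ?(ltW cr) //; lra.
  apply: le_trans (ler_wpM2l Q0 h1) _.
  rewrite powRM ?(ltW ca0) ?(ltW r0) // (powR_expR_ln _ r0) expRK.
  have h2 : cos (g * al) <= cos (- g * complex.Im z).
    apply: cos_ge_cos; last by lra.
    by rewrite normrM normrN (gtr0_norm g0) ler_pM2l //; case: Kz.
  have e0 := expR_gt0 (- g * complex.Re z).
  have p0 : 0 <= ca `^ (- g) by exact: powR_ge0.
  rewrite /C1 [leRHS](_ : _ = Q * (ca `^ (- g) * expR (- g * complex.Re z)) *
    (cos (- g * complex.Im z) / cos (g * al))); last by ring.
  rewrite ler_peMr ?mulr_ge0 ?(ltW e0) //.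
  by rewrite ler_pdivlMr // mul1r.
have bK z : K z -> normc z <= `|ln delta| + `|ln T| + al.
  move=> [x1 x2 y1]; apply: le_trans (normc_le_sum _) _; apply: lerD => //.
  rewrite ler_norml; apply/andP; split.
    have := ler_norm (- ln delta); have := normr_ge0 (ln T); rewrite normrN; lra.
  have := ler_norm (ln T); have := normr_ge0 (ln delta); lra.
have step : forall z, K z -> normc (phi z) * expR (h z) <= 1.
  apply: (@max_principle _ K B phi h 1 (`|ln delta| + `|ln T| + al)) => //.
  - move=> z nK.
    have dist w : `|complex.Re w - complex.Re z| <= normc (w - z) /\
         `|complex.Im w - complex.Im z| <= normc (w - z).
      have := normc_ge_Re (w - z); have := normc_ge_Im (w - z).
      by case: (w) (z) => a c [u v].
    have [x1|x1] := ltP (complex.Re z) (ln delta).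
      exists (ln delta - complex.Re z); first by rewrite subr_gt0.
      move=> w wz [w1 _ _]; have [+ _] := dist w; rewrite ler_norml => /andP[_]; lra.
    have [x2|x2] := ltP (ln T) (complex.Re z).
      exists (complex.Re z - ln T); first by rewrite subr_gt0.
      move=> w wz [_ w1 _]; have [+ _] := dist w; rewrite ler_norml => /andP[+ _]; lra.
    have [y1|y1] := ltP al `|complex.Im z|; last by exfalso; apply: nK.
    exists (`|complex.Im z| - al); first by rewrite subr_gt0.
    move=> w wz [_ _ w1]; have [_] := dist w.
    have := ler_normB (complex.Im w) (complex.Im w - complex.Im z).
    rewrite opprB addrC subrK; lra.
  - apply: ctn_inM; first by apply: ctn_sector => z /K1/tf.
    apply: (@ctn_in_comp _ _ h); last by move=> z _; exact: continuous_expR.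
    have cRe (s : R) : ctn_in K (fun z => complex.Re (cexp (s%:C * z))).
      move=> z _ e e0; have [d d0' dP] := cexp_continuous (s%:C * z) e0.
      have s1 : 0 < `|s| + 1 by rewrite ltr_wpDl.
      exists (d / (`|s| + 1)); first by rewrite divr_gt0.
      move=> w _; rewrite ltr_pdivlMr // => wz.
      have := dP (s%:C * w); rewrite -mulrBr normcM normc_real => /(_ _).
      have -> : `|s| * normc (w - z) < d.
        by have := normc_ge0 (w - z); lra.
      move=> /(_ isT); apply: le_lt_trans; have := normc_ge_Re (cexp (s%:C * w) - cexp (s%:C * z)).
      by rewrite raddfB.
    apply: ctn_inD; apply: ctn_inM; rewrite -/al //; try exact: ctn_in_cst.
    by apply: ctn_inD; [exact: cRe|exact: ctn_in_cst].
  - move=> z Kz nB; split.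
    + have [x1 x2 y1] : [/\ ln delta < complex.Re z, complex.Re z < ln T &
          `|complex.Im z| < al].
        split; rewrite ltNge; apply/negP => ?; apply: nB;
          [exact: Or31|exact: Or32|exact: Or33].
      exists (Num.min (complex.Re z - ln delta) (Num.min (ln T - complex.Re z) (al - `|complex.Im z|))).
        by rewrite !lt_min !subr_gt0 x1 x2 y1.
      move=> w; rewrite !lt_min => /and3P[w1 w2 w3].
      have := normc_ge_Re (w - z); have := normc_ge_Im (w - z).
      have := ler_normD (complex.Im w - complex.Im z) (complex.Im z); rewrite subrK.
      case: (w) (z) x1 x2 y1 w1 w2 w3 => a c [u v] /= x1 x2 y1 w1 w2 w3 i1 i2.
      rewrite ler_norml => /andP[j1 j2].
      by split=> /=; lra.
    + apply: cross_taylor2_mul; apply: cross_taylor2_comp; last exact: sector_map_taylor2.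
      by apply: tf; exact: K1.
    + apply: add_harmonicD; apply: add_harmonicZ.
        exact: cross_taylor2_Re (cross_taylor2_cexp _ _).
      apply: add_harmonicD; last exact: add_harmonic_cst.
      exact: cross_taylor2_Re (cross_taylor2_cexp _ _).
  - move=> z Kz; have p1 := phi_le _ Kz.
    (* the sides and the far arc are treated alike *)
    have side : complex.Re (cexp ((- g')%:C * z)) <= T `^ (- g') ->
        normc (phi z) * expR (h z) <= 1.
      move=> le; apply: le_trans (ler_wpM2r (expR_ge0 _) p1) _.
      rewrite -expRD -expR0 ler_expR /h.
      have : A * (complex.Re (cexp ((- g')%:C * z)) + - T `^ (- g')) <= 0.
        by rewrite mulr_ge0_le0 // subr_le0.
      lra.
    have ge0 : 0 <= C1 * complex.Re (cexp ((- g)%:C * z)).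
      rewrite mulr_ge0 // Re_cexpZ mulr_ge0 ?expR_ge0 // ltW //.
      apply: lt_le_trans cg0 _; apply: cos_ge_cos; last by lra.
      by rewrite normrM normrN (gtr0_norm g0) ler_pM2l //; case: Kz.
    move=> [x1|x1|y1].
    + have {}x1 : complex.Re z = ln delta.
        by apply/eqP; rewrite eq_le x1; case: Kz.
      have zE : z = ln delta +i* complex.Im z by case: (z) x1 => u v /= ->.
      have n1 : normc (phi z) <= expR (- Kc) by rewrite /phi zE; apply: nf; case: Kz.
      have : h z <= Kc.
        rewrite /h; apply: (@le_trans _ _ (A * complex.Re (cexp ((- g')%:C * z)))).
          have : 0 <= A * T `^ (- g') by rewrite mulr_ge0 // powR_ge0.
          lra.
        rewrite Re_cexpZ x1 -(powR_expR_ln _ d0) /A -mulrA mulrA -[leRHS]mulr1 -mulrA.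
        rewrite ler_wpM2l // mulrA -powRD; last by apply/implyP => _; rewrite gt_eqF.
        by rewrite subrr powRr0 mul1r cos_le1.
      rewrite -ler_expR => h1.
      apply: le_trans (ler_pM (normc_ge0 _) (expR_ge0 _) n1 h1) _.
      by rewrite -expRD addNr expR0.
    + have {}x1 : complex.Re z = ln T.
        by apply/eqP; rewrite eq_le x1 andbT; case: Kz.
      apply: side; rewrite Re_cexpZ x1 -(powR_expR_ln _ T0).
      by rewrite ler_piMr ?powR_ge0 // cos_le1.
    + have {}y1 : `|complex.Im z| = al.
        by apply/eqP; rewrite eq_le y1 andbT; case: Kz.
      apply: side; rewrite Re_cexpZ.
      rewrite (_ : cos (- g' * complex.Im z) = 0) ?mulr0 ?powR_ge0 //.
      rewrite mulNr cosN.
      have [y0|y0] := leP 0 (complex.Im z).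
        by rewrite ger0_norm // in y1; rewrite y1 alE cos_pihalf.
      rewrite ltr0_norm // in y1.
      by rewrite -cosN -mulrN y1 alE cos_pihalf.
have Kb : K ((ln b)%:C).
  split => /=; [by rewrite ler_ln ?posrE|by rewrite ler_ln ?posrE|].
  by rewrite normr0 ltW.
have := step _ Kb.
have -> : phi ((ln b)%:C) = f (E * (1 - b%:C)).
  by rewrite /phi /sector_map /cexp /= sin0 cos0 lnK ?posrE // mulr1 mulr0.
have -> : h ((ln b)%:C) = - C1 * b `^ (- g) + A * (b `^ (- g') + - T `^ (- g')).
  by rewrite /h !Re_cexpZ /= !mulr0 cos0 !mulr1 -!powR_expR_ln.
move=> /(le_trans (ler_wpM2r (expR_ge0 _) base)).
rewrite -expRD -expR0 ler_expR /A /C1; lra.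
Qed.

End sector_two_constants.

(** * A lower bound at base points, uniform in the direction *)

Section uniform_lower_bound.
Context {R : realType}.
Implicit Types (f : R[i] -> R[i]) (z w E : R[i]).

Lemma disc_bounded f (rho : R) : 0 <= rho ->
  (forall z, normc z <= rho -> taylor2 f z) ->
  exists2 M, 1 <= M & forall z, normc z <= rho -> normc (f z) <= expR M.
Proof.
move=> rho0 tf; pose K : set R[i] := [set z | normc z <= rho].
have Kc z : ~ K z -> open_at (~` K) z by exact: disc_compl_open.
have [| | |[a b] _ pmax] := @compact_EVT_max _ R ((fun z => normc (f z)) \o cx)
    [set p | K (cx p)].
- by exists (0, 0); rewrite /K /cx /= expr0n addr0 sqrtr0.
- by apply: (@compact_cx _ K rho).
- by apply: ctn_in_within; exact: taylor2_ctn.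
exists (1 + normc (f (cx (a, b)))); first by rewrite lerDl normc_ge0.
move=> z zr; have := pmax (complex.Re z, complex.Im z); rewrite inE /= => h.
have {h} : normc (f z) <= normc (f (cx (a, b))).
  by move: h zr; case: z => u v; rewrite /cx /= => h /h.
have := @expR_ge1Dx R (1 + normc (f (cx (a, b)))); lra.
Qed.

(** The zeros of [f] may lie on any given circle, so a base point is looked for
    on a radial segment.  If [f] were tiny on a whole segment, equally spaced
    points of it would force [f z0] to be tiny as well. *)
Lemma radial_lower_bound f (b1 b2 : R) (z0 : R[i]) :
  (forall z, normc z < 1 -> taylor2 f z) -> normc z0 < 1 -> f z0 != 0 ->
  0 < b1 -> b1 < b2 -> b2 < 1 ->
  exists2 L0, 0 <= L0 & forall E, normc E = 1 ->
    exists b, [/\ b1 <= b, b <= b2 & expR (- L0) <= normc (f (E * (1 - b%:C)))].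
Proof.
move=> tf z01 fz0 b10 b12 b21.
pose rho := (1 + Num.max (normc z0) (1 - b1)) / 2.
have [m1 m2] : normc z0 <= Num.max (normc z0) (1 - b1) /\
    1 - b1 <= Num.max (normc z0) (1 - b1) by rewrite !le_max !lexx ?orbT.
have m3 : Num.max (normc z0) (1 - b1) < 1 by rewrite gt_max z01 /=; lra.
have z00 := normc_ge0 z0.
have rho0 : 0 < rho by rewrite /rho; lra.
have rho1 : rho < 1 by rewrite /rho; lra.
have z0r : normc z0 < rho by rewrite /rho; lra.
have br : 1 - b1 < rho by rewrite /rho; lra.
have tf' z : normc z <= rho -> taylor2 f z by move=> zr; apply: tf; exact: le_lt_trans rho1.
have [M M1 bf] := disc_bounded (ltW rho0) tf'.
pose x := (rho ^+ 2 - (1 - b1) ^+ 2) * (rho ^+ 2 - normc z0 ^+ 2) / 4.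
have r1 : 0 < rho ^+ 2 - (1 - b1) ^+ 2.
  by rewrite subr_sqr mulr_gt0 //; lra.
have r2 : 0 < rho ^+ 2 - normc z0 ^+ 2.
  by rewrite subr_sqr mulr_gt0 //; lra.
have x0 : 0 < x by rewrite divr_gt0 // mulr_gt0.
pose kap := ln (1 + x) / 2.
have kap0 : 0 < kap by rewrite divr_gt0 // ln_gt0 //; lra.
have f0 : 0 < normc (f z0) by rewrite normc_gt0.
pose Kb := Num.max 0 (- ln (normc (f z0))).
have Kb0 : 0 <= Kb by rewrite le_max lexx.
have fKb : expR (- Kb) <= normc (f z0).
  by rewrite -[leRHS]lnK ?posrE // ler_expR lerNl /Kb le_max lexx orbT.
pose S := ln (12 * 2 / (b2 - b1)) + 2.
pose L := Num.max Kb ((Kb + M) * S / kap) + 1.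
have LK : Kb < L by rewrite /L ltr_pwDr // le_max lexx.
have LS : (Kb + M) * S < L * kap.
  by rewrite -ltr_pdivrMr // /L ltr_pwDr // le_max lexx orbT.
exists L; first by apply: le_trans (ltW LK).
move=> E E1; apply: contrapT => H.
have small b : b1 <= b -> b <= b2 -> normc (f (E * (1 - b%:C))) <= expR (- L).
  by move=> h1 h2; rewrite leNgt; apply/negP => h3; apply: H; exists b; split => //; exact: ltW.
have nb (b : R) : b1 <= b -> b <= b2 -> normc (E * (1 - b%:C)) = 1 - b.
  move=> h1 h2; rewrite normcM E1 mul1r -(rmorph1 (real_complex R)) -rmorphB normc_real.
  by rewrite ger0_norm //; lra.
have b120 : 0 < b2 - b1 by rewrite subr_gt0.
have /(_ _)[//| | |] := @small_values_spread _ f rho M L Kb kap 2 (b2 - b1) z0 rho0 tf' bf M1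
  (ltW z0r) fKb Kb0 b120; [by lra| |by rewrite leNgt LK|by rewrite leNgt LS].
move=> n n0; have n0' : (0 : R) < n%:R by rewrite ltr0n.
pose s (i : nat) := b1 + (b2 - b1) * (i%:R / n%:R).
have sP i : (i < n)%N -> b1 <= s i /\ s i <= b2.
  move=> ni; have : 0 <= i%:R / n%:R :> R by rewrite divr_ge0.
  have : i%:R / n%:R <= 1 :> R by rewrite ler_pdivrMr // mul1r ler_nat ltnW.
  by rewrite /s => h1 h2; split; nra.
exists (fun i => E * (1 - (s i)%:C)); split.
- move=> i /sP[s1 s2]; rewrite (nb _ s1 s2); split.
  + lra.
  + exact: small.
  + have := sqr_ge0 (1 - s i); have : rho ^+ 2 <= rho * 2.
      by rewrite expr2 ler_pM2l //; lra.
    lra.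
  + move=> za; apply: green_ge => //; first by rewrite (nb _ s1 s2); lra.
    * exact: ltW.
    * exact: ltW.
    rewrite (nb _ s1 s2) normcM normc_real exprMn.
    have d2 : normc (z0 - E * (1 - (s i)%:C)) <= 2.
      by apply: le_trans (normcB _ _) _; rewrite (nb _ s1 s2); lra.
    have d4 : normc (z0 - E * (1 - (s i)%:C)) ^+ 2 <= 4.
      rewrite (_ : 4 = 2 ^+ 2) ?ler_pXn2r ?nnegrE ?normc_ge0 //.
      by rewrite -natrX.
    have rr : `|rho| ^+ 2 <= 1 by rewrite real_normK ?num_real // expr_le1 // ltW.
    apply: (@le_trans _ _ (x * 4)).
      rewrite ler_pM2l //; rewrite -[leRHS]mul1r; apply: ler_pM => //; exact: sqr_ge0.
    rewrite /x divfK // ler_wpM2r ?(ltW r2) // lerD2l lerN2.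
    by rewrite lerXn2r ?nnegrE //; lra.
- move=> i j ni nj; have [s1 s2] := sP _ ni; have [s3 s4] := sP _ nj.
  have -> : E * (1 - (s i)%:C) - E * (1 - (s j)%:C) = E * (s j - s i)%:C.
    by rewrite rmorphB /=; ring.
  rewrite normcM E1 mul1r normc_real; apply/andP; split; last first.
    by rewrite ler_norml; apply/andP; split; lra.
  have -> : s j - s i = (j%:R - i%:R) * ((b2 - b1) / n%:R).
    by rewrite /s; field; rewrite gt_eqF.
  rewrite normrM (gtr0_norm (divr_gt0 b120 n0')).
  rewrite ler_wpM2r ?(ltW (divr_gt0 b120 n0')) //.
  have [ij|ji] := leqP i j.
    have ij0 : (i - j = 0)%N by apply/eqP; rewrite subn_eq0.
    by rewrite ij0 max0n (natrB _ ij); exact: ler_norm.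
  have ji0 : (j - i = 0)%N by apply/eqP; rewrite subn_eq0 ltnW.
  by rewrite ji0 maxn0 (natrB _ (ltnW ji)) distrC; exact: ler_norm.
Qed.

End uniform_lower_bound.

(** * Spaced points in a set of positive measure *)

Section spaced_points.
Context {R : realType}.
Local Notation mu := (@lebesgue_measure R).

(** Greedy choice: take a point of [A] close to its infimum and drop the part of
    [A] within distance [d], which costs only a little more than [d]. *)
Lemma spaced_points (A : set R) (d u v : R) (n : nat) : 0 <= d ->
  measurable A -> A `<=` `[u, v]%classic -> ((n%:R * d)%:E < mu A)%E ->
  exists t : nat -> R, (forall i, (i <= n)%N -> A (t i)) /\
    forall i j, (i <= j)%N -> (j <= n)%N -> (j - i)%:R * d <= t j - t i.
Proof.
move=> d0; elim: n A => [|n ih] A mA Auv Ad.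
  have [a Aa] : A !=set0.
    apply/set0P; apply: contraTneq Ad => ->; rewrite measure0 mul0r ltxx //.
  exists (fun=> a); split => // i j ij; rewrite leqn0 => /eqP j0.
  by move: ij; rewrite j0 leqn0 => /eqP ->; rewrite subnn mul0r subrr.
have fA : mu A \is a fin_num.
  rewrite ge0_fin_numE //; apply: le_lt_trans (_ : (mu `[u, v]%classic < +oo)%E).
    by apply: le_measure => //; rewrite inE //; exact: measurable_itv.
  by rewrite lebesgue_measure_itv /=; case: ifP => _; rewrite ?ltry // -EFinD ltry.
have A0 : A !=set0.
  apply/set0P; apply: contraTneq Ad => ->; rewrite measure0 -leNgt lee_fin mulr_ge0 //.
have hA : has_inf A.
  split=> //; exists u => a /Auv; rewrite /= in_itv /= => /andP[]//.
pose m0 := fine (mu A).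
have m0E : mu A = m0%:E by rewrite fineK.
have e0 : 0 < m0 - n.+1%:R * d by rewrite subr_gt0 -lte_fin -m0E.
have [t0 At0 t0i] := inf_adherent e0 hA.
pose A' := A `&` `[t0 + d, +oo[%classic.
have mA' : measurable A' by apply: measurableI => //; exact: measurable_itv.
have A'd : ((n%:R * d)%:E < mu A')%E.
  have sub : A `<=` `[inf A, t0 + d]%classic `|` A'.
    move=> a Aa; have [ad|da] := leP a (t0 + d).
      by left; rewrite /= in_itv /= ad andbT; apply: inf_lbound => //; case: hA.
    by right; split => //; rewrite /= in_itv /= andbT ltW.
  have : (mu A <= mu `[inf A, (t0 + d)%R]%classic + mu A')%E.
    have mI : measurable (`[inf A, (t0 + d)%R]%classic : set R).
      exact: measurable_itv.
    apply: (le_trans _ (measureU2 mu mI mA')).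
    by apply: le_measure => //; rewrite inE //; exact: measurableU.
  have it0 : inf A <= t0 by apply: inf_lbound => //; case: hA.
  rewrite lebesgue_measure_itv /= lte_fin; case: ifPn => [_|]; last first.
    rewrite -leNgt => td; rewrite add0e m0E => /(lt_le_trans _); apply.
    rewrite lte_fin; move: e0; rewrite subr_gt0 => /(le_lt_trans _); apply.
    by rewrite ler_wpM2r // ler_nat.
  rewrite m0E -EFinD -leeBlDl // -EFinB => /(lt_le_trans _); apply.
  by rewrite lte_fin; move: t0i; rewrite -natr1; lra.
have [|t [tA tP]] := ih A' mA' _ A'd; first by move=> a [/Auv].
exists (fun i => if i is i'.+1 then t i' else t0); split.
  by case=> // i; rewrite ltnS => /tA[].
case=> [|i] [|j] //; rewrite ?ltnS ?subnn ?mul0r ?subrr //; last first.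
  by rewrite subSS; exact: tP.
move=> _ jn; have := tP 0%N j (leq0n _) jn; rewrite subn0.
have [_] := tA 0%N (leq0n _); rewrite /= in_itv /= andbT subn0 -natr1; lra.
Qed.

End spaced_points.

(** * Sublevel sets on an arc *)

Section arc_estimate.
Context {R : realType}.
Implicit Types (f : R[i] -> R[i]) (z w E : R[i]) (r s t : R).
Local Notation mu := (@lebesgue_measure R).

Lemma circle_pointE r t : circle_point r t = r%:C * cexp (0 +i* t).
Proof.
by rewrite /circle_point /cexp /= expR0; apply/eqP; rewrite eq_complex /=;
  apply/andP; split; apply/eqP; ring.
Qed.

Lemma normc_circle_point r t : 0 <= r -> normc (circle_point r t) = r.
Proof.
by move=> r0; rewrite circle_pointE normcM normc_real normc_cexp /= expR0 mulr1 ger0_norm.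
Qed.

Lemma chord_bounds r s t : 1 / 2 <= r <= 1 -> `|s - t| <= 1 / 4 ->
  `|s - t| / 4 <= normc (circle_point r s - circle_point r t) <= 2 * `|s - t|.
Proof.
move=> /andP[r1 r2] st.
have r0 : 0 <= r by lra.
have -> : normc (circle_point r s - circle_point r t) = Num.sqrt (r ^+ 2 * (2 - 2 * cos (s - t))).
  rewrite /circle_point /=; congr Num.sqrt; rewrite cosB.
  have -> : (r * cos s - r * cos t) ^+ 2 + (r * sin s - r * sin t) ^+ 2 =
    r ^+ 2 * ((cos s ^+ 2 + sin s ^+ 2) + (cos t ^+ 2 + sin t ^+ 2) -
              2 * (cos s * cos t + sin s * sin t)) by ring.
  by rewrite !cos2Dsin2.
set x := s - t in st *.
have [_ h] := @sin_approx R x ltac:(lra).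
have x0 := normr_ge0 x.
have x2 : x ^+ 2 = `|x| ^+ 2 by rewrite real_normK ?num_real.
rewrite x2 in h.
set y := `|x| in st x0 h *.
have y3 : y ^+ 3 <= y ^+ 2 / 4.
  by rewrite exprSr ler_wpM2l ?sqr_ge0 //; lra.
move: h; rewrite ler_norml => /andP[h1 h2].
have r4 : 1 / 4 <= r ^+ 2 by rewrite expr2; nra.
have r5 : r ^+ 2 <= 1 by rewrite expr_le1.
have c1 : y ^+ 2 / 2 <= 2 - 2 * cos x by lra.
have c2 : 2 - 2 * cos x <= 2 * y ^+ 2 by lra.
have y20 := sqr_ge0 y.
apply/andP; split.
  rewrite -(@ler_pXn2r _ 2%N) ?nnegrE ?sqrtr_ge0 ?divr_ge0 //.
  rewrite sqr_sqrtr; last by rewrite mulr_ge0 ?sqr_ge0 //; lra.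
  by rewrite expr_div_n; nra.
rewrite -(@ler_pXn2r _ 2%N) ?nnegrE ?sqrtr_ge0 ?mulr_ge0 //.
rewrite sqr_sqrtr; last by rewrite mulr_ge0 ?sqr_ge0 //; lra.
by rewrite exprMn; nra.
Qed.

Lemma continuous_circle f r : (forall z, normc z < 1 -> taylor2 f z) ->
  0 <= r -> r < 1 -> continuous (fun t => normc (f (circle_point r t))).
Proof.
move=> tf r0 r1 t; apply/cvgrPdist_lt => e e0.
have tz : taylor2 f (circle_point r t) by apply: tf; rewrite normc_circle_point.
have [d d0 dP] := taylor2_continuous tz e0.
have [d' d'0 d'P] := cexp_continuous (0 +i* t) d0.
near=> s.
apply: le_lt_trans (ler_dist_normc _ _) _; rewrite normcBC; apply: dP.
rewrite !circle_pointE -mulrBr normcM normc_real ger0_norm //.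
apply: le_lt_trans (_ : normc (cexp (0 +i* s) - cexp (0 +i* t)) < d).
  by rewrite ler_piMl ?normc_ge0 // ltW.
apply: d'P; apply: le_lt_trans (normc_le_sum _) _; rewrite /= subrr normr0 add0r.
by rewrite distrC; near: s; exact: cvgr_dist_lt.
Unshelve. all: end_near. Qed.

Lemma measurable_circle_sublevel f r (x : R) :
  (forall z, normc z < 1 -> taylor2 f z) -> 0 <= r -> r < 1 ->
  measurable [set t | normc (f (circle_point r t)) <= x].
Proof.
move=> tf r0 r1.
have mF : measurable_fun setT (fun t => normc (f (circle_point r t))).
  by apply: continuous_measurable_fun; exact: continuous_circle.
rewrite (_ : [set t | _] = (fun t => normc (f (circle_point r t))) @^-1` `]-oo, x]).
  by rewrite -[X in measurable X]setTI; apply: mF => //; exact: measurable_itv.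
by apply/seteqP; split => t /=; rewrite in_itv.
Qed.


(** The points to which [small_values_spread] is applied.  The distance between
    [zs] and the arc is at most of order [delta], and their distances to the
    circle of radius [rho] are at least of that order; hence the constant lower
    bound for the Green function. *)
Lemma arc_points (c1 delta m : R) (zs : R[i]) (t0 : R) (A : set R) (n : nat) :
  let rho := 1 - c1 * delta in let r := 1 - delta in
  0 < c1 -> c1 <= 1 / 4 -> 0 < delta -> delta <= 1 / 4 ->
  normc zs <= 1 - 2 * (c1 * delta) ->
  normc (zs - cexp (0 +i* t0)) <= delta ->
  measurable A -> A `<=` `[t0, t0 + delta]%classic -> 0 < m -> mu A = m%:E ->
  (0 < n)%N ->
  exists t : nat -> R, [/\ (forall i, (i < n)%N -> A (t i)),
    (forall i, (i < n)%N ->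
       zs != circle_point r (t i) ->
       ln (1 + c1 / 64) / 2 <= green rho (circle_point r (t i)) zs) &
    forall i j, (i < n)%N -> (j < n)%N ->
      (maxn (i - j) (j - i))%:R * (m / 4 / n%:R) <=
      normc (circle_point r (t i) - circle_point r (t j)) <= 4 * delta].
Proof.
move=> rho r c10 c14 d0 d4 zs1 zsE mA Aitv m0 mAE.
case: n => // n _.
have m0n : 0 < m / n.+1%:R by rewrite divr_gt0.
have [||t [tA tP]] := @spaced_points _ A (m / n.+1%:R) t0 (t0 + delta) n _ mA Aitv.
- exact: ltW.
- by rewrite mAE lte_fin mulrA ltr_pdivrMr // mulrC ltr_pM2l // ltr_nat.
have tI i : (i < n.+1)%N -> t0 <= t i <= t0 + delta.
  by rewrite ltnS => /tA/Aitv; rewrite /= in_itv.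
have r0 : 3 / 4 <= r by rewrite /r; clear -d4; lra.
have r1 : r < 1 by rewrite /r; clear -d0; lra.
have cd0 : 0 < c1 * delta by rewrite mulr_gt0.
have cd4 : c1 * delta <= delta / 4.
  by rewrite [leRHS]mulrC ler_pM2r //; clear -c14; lra.
have r_rho : r + 3 / 4 * delta <= rho by rewrite /r /rho; clear -cd4; lra.
have rho1 : rho <= 1 by rewrite /rho; clear -cd0; lra.
exists t; split.
- by move=> i; rewrite ltnS; apply: tA.
- move=> i ni za.
  have /andP[ti1 ti2] := tI _ ni.
  have zsa : normc (zs - circle_point r (t i)) <= 4 * delta.
    have -> : zs - circle_point r (t i) = (zs - cexp (0 +i* t0)) -
       (circle_point 1 (t i) - circle_point 1 t0) +
       (circle_point 1 (t i) - circle_point r (t i)).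
      by rewrite (circle_pointE 1 t0) mul1r; ring.
    have h1 : normc (circle_point 1 (t i) - circle_point r (t i)) = delta.
      rewrite !circle_pointE -mulrBl normcM -rmorphB normc_real normc_cexp /= expR0 mulr1.
      by rewrite ger0_norm /r; clear -d0; lra.
    have td : `|t i - t0| <= delta.
      by rewrite ger0_norm; clear -ti1 ti2; lra.
    have /andP[_ h2] := @chord_bounds 1 (t i) t0 ltac:(clear; lra)
      ltac:(clear -td d4; lra).
    apply: le_trans (normcD _ _) _; rewrite h1.
    have := normcB (zs - cexp (0 +i* t0)) (circle_point 1 (t i) - circle_point 1 t0).
    move=> h3; clear -h2 h3 td zsE; lra.
  have nr : normc (circle_point r (t i)) = r.
    by rewrite normc_circle_point //; clear -r0; lra.
  have rho0 : 3 / 4 <= rho by clear -r_rho r0 d0; lra.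
  apply: green_ge => //.
  + by clear -rho0; lra.
  + by rewrite nr; clear -r_rho d0; lra.
  + by rewrite /rho; clear -zs1 cd0; lra.
  + by rewrite divr_ge0 ?(ltW c10).
  rewrite nr normcM normc_real exprMn real_normK ?num_real //.
  have z4 : normc (zs - circle_point r (t i)) ^+ 2 <= 16 * delta ^+ 2.
    rewrite (_ : 16 * delta ^+ 2 = (4 * delta) ^+ 2); last by ring.
    by rewrite ler_pXn2r ?nnegrE ?normc_ge0 ?mulr_ge0 ?(ltW d0).
  have q1 : 3 / 4 * delta <= rho ^+ 2 - r ^+ 2.
    rewrite subr_sqr -[leLHS]mulr1; apply: ler_pM => //.
    * by rewrite mulr_ge0 // ?(ltW d0) // divr_ge0.
    * by clear -r_rho; lra.
    * by clear -rho0 r0; lra.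
  have q2 : c1 * delta / 2 <= rho ^+ 2 - normc zs ^+ 2.
    rewrite subr_sqr; apply: ler_pM => //.
    * exact: ltW.
    * by rewrite /rho; clear -zs1; lra.
    * by have := normc_ge0 zs; clear -rho0; lra.
  have q3 : 0 <= c1 * delta / 2 by rewrite divr_ge0 // ltW.
  have q4 : 0 <= 3 / 4 * delta by rewrite mulr_ge0 ?(ltW d0) // divr_ge0.
  apply: le_trans (ler_pM q4 q3 q1 q2).
  have rho2 : rho ^+ 2 <= 1 by rewrite expr_le1 //; clear -rho0; lra.
  have p1 : rho ^+ 2 * normc (zs - circle_point r (t i)) ^+ 2 <= 1 * (16 * delta ^+ 2).
    by apply: ler_pM => //; exact: sqr_ge0.
  apply: le_trans (ler_wpM2l _ p1) _; first by rewrite divr_ge0 ?(ltW c10).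
  have : 0 <= c1 * delta ^+ 2 by rewrite mulr_ge0 ?sqr_ge0 ?(ltW c10).
  by clear; lra.
have H i j : (i <= j)%N -> (j < n.+1)%N -> (j - i)%:R * (m / 4 / n.+1%:R) <=
      normc (circle_point r (t j) - circle_point r (t i)) <= 4 * delta.
  move=> ij nj; have /andP[i1 i2] := tI _ (leq_ltn_trans ij nj).
  have /andP[j1 j2] := tI _ nj.
  have tij := tP _ _ ij nj.
  have ge0 : 0 <= t j - t i by apply: le_trans tij; rewrite mulr_ge0 // ltW.
  have dd : `|t j - t i| <= delta by rewrite ger0_norm //; clear -i1 j2; lra.
  have rr : 1 / 2 <= r <= 1 by apply/andP; split; clear -r0 r1; lra.
  have /andP[h1 h2] := @chord_bounds r (t j) (t i) rr ltac:(clear -dd d4; lra).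
  apply/andP; split; last by clear -h2 dd d0; lra.
  apply: le_trans h1; rewrite (ger0_norm ge0).
  have -> : m / 4 / n.+1%:R = m / n.+1%:R / 4 by rewrite mulrAC.
  by rewrite mulrA ler_pM2r ?invr_gt0.
move=> i j ni nj; have [ij|ji] := leqP i j.
  have ij0 : (i - j = 0)%N by apply/eqP; rewrite subn_eq0.
  by rewrite ij0 max0n normcBC; exact: H.
have ji0 : (j - i = 0)%N by apply/eqP; rewrite subn_eq0 ltnW.
by rewrite ji0 maxn0; apply: H => //; exact: ltnW.
Qed.

(** A measure estimate of John-Nirenberg type: the bound
    [Lam <= B (ln (192 delta / m) + 2)] for the measure [m] of the sublevel set
    is solved for [m]. *)
Lemma arc_measure f (c1 delta Kb M t0 Lam : R) (zs : R[i]) :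
  (forall z, normc z < 1 -> taylor2 f z) ->
  0 < c1 -> c1 <= 1 / 4 -> 0 < delta -> delta <= 1 / 4 ->
  (forall z, normc z <= 1 - c1 * delta -> normc (f z) <= expR M) -> 1 <= M ->
  0 <= Kb -> expR (- Kb) <= normc (f zs) ->
  normc zs <= 1 - 2 * (c1 * delta) ->
  normc (zs - cexp (0 +i* t0)) <= delta -> 0 <= Lam ->
  (mu (`[t0, (t0 + delta)%R] `&`
      [set t : R | (normc (f (circle_point (1 - delta) t)) <= expR (- Lam))%R]) <=
   (192 * expR 2 * delta *
     expR (- Lam / ((Kb + M) / (ln (1 + c1 / 64) / 2))))%:E)%E.
Proof.
move=> tf c10 c14 d0 d4 bM M1 Kb0 fzs zs1 zsE Lam0.
set kap := ln (1 + c1 / 64) / 2.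
have kap0 : 0 < kap by rewrite divr_gt0 // ln_gt0 // ltrDl divr_gt0.
have kap1 : kap <= 1.
  have := @le_ln1Dx R (c1 / 64) ltac:(clear -c10; lra); rewrite /kap; clear -c14; lra.
set A := _ `&` _; set B := (Kb + M) / kap.
have B1 : Kb + M <= B.
  by rewrite ler_pdivlMr // ler_piMr //; clear -Kb0 M1; lra.
have B0 : 0 < B by clear -B1 Kb0 M1; lra.
have mA : measurable A.
  apply: measurableI; first exact: measurable_itv.
  by apply: measurable_circle_sublevel => //; clear -d0 d4; lra.
have Aitv : A `<=` `[t0, t0 + delta]%classic by move=> t [].
have mAd : (mu A <= delta%:E)%E.
  apply: (@le_trans _ _ (mu `[t0, (t0 + delta)%R]%classic)).
    by apply: le_measure => //; rewrite inE //; exact: measurable_itv.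
  by rewrite lebesgue_measure_itv /= lte_fin ltrDl d0 -EFinD lee_fin addrC addKr.
have fA : mu A \is a fin_num.
  by rewrite ge0_fin_numE //; apply: le_lt_trans mAd _; rewrite ltry.
pose m0 := fine (mu A).
have m0E : mu A = m0%:E by rewrite fineK.
rewrite m0E lee_fin; rewrite m0E lee_fin in mAd.
have m00 : 0 <= m0 by rewrite -lee_fin -m0E.
have [->|m0n0] := eqVneq m0 0.
  by rewrite mulr_ge0 ?expR_ge0 // mulr_ge0 ?(ltW d0) // mulr_ge0 // expR_ge0.
have {m0n0}m00 : 0 < m0 by rewrite lt_def m0n0.
set rho := 1 - c1 * delta in bM.
have cd0 : 0 < c1 * delta by rewrite mulr_gt0.
have cd4 : c1 * delta <= delta / 4.
  by rewrite [leRHS]mulrC ler_pM2r //; clear -c14; lra.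
have rho0 : 3 / 4 <= rho by rewrite /rho; clear -cd4 d4; lra.
have rho1 : rho < 1 by rewrite /rho; clear -cd0; lra.
have tf' z : normc z <= rho -> taylor2 f z.
  by move=> zr; apply: tf; exact: le_lt_trans rho1.
have r0 : 0 <= 1 - delta by clear -d4; lra.
have [||||LK|] := @small_values_spread _ f rho M Lam Kb kap (4 * delta) (m0 / 4) zs
    ltac:(clear -rho0; lra) tf' bM M1 _ fzs Kb0.
- by rewrite /rho; clear -zs1 cd0; lra.
- by rewrite divr_gt0.
- by clear -mAd d0; lra.
- move=> n n0.
  have [t [tA tg tP]] := arc_points c10 c14 d0 d4 zs1 zsE mA Aitv m00 m0E n0.
  exists (fun i => circle_point (1 - delta) (t i)); split => [i ni|]; last exact: tP.
  rewrite normc_circle_point //; split.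
  + by rewrite /rho; clear -cd4 d0; lra.
  + by have [] := tA _ ni.
  + apply: (@le_trans _ _ (delta * 2)).
      rewrite subr_sqr; apply: ler_pM; rewrite /rho; clear -cd0 cd4 d0 d4; lra.
    have : rho * (4 * delta) = 4 * delta * rho by ring.
    move=> ->; have : 4 * delta * (3 / 4) <= 4 * delta * rho.
      by rewrite ler_pM2l // mulr_gt0.
    by clear -d0; lra.
  + exact: tg.
- apply: le_trans mAd _.
  have : expR (-1) <= expR (- Lam / B) :> R.
    rewrite ler_expR mulNr lerN2 ler_pdivrMr // mul1r; apply: le_trans LK _.
    by apply: le_trans B1; clear -M1; lra.
  move=> h; apply: (@le_trans _ _ (192 * expR 2 * delta * expR (-1))); last first.
    by rewrite ler_wpM2l // mulr_ge0 ?(ltW d0) // mulr_ge0 // expR_ge0.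
  have : 1 <= expR 2 * expR (-1) :> R.
    by rewrite -expRD -[leLHS]expR0 ler_expR; lra.
  by clear -d0; nra.
rewrite -ler_pdivlMr // => LS.
have e1 : expR (Lam / B) <= 192 * delta / m0 * expR 2.
  have q0 : 0 < 192 * delta / m0 by rewrite divr_gt0 // mulr_gt0.
  rewrite -[192 * delta / m0]lnK ?posrE // -expRD ler_expR ler_pdivrMr //.
  apply: le_trans LS _.
  have -> : 12 * (4 * delta) / (m0 / 4) = 192 * delta / m0.
    by field; rewrite gt_eqF.
  by rewrite mulrAC mulrC.
have e2 : m0 * expR (Lam / B) <= 192 * expR 2 * delta.
  rewrite mulrC -ler_pdivlMr // [leRHS](_ : _ = 192 * delta / m0 * expR 2) //.
  by ring.
by rewrite mulNr expRN ler_pdivlMr // expR_gt0.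
Qed.

End arc_estimate.

(** * Sublevel sets in terms of the growth *)

Section arc_small_values.
Context {R : realType}.
Implicit Types (f : R[i] -> R[i]) (z w E : R[i]) (r s t : R).
Local Notation mu := (@lebesgue_measure R).

Lemma ler_powRN (a b g : R) : 0 <= g -> 0 < a -> a <= b -> b `^ (- g) <= a `^ (- g).
Proof.
move=> g0 a0 ab; have b0 : 0 < b by exact: lt_le_trans ab.
rewrite !powRN lef_pV2 ?posrE ?powR_gt0 //.
by rewrite ge0_ler_powR ?nnegrE ?(ltW a0) ?(ltW b0).
Qed.

Lemma sector_angles (g g' : R) : 0 < g -> g < g' -> 1 < g' ->
  let al := pi / (2 * g') in [/\ 0 <= al, al <= pi / 2, 0 < cos al & 0 < cos (g * al)].
Proof.
move=> g0 gg' g'1 al; have pi0 := pi_gt0 R.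
have g'0 : 0 < g' by lra.
have alE : g' * al = pi / 2 by rewrite /al; field; rewrite gt_eqF.
have al0 : 0 < al by rewrite divr_gt0 // mulr_gt0.
have al2 : al < pi / 2 by rewrite -alE ltr_pMl.
have gal : 0 <= g * al < pi / 2.
  by rewrite mulr_ge0 ?(ltW g0) ?(ltW al0) //= -alE ltr_pM2r.
by split; [exact: ltW|exact: ltW|apply: cos_gt0_pihalf; lra|apply: cos_gt0_pihalf; lra].
Qed.

(** The contrapositive of [sector_two_constants]: the exponent [D / c2
    delta^-g' + 1] is just beyond what that lemma allows. *)
Lemma sector_point f (g g' b1 b2 L0 Q delta : R) E :
  let al := pi / (2 * g') in let ca := cos al / 2 in
  let c2 := b2 `^ (- g') - cos al `^ (- g') in
  let D := ca `^ (- g) / cos (g * al) * Q * b1 `^ (- g) + L0 in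
  (forall z, normc z < 1 -> taylor2 f z) -> normc E = 1 ->
  0 < g -> g < g' -> 1 < g' -> 0 < delta -> delta <= b1 -> b2 < cos al ->
  0 <= Q -> 0 <= L0 ->
  (forall z, normc z <= 1 - ca * delta ->
     normc (f z) <= expR (Q * (1 - normc z) `^ (- g))) ->
  (exists b, [/\ b1 <= b, b <= b2 & expR (- L0) <= normc (f (E * (1 - b%:C)))]) ->
  exists y, `|y| <= al /\
    expR (- (D / c2 * delta `^ (- g') + 1)) <=
      normc (f (sector_map E (ln delta +i* y))).
Proof.
move=> al ca c2 D tf E1 g0 gg' g'1 d0 db1 b2T Q0 L00 bf [b [b1b bb2 fb]].
have [al0 al2 T0 cg0] := sector_angles g0 gg' g'1; rewrite -/al in al0 al2 T0 cg0.
have ca0 : 0 < ca by rewrite divr_gt0.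
have b10 : 0 < b1 by exact: lt_le_trans db1.
have b0 : 0 < b by exact: lt_le_trans b1b.
have b20 : 0 < b2 by exact: lt_le_trans bb2.
have g'0 : 0 < g' by clear -g'1; lra.
have c20 : 0 < c2.
  rewrite /c2 subr_gt0 !powRN ltf_pV2 ?posrE ?powR_gt0 //.
  by rewrite gt0_ltr_powR ?nnegrE ?(ltW b20) ?(ltW T0).
have C10 : 0 <= ca `^ (- g) / cos (g * al) * Q.
  by rewrite mulr_ge0 // divr_ge0 ?powR_ge0 // ltW.
have D0 : 0 <= D by rewrite addr_ge0 // mulr_ge0 // powR_ge0.
set Kb := D / c2 * delta `^ (- g') + 1.
have Kb0 : 0 <= Kb by rewrite addr_ge0 // mulr_ge0 ?powR_ge0 // divr_ge0 // ltW.
apply: contrapT => H.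
have small y : `|y| <= al ->
    normc (f (sector_map E (ln delta +i* y))) <= expR (- Kb).
  move=> yal; rewrite leNgt; apply/negP => h; apply: H; exists y; split=> //.
  exact: ltW.
have db : delta <= b by exact: le_trans b1b.
have bT : b <= cos al by apply: ltW; exact: le_lt_trans b2T.
have := sector_two_constants tf E1 g0 gg' g'1 d0 db bT (lexx _) Q0 bf small Kb0 fb.
rewrite -/al -/ca; apply/negP; rewrite -ltNge.
have bb1 : b `^ (- g) <= b1 `^ (- g) by apply: ler_powRN => //; exact: ltW.
have c2b : c2 <= b `^ (- g') - cos al `^ (- g').
  by rewrite /c2 lerD2r; apply: ler_powRN => //; exact: ltW.
have dp : 0 < delta `^ g' by exact: powR_gt0.
apply: le_lt_trans (_ : D < _); first by rewrite lerD2r ler_wpM2l.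
apply: lt_le_trans (_ : Kb * (delta `^ g' * c2) <= _); last first.
  by rewrite ler_wpM2l // ler_pM2l.
have dpn : delta `^ (- g') * delta `^ g' = 1.
  by rewrite powRN mulVf // gt_eqF.
have -> : Kb * (delta `^ g' * c2) =
   D * (delta `^ (- g') * delta `^ g') + delta `^ g' * c2.
  by rewrite /Kb; field; rewrite gt_eqF.
by rewrite dpn mulr1 ltrDl mulr_gt0.
Qed.

(** All the constants of the two comparison arguments are absorbed in [C]; they
    depend on [f], [g] and [g'] but neither on [delta] nor on [Q]. *)
Lemma arc_small_values f (g g' : R) (z0 : R[i]) :
  (forall z, normc z < 1 -> taylor2 f z) -> normc z0 < 1 -> f z0 != 0 ->
  1 < g -> g < g' ->
  exists c1 d0 C, [/\ 0 < c1 /\ c1 <= 1, 0 < d0 /\ d0 <= 1 / 4, 1 <= C &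
  forall delta Q, 0 < delta -> delta <= d0 -> 1 <= Q ->
  (forall z, normc z <= 1 - c1 * delta ->
     normc (f z) <= expR (Q * (1 - normc z) `^ (- g))) ->
  (forall t, normc (f (circle_point (1 - delta) t)) <= expR (C * Q * delta `^ (- g'))) /\
  forall t0 Lam, 0 <= Lam ->
    (mu (`[t0, (t0 + delta)%R] `&`
        [set t : R | (normc (f (circle_point (1 - delta) t)) <= expR (- Lam))%R]) <=
    (C * delta * expR (- Lam / (C * Q * delta `^ (- g'))))%:E)%E].
Proof.
move=> tf z01 fz0 g1 gg'.
have g'1 : 1 < g' by exact: lt_trans gg'.
have g0 : 0 < g by exact: lt_trans g1.
have g'0 : 0 < g' by exact: lt_trans gg'.
pose al := pi / (2 * g'); pose ca := cos al / 2.
have [al0 al2 T0 cg0] := sector_angles g0 gg' g'1; rewrite -/al in al0 al2 T0 cg0.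
set T := cos al in T0.
have T1 : T <= 1 by exact: cos_le1.
have ca0 : 0 < ca by rewrite divr_gt0.
have caT : ca = T / 2 by [].
pose b1 := T / 4; pose b2 := T / 2.
have [|||L0 L00 base] := @radial_lower_bound _ f b1 b2 z0 tf z01 fz0;
  [rewrite /b1 /b2; clear -T0 T1; lra..|].
have b2T : b2 < T by rewrite /b2; clear -T0; lra.
pose c1 := ca / 2.
have c1T : c1 = T / 4 by rewrite /c1 caT; clear; field.
have c10 : 0 < c1 by rewrite divr_gt0.
have c11 : c1 <= 1 / 4 by rewrite c1T; clear -T1; lra.
pose C1 := ca `^ (- g) / cos (g * al).
have C10 : 0 <= C1 by rewrite divr_ge0 ?powR_ge0 // ltW.
pose c2 := b2 `^ (- g') - T `^ (- g').
have b20 : 0 < b2 by rewrite divr_gt0.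
have b10 : 0 < b1 by rewrite divr_gt0.
have c20 : 0 < c2.
  rewrite /c2 subr_gt0 !powRN ltf_pV2 ?posrE ?powR_gt0 //.
  by rewrite gt0_ltr_powR ?nnegrE ?(ltW b20) ?(ltW T0).
pose kap := ln (1 + c1 / 64) / 2.
have kap0 : 0 < kap by rewrite divr_gt0 // ln_gt0 // ltrDl divr_gt0.
have kap1 : kap <= 1.
  by have := @le_ln1Dx R (c1 / 64) ltac:(clear -c10; lra); rewrite /kap; clear -c11; lra.
have p4 := powR_ge0 b1 (- g); have p1 := powR_ge0 c1 (- g).
pose C3 := (C1 * b1 `^ (- g) + L0) / c2.
have C30 : 0 <= C3.
  by apply: divr_ge0; [apply: addr_ge0 => //; exact: mulr_ge0|exact: ltW].
pose C2 := C3 + 1 + c1 `^ (- g) + 1.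
pose C := 192 * expR 2 + C2 / kap.
have C21 : 2 <= C2 by rewrite /C2; clear -C30 p1; lra.
have C2k : 2 <= C2 / kap.
  by rewrite ler_pdivlMr //; clear -kap1 C21; lra.
have E2 : 1 <= expR 2 :> R by rewrite -[leLHS]expR0 ler_expR.
have C31 : 1 <= C by rewrite /C; clear -E2 C2k; lra.
have C192 : 192 * expR 2 <= C by rewrite /C; clear -C2k; lra.
have CC2 : C2 / kap <= C by rewrite /C; clear -E2; lra.
(* A disc of radius [1 - c1 delta] has to contain the arc of the sector, whose
   points satisfy [|z| <= 1 - 2 c1 delta]. *)
exists c1, b1, C; split => //.
- by split=> //; clear -c11; lra.
- by split=> //; rewrite /b1; clear -T1; lra.
move=> delta Q d0 dT Q1 bf.
have d4 : delta <= 1 / 4 by apply: le_trans dT _; rewrite /b1; clear -T1; lra.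
have d1 : 0 < delta <= 1 by rewrite d0 /=; clear -d4; lra.
have c1d : 0 < c1 * delta by rewrite mulr_gt0.
have c1d' : c1 * delta <= delta / 4.
  by rewrite [leRHS]mulrC ler_pM2r //; clear -c11; lra.
have dg : 1 <= delta `^ (- g').
  by rewrite -(powRr0 delta); apply: ger_powR => //; clear -g'0; lra.
have dgg : delta `^ (- g) <= delta `^ (- g').
  by apply: ger_powR => //; clear -gg'; lra.
have dg0 : 0 < delta `^ (- g') by exact: powR_gt0.
have Q0 : 0 <= Q by clear -Q1; lra.
have Qd : 1 <= Q * delta `^ (- g') by rewrite -[leLHS]mulr1 ler_pM.
pose D := C1 * Q * b1 `^ (- g) + L0.
have D0 : 0 <= D.
  by apply: addr_ge0 => //; apply: mulr_ge0 => //; exact: mulr_ge0.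
pose Kb := D / c2 * delta `^ (- g') + 1.
pose M := Q * (c1 * delta) `^ (- g) + 1.
have Dc2 : 0 <= D / c2 by exact: divr_ge0 D0 (ltW c20).
have Kb0 : 0 <= Kb.
  by apply: addr_ge0 => //; apply: mulr_ge0 => //; exact: ltW.
have M1 : 1 <= M by rewrite lerDr mulr_ge0 // powR_ge0.
have cd : (c1 * delta) `^ (- g) <= c1 `^ (- g) * delta `^ (- g').
  by rewrite powRM ?(ltW c10) ?(ltW d0) // ler_wpM2l.
have KM : Kb + M <= C2 * (Q * delta `^ (- g')).
  have h1 : D / c2 <= Q * C3.
    rewrite /C3 mulrA ler_pM2r ?invr_gt0 // mulrDr /D.
    have : L0 <= Q * L0 by rewrite ler_peMl.
    by clear; lra.
  have h2 := ler_wpM2r (ltW dg0) h1.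
  have h3 := ler_wpM2l Q0 cd.
  rewrite /Kb /M /C2; clear -h2 h3 Qd; lra.
have bM z : normc z <= 1 - c1 * delta -> normc (f z) <= expR M.
  move=> zr; apply: le_trans (bf _ zr) _; rewrite ler_expR /M.
  rewrite -[leLHS]addr0; apply: lerD => //; apply: ler_wpM2l => //.
  by apply: ler_powRN; [exact: ltW|exact: c1d|clear -zr; lra].
split.
  move=> t; have r0 : 0 <= 1 - delta by clear -d4; lra.
  apply: le_trans (bf _ _) _.
    by rewrite normc_circle_point //; clear -c1d' d0; lra.
  rewrite normc_circle_point // (_ : 1 - (1 - delta) = delta); last by ring.
  rewrite ler_expR -mulrA mulrCA ler_wpM2l //; apply: le_trans dgg _.
  by rewrite ler_peMl // ltW.
move=> t0 Lam Lam0.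
pose E := cexp (0 +i* t0) : R[i].
have E1 : normc E = 1 by rewrite normc_cexp expR0.
have [z|y [yal fy]] := @sector_point f g g' b1 b2 L0 Q delta E tf E1 g0 gg' g'1 d0
   dT b2T Q0 L00 _ (base E E1).
  move=> zr; apply: bf; apply: le_trans zr _.
  by rewrite lerD2l lerN2 ler_pM2r // -/al -/ca /c1 ler_pdivrMr // ler_peMr ?(ltW ca0) // ler1n.
rewrite -/al -/ca -/T -/C1 -/c2 -/D -/Kb in fy yal.
set zs := sector_map E _ in fy.
have zs1 : normc zs <= 1 - 2 * (c1 * delta).
  have := @sector_map_norm _ E al (ln delta +i* y) E1 ltac:(by rewrite al0 al2) yal.
  rewrite /= lnK ?posrE // -/T => h.
  have -> : 2 * (c1 * delta) = T / 2 * delta by rewrite c1T; clear; field.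
  by apply: h; apply: le_trans dT _; rewrite /b1; clear -T0; lra.
have zsE : normc (zs - E) <= delta.
  rewrite /zs /sector_map (_ : _ - E = - (E * cexp (ln delta +i* y))); last by ring.
  by rewrite normcN normcM E1 mul1r normc_cexp /= lnK ?posrE.
apply: le_trans (arc_measure tf c10 c11 d0 d4 bM M1 Kb0 fy zs1 zsE Lam0) _.
rewrite lee_fin -/kap; set B := (Kb + M) / kap.
have B0 : 0 < B.
  by rewrite divr_gt0 //; clear -Kb0 M1; lra.
have BC : B <= C * Q * delta `^ (- g').
  rewrite ler_pdivrMr //; apply: le_trans KM _.
  have -> : C * Q * delta `^ (- g') * kap = C * kap * (Q * delta `^ (- g')) by ring.
  rewrite ler_wpM2r //; first by clear -Qd; lra.
  by rewrite -ler_pdivrMr.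
apply: ler_pM; rewrite ?expR_ge0 //.
- by rewrite mulr_ge0 ?(ltW d0) // mulr_ge0 // expR_ge0.
- by rewrite ler_pM2r.
rewrite ler_expR !mulNr lerN2 ler_wpM2l // lef_pV2 ?posrE //.
exact: lt_le_trans BC.
Qed.

End arc_small_values.

(** * Logarithmic means from exponentially small sublevel sets *)

Section logarithmic_means.
Context {R : realType}.
Implicit Types (f : R[i] -> R[i]) (z w E : R[i]) (r s t : R).
Local Notation mu := (@lebesgue_measure R).

Lemma circle_cover (S : set R) (delta X : R) : 0 < delta -> delta <= 1 / 4 ->
  0 <= X -> measurable S ->
  (forall t0, (mu (`[t0, (t0 + delta)%R] `&` S) <= X%:E)%E) ->
  (mu (`[0%R, (2 * pi)%R] `&` S) <= (9 / delta * X)%:E)%E.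
Proof.
move=> d0 d4 X0 mS arcs; have pi0 := pi_gt0 R.
have pi4 : pi <= 4 :> R by have := pihalf_lt2 R; clear; lra.
pose n := (Num.truncn (2 * pi / delta)).+1.
have q0 : 0 <= 2 * pi / delta by rewrite divr_ge0 ?mulr_ge0 // ltW.
have n1 : 2 * pi / delta < n%:R by exact: Num.Theory.truncnS_gt.
have n2 : n%:R <= 9 / delta.
  have -> : n%:R = (Num.truncn (2 * pi / delta))%:R + 1 :> R by rewrite natr1.
  have h : (Num.truncn (2 * pi / delta))%:R <= 2 * pi / delta.
    by have /andP[] := Num.Theory.truncn_itv q0.
  apply: le_trans (lerD h (lexx 1)) _; rewrite -[X in _ + X](divff (lt0r_neq0 d0)).
  by rewrite -mulrDl ler_pM2r ?invr_gt0 //; clear -pi4 d4; lra.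
pose A (i : nat) : set R := `[i%:R * delta, i%:R * delta + delta]%classic `&` S.
have mA i : measurable (A i) by apply: measurableI => //; exact: measurable_itv.
apply: (@le_trans _ _ (\sum_(i < n) mu (A i))%E).
  have mX : measurable (`[0%R, (2 * pi)%R] `&` S).
    by apply: measurableI => //; exact: measurable_itv.
  apply: content_subadditive => //; first by move=> i _; exact: mA.
  move=> t [/=]; rewrite in_itv /= => /andP[t0 t2] St.
  rewrite -bigcup_mkord; exists (Num.truncn (t / delta)).
    rewrite /= /n ltnS; apply: Num.Theory.le_truncn.
    by rewrite ler_pM2r ?invr_gt0.
  have td : 0 <= t / delta by rewrite divr_ge0 // ltW.
  have /andP[h1 h2] := Num.Theory.truncn_itv td.
  split => //=; rewrite in_itv /=; apply/andP; split.
    by rewrite -ler_pdivlMr.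
  by rewrite -[X in _ + X]mul1r -mulrDl natr1 -ler_pdivrMr // ltW.
apply: (@le_trans _ _ (\sum_(i < n) X%:E)%E).
  by apply: lee_sum => i _; exact: arcs.
rewrite sumEFin lee_fin sumr_const card_ord -[X *+ n]mulr_natl.
by rewrite ler_wpM2r.
Qed.

Lemma measurable_lne_comp (u : R -> R) : measurable_fun setT u ->
  measurable_fun setT (fun t => lne (u t)%:E).
Proof.
move=> mu_; rewrite /lne; apply: measurable_fun_ifT.
- by apply: measurable_fun_ler => //; exact: measurable_cst.
- exact: measurable_cst.
- apply/measurable_EFinP; apply: measurableT_comp => //; exact: measurable_ln.
Qed.

Lemma powR_le_exp (p : R) (k : nat) : 1 <= p ->
  k.+1%:R `^ p * expR (- k%:R) <= expR 1 * (2 * p) `^ p * expR (- (1 / 2)) ^+ k.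
Proof.
move=> p1; have p0 : 0 < p by lra.
have pp : 0 < 2 * p by rewrite mulr_gt0.
rewrite -expRM_natl !powR_expR_ln // -!expRD ler_expR.
have h : ln (k.+1%:R / (2 * p)) <= k.+1%:R / (2 * p) - 1.
  have := @le_ln1Dx R (k.+1%:R / (2 * p) - 1).
  rewrite (addrC 1) subrK; apply.
  by rewrite ltrBDr addNr divr_gt0.
have h2 : p * ln k.+1%:R <= k.+1%:R / 2 + p * ln (2 * p).
  have -> : ln k.+1%:R = ln (k.+1%:R / (2 * p)) + ln (2 * p).
    by rewrite -lnM ?posrE ?divr_gt0 // divfK // gt_eqF.
  rewrite mulrDr lerD2r; apply: le_trans (ler_wpM2l (ltW p0) h) _.
  rewrite mulrBr mulr1.
  have -> : p * (k.+1%:R / (2 * p)) = k.+1%:R / 2 by field; rewrite gt_eqF.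
  by clear -p0; lra.
have -> : k%:R = k.+1%:R - 1 :> R by rewrite -natr1 addrK.
clear -h2; lra.
Qed.

Lemma geometric_sum_le (q : R) n : 0 <= q -> q < 1 ->
  \sum_(0 <= k < n) q ^+ k <= (1 - q)^-1.
Proof.
move=> q0 q1; rewrite -[leRHS]mul1r ler_pdivlMr ?subr_gt0 //.
rewrite big_mkord mulrC.
have := subrX1 q n; rewrite -opprB => /eqP.
rewrite -(opprB 1 q) mulNr eqr_opp => /eqP <-.
by rewrite lerBlDr lerDl exprn_ge0.
Qed.

(** A bound for the sum over [k] of [(k + 1)^p exp (- k)]. *)
Definition log_mean_const (p : R) : R :=
  expR 1 * (2 * p) `^ p / (1 - expR (- (1 / 2))).

(** The integrand is at most the sum over [k] of [((k + 1) B)^p] times the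
    indicator of [log u <= - k B] (of the whole interval if [k = 0]).  At a zero
    of [u] both sides are infinite, so that no exceptional set is needed. *)
Lemma log_layers (u : R -> R) (B C p : R) :
  measurable_fun setT u -> 1 <= B -> 2 * pi <= C -> 1 <= p ->
  (forall t, u t <= expR B) ->
  (forall k : nat, (mu (`[0%R, (2 * pi)%R] `&`
      [set t | (u t <= expR (- (k%:R * B)))%R]) <= (C * expR (- k%:R))%:E)%E) ->
  (\int[mu]_(t in `[0%R, (2 * pi)%R]) `|lne (u t)%:E| `^ p <=
     (B `^ p * (C * log_mean_const p))%:E)%E.
Proof.
move=> mu_ B1 C1 p1 uB layers.
have B0 : 0 < B by lra.
have p0 : 0 <= p by lra.
have pi0 := pi_gt0 R.
pose D : set R := `[0%R, (2 * pi)%R]%classic.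
have mD : measurable D by exact: measurable_itv.
pose G (k : nat) : set R := if k is 0%N then setT else [set t | u t <= expR (- (k%:R * B))].
have mG k : measurable (G k).
  case: k => [|k]; first exact: measurableT.
  rewrite /G (_ : [set t | _] = u @^-1` `]-oo, expR (- (k.+1%:R * B))]).
    by rewrite -[X in measurable X]setTI; apply: mu_ => //; exact: measurable_itv.
  by apply/seteqP; split => t /=; rewrite in_itv.
pose c (k : nat) := (k.+1%:R * B) `^ p.
have c0 k : 0 <= c k by exact: powR_ge0.
pose h (k : nat) (t : R) : \bar R := ((c k)%:E * (\1_(G k) t)%:E)%E.
have h0 k t : (0 <= h k t)%E by rewrite mule_ge0 // lee_fin.
have mh k : measurable_fun D (h k).
  apply: emeasurable_funM; first exact: measurable_cst.
  by apply/measurable_EFinP; apply: measurable_funTS; exact: measurable_indic.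
have term_le k t : (h k t <= \sum_(0 <= i <oo) h i t)%E.
  apply: (@le_trans _ _ (\sum_(0 <= i < k.+1) h i t)%E); last first.
    by apply: nneseries_lim_ge => i _ _.
  by rewrite big_nat_recr //= leeDr // sume_ge0.
have ptw t : D t -> (`|lne (u t)%:E| `^ p <= \sum_(0 <= i <oo) h i t)%E.
  move=> _; have [u0|u0] := leP (u t) 0.
    (* every term is at least 1, so the series diverges *)
    have Gt k : G k t by case: k => // k; apply: le_trans u0 _; exact: expR_ge0.
    rewrite leNgt; apply/negP => lt.
    have fin : (\sum_(0 <= i <oo) h i t)%E \is a fin_num.
      rewrite ge0_fin_numE; first by apply: lt_le_trans lt _; rewrite leey.
      by apply: nneseries_ge0 => i _ _.
    pose x := fine (\sum_(0 <= i <oo) h i t)%E.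
    pose n := (Num.truncn x).+1.
    have : (n%:R%:E <= \sum_(0 <= i <oo) h i t)%E.
      apply: (@le_trans _ _ (\sum_(0 <= i < n) h i t)%E); last first.
        by apply: nneseries_lim_ge => i _ _.
      apply: (@le_trans _ _ (\sum_(0 <= i < n) 1%:E)%E).
        by rewrite sumEFin sumr_const_nat subn0.
      apply: lee_sum => i _; rewrite /h indicE mem_set // mule1 lee_fin.
      apply: (@le_trans _ _ (1 `^ p)); first by rewrite powR1.
      rewrite /c; apply: ge0_ler_powR; rewrite ?nnegrE ?mulr_ge0 ?(ltW B0) //.
      by rewrite -[leLHS]mulr1; apply: ler_pM => //; rewrite ler1n.
    rewrite -(fineK fin) -/x lee_fin leNgt => /negP; apply.
    exact: Num.Theory.truncnS_gt.
  rewrite lne_EFin // abse_EFin poweR_EFin.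
  have [lB|Bl] := leP (`|ln (u t)|) B.
    apply: le_trans (term_le 0%N t); rewrite /h indicE mem_set // mule1 lee_fin.
    by rewrite /c mul1r ge0_ler_powR ?nnegrE // ltW.
  have luB : ln (u t) <= B by rewrite -ler_expR lnK.
  have ln0 : ln (u t) < - B.
    by rewrite ltNge; apply/negP => h1; move: Bl; rewrite ltNge ler_norml h1 luB.
  pose j := Num.truncn (- ln (u t) / B).
  have q0 : 0 <= - ln (u t) / B by rewrite divr_ge0 ?(ltW B0) //; clear -ln0 B0; lra.
  have /andP[j1 j2] := Num.Theory.truncn_itv q0; rewrite -/j in j1 j2.
  rewrite ler_pdivlMr // in j1; rewrite ltr_pdivrMr // in j2.
  apply: le_trans (term_le j t).
  have Gj : G j t.
    rewrite /G; case: j j1 {j2} => // j j1 /=.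
    by rewrite -[leLHS]lnK ?posrE // ler_expR; clear -j1; lra.
  rewrite /h indicE mem_set // mule1 lee_fin /c ge0_ler_powR ?nnegrE ?mulr_ge0 ?(ltW B0) //.
  by rewrite ltr0_norm; [exact: ltW|clear -ln0 B0; lra].
apply: (@le_trans _ _ (\int[mu]_(t in D) \sum_(0 <= i <oo) h i t)%E).
  apply: ge0_le_integral => //.
  - by move=> t _; exact: poweR_ge0.
  - apply: measurable_funTS; apply: (@measurableT_comp _ _ _ _ _ _ (fun x : \bar R => x `^ p)%E).
      exact: measurable_poweR.
    apply: measurableT_comp; first exact: abse_measurable.
    exact: measurable_lne_comp.
  - by apply: (@ge0_emeasurable_sum _ _ _ _ h xpredT) => [k t _ _|k _];
      [exact: h0|exact: mh].
rewrite integral_nneseries //.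
have inth k : (\int[mu]_(t in D) h k t <=
    (B `^ p * C * (expR 1 * (2 * p) `^ p) * expR (- (1 / 2)) ^+ k)%:E)%E.
  have m1 : measurable_fun D (fun t => (\1_(G k) t)%:E : \bar R).
    by apply/measurable_EFinP; apply: measurable_funTS; exact: measurable_indic.
  have -> : (\int[mu]_(t in D) h k t =
      (c k)%:E * \int[mu]_(t in D) (\1_(G k) t)%:E)%E.
    by apply: ge0_integralZl => //; rewrite lee_fin.
  rewrite integral_indic //; last exact: mG.
  have G_le : (mu (G k `&` D) <= (C * expR (- k%:R))%:E)%E.
    case: k {m1} => [|k]; last by rewrite setIC; exact: layers.
    rewrite setTI lebesgue_measure_itv /= lte_fin mulr_gt0 // -EFinD lee_fin.
    by rewrite subr0 oppr0 expR0 mulr1.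
  apply: le_trans (lee_wpmul2l _ G_le) _; first by rewrite lee_fin.
  rewrite -EFinM lee_fin /c powRM ?(ltW B0) //.
  have BC : 0 <= B `^ p * C.
    by rewrite mulr_ge0 ?powR_ge0 //; apply: le_trans C1; rewrite mulr_ge0 // ltW.
  have := ler_wpM2l BC (powR_le_exp k p1).
  by clear; lra.
apply: lime_le; first by apply: is_cvg_nneseries => k _ _; exact: integral_ge0.
near=> n.
apply: le_trans (lee_sum _ (fun k _ => inth k)) _.
rewrite sumEFin lee_fin -mulr_sumr.
have q1 : expR (- (1 / 2)) < 1 :> R by rewrite -[ltRHS]expR0 ltr_expR; clear; lra.
have BC : 0 <= B `^ p * C * (expR 1 * (2 * p) `^ p).
  rewrite mulr_ge0 ?mulr_ge0 ?powR_ge0 ?expR_ge0 //.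
  by apply: le_trans C1; rewrite mulr_ge0 // ltW.
apply: le_trans (ler_wpM2l BC (geometric_sum_le n (expR_ge0 _) q1)) _.
by rewrite /log_mean_const !mulrA.
Unshelve. all: end_near. Qed.

Lemma mean_log_le f r (B C p : R) :
  (forall z, normc z < 1 -> taylor2 f z) -> 0 <= r -> r < 1 ->
  1 <= B -> 2 * pi <= C -> 1 <= p ->
  (forall t, normc (f (circle_point r t)) <= expR B) ->
  (forall k : nat, (mu (`[0%R, (2 * pi)%R] `&`
     [set t | (normc (f (circle_point r t)) <= expR (- (k%:R * B)))%R]) <=
     (C * expR (- k%:R))%:E)%E) ->
  (mean_log p r f <= ((C * log_mean_const p / (2 * pi)) `^ p^-1 * B)%:E)%E.
Proof.
move=> tf r0 r1 B1 C1 p1 fB layers.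
have pi0 := pi_gt0 R; have p0 : 0 < p by lra.
have q1 : expR (- (1 / 2)) < 1 :> R by rewrite -[ltRHS]expR0 ltr_expR; clear; lra.
have W0 : 0 <= log_mean_const p.
  by rewrite divr_ge0 ?mulr_ge0 ?powR_ge0 ?expR_ge0 // subr_ge0 ltW.
have C0 : 0 <= C by apply: le_trans C1; rewrite mulr_ge0 // ltW.
have mF : measurable_fun setT (fun t => normc (f (circle_point r t))).
  by apply: continuous_measurable_fun; exact: continuous_circle.
have int_le := log_layers mF B1 C1 p1 fB layers.
rewrite /mean_log.
have i2pi : 0 <= (2 * pi)^-1 :> R by rewrite invr_ge0 mulr_ge0 // ltW.
apply: (@le_trans _ _
  ((((2 * pi)^-1)%:E * (B `^ p * (C * log_mean_const p))%:E) `^ p^-1)%E).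
  apply: gt0_ler_poweR; rewrite ?invr_ge0 ?(ltW p0) // ?in_itv /= ?leey ?andbT //.
  - by rewrite mule_ge0 ?lee_fin // integral_ge0 // => t _; exact: poweR_ge0.
  - by rewrite -EFinM lee_fin !mulr_ge0 ?powR_ge0.
  - by rewrite lee_wpmul2l ?lee_fin.
rewrite -EFinM poweR_EFin lee_fin.
have -> : (2 * pi)^-1 * (B `^ p * (C * log_mean_const p)) =
   C * log_mean_const p / (2 * pi) * B `^ p by ring.
rewrite powRM ?powR_ge0 //; last first.
  by apply: mulr_ge0 => //; exact: mulr_ge0.
by rewrite -powRrM divff ?gt_eqF // powRr1 //; lra.
Qed.

End logarithmic_means.

(** * Means of functions of given growth *)

Section growth.
Context {R : realType}.
Implicit Types (f : R[i] -> R[i]) (z w : R[i]) (r s t : R).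
Local Notation mu := (@lebesgue_measure R).

Lemma powRN_ge1 (x a : R) : 0 < x -> x <= 1 -> 0 <= a -> 1 <= x `^ (- a).
Proof.
move=> x0 x1 a0; rewrite -[leLHS](powRr0 x).
by apply: ger_powR; [rewrite x0|rewrite oppr_le0].
Qed.

(** The circle is covered by [O(1 / (1 - r))] arcs of length [1 - r].  The
    constants [c] and [d] are found before [p], so that the second estimate of
    the theorem can use one set of radii for all [p]. *)
Lemma mean_log_growth f (g g' : R) (z0 : R[i]) :
  (forall z, normc z < 1 -> taylor2 f z) -> normc z0 < 1 -> f z0 != 0 ->
  1 < g -> g < g' ->
  exists c d, [/\ 0 < c /\ c <= 1, 0 < d /\ d <= 1 / 4 &
  forall p, 1 <= p -> exists2 C, 0 < C & forall r Q, 1 - d <= r -> r < 1 -> 1 <= Q ->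
  (forall z, normc z <= 1 - c * (1 - r) ->
     normc (f z) <= expR (Q * (1 - normc z) `^ (- g))) ->
  (mean_log p r f <= (C * Q * (1 - r) `^ (- g'))%:E)%E].
Proof.
move=> tf z01 fz0 g1 gg'.
have [c [d [C [c0 d0 C1 H]]]] := arc_small_values tf z01 fz0 g1 gg'.
exists c, d; split => // p p1.
have pi0 := pi_gt0 R; have pi4 := pihalf_lt2 R.
exists ((9 * C * log_mean_const p / (2 * pi)) `^ p^-1 * C).
  have q1 : expR (- (1 / 2)) < 1 :> R by rewrite -[ltRHS]expR0 ltr_expR; clear; lra.
  have W0 : 0 < log_mean_const p.
    rewrite divr_gt0 ?subr_gt0 // mulr_gt0 ?expR_gt0 // powR_gt0 //.
    by clear -p1; lra.
  apply: mulr_gt0; last by clear -C1; lra.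
  apply: powR_gt0; apply: divr_gt0; last by rewrite mulr_gt0.
  by rewrite mulr_gt0 //; clear -C1; lra.
move=> r Q dr r1 Q1 bf.
have de0 : 0 < 1 - r by rewrite subr_gt0.
have ded : 1 - r <= d by clear -dr; lra.
have rE : 1 - (1 - r) = r by ring.
have [fB arcs] := H _ _ de0 ded Q1 bf; rewrite rE in fB arcs.
set B := C * Q * (1 - r) `^ (- g') in fB arcs.
have dg : 1 <= (1 - r) `^ (- g').
  apply: powRN_ge1 => //; last by clear -g1 gg'; lra.
  by case: d0 => _; clear -ded; lra.
have CQ : 1 <= C * Q by rewrite -[leLHS]mulr1; apply: ler_pM.
have B1 : 1 <= B by rewrite -[leLHS]mulr1; apply: ler_pM.
have r0 : 0 <= r by case: d0 => _; clear -ded; lra.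
rewrite (_ : _ * C * Q * _ = (9 * C * log_mean_const p / (2 * pi)) `^ p^-1 * B);
  last by rewrite /B; ring.
apply: mean_log_le => // [|k]; first by clear -C1 pi4; lra.
have B0 : 0 < B by clear -B1; lra.
have mS := measurable_circle_sublevel (expR (- (k%:R * B))) tf r0 r1.
have := @circle_cover _ _ (1 - r) (C * (1 - r) * expR (- (k%:R * B) / B)) de0 _ _ mS.
have -> : 9 / (1 - r) * (C * (1 - r) * expR (- (k%:R * B) / B)) = 9 * C * expR (- k%:R).
  rewrite mulNr mulfK ?gt_eqF //; field; rewrite gt_eqF //.
apply.
- by case: d0 => _; clear -ded; lra.
- by rewrite mulr_ge0 ?expR_ge0 // mulr_ge0 ?(ltW de0) //; clear -C1; lra.
- by move=> t0; apply: arcs; rewrite mulr_ge0 // ltW.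
Qed.

Lemma normc_le_max_modulus f r z : (forall z, normc z < 1 -> taylor2 f z) ->
  r < 1 -> normc z = r -> normc (f z) <= max_modulus r f.
Proof.
move=> tf r1 zr; have r0 : 0 <= r by rewrite -zr normc_ge0.
have tf' w : normc w <= r -> taylor2 f w by move=> wr; apply: tf; exact: le_lt_trans r1.
have [M _ MP] := disc_bounded r0 tf'.
apply: ub_le_sup; last by exists z.
by exists (expR M) => _ [w /= wr <-]; apply: MP; rewrite wr.
Qed.

Lemma normc_le_max_modulus_disc f r z : (forall z, normc z < 1 -> taylor2 f z) ->
  r < 1 -> normc z <= r -> normc (f z) <= max_modulus r f.
Proof.
move=> tf r1 zr; have r0 : 0 <= r by apply: le_trans zr; exact: normc_ge0.
have M0 : 0 <= max_modulus r f.
  apply: le_trans (normc_le_max_modulus tf r1 (_ : normc r%:C = r)).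
    exact: normc_ge0.
  by rewrite normc_real ger0_norm.
pose K : set R[i] := [set z | normc z <= r].
have Kc w : ~ K w -> open_at (~` K) w by exact: disc_compl_open.
suff step : forall w, K w -> normc (f w) * expR 0 <= max_modulus r f.
  by have := step z zr; rewrite expR0 mulr1.
apply: (@max_principle R K [set w | normc w = r] f (fun=> 0) (max_modulus r f) r) => //.
- apply: ctn_inM; last exact: ctn_in_cst.
  by apply: taylor2_ctn => w wr; apply: tf; exact: le_lt_trans r1.
- move=> w wr nw; split; last exact: add_harmonic_cst.
  + have wr' : normc w < r by rewrite lt_def wr andbT; apply/eqP => e; apply: nw.
    exists (r - normc w); first by rewrite subr_gt0.
    by move=> v vw; rewrite /K /=; have := normcD (v - w) w; rewrite subrK; clear -vw; lra.
  + by apply/cross_taylor2_mul/taylor2_cross/tf; exact: le_lt_trans r1.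
- by move=> w _ wr; rewrite expR0 mulr1; exact: normc_le_max_modulus.
Qed.

Lemma le_expR_logp (x : R) : x <= expR (logp x).
Proof.
have [x0|x0] := leP x 0; first by apply: le_trans x0 (expR_ge0 _).
rewrite -[leLHS]lnK ?posrE // ler_expR /logp /pospart.
by rewrite le_max lexx.
Qed.

(** When [logp] of the maximum modulus is at most 1 its logarithm is truncated
    to 0, and the right-hand side is at least 1 anyway. *)
Lemma order_quotient_bound f r s : 0 <= s -> 0 < r -> r < 1 ->
  order_quotient f r <= s -> logp (max_modulus r f) <= (1 - r) `^ (- s).
Proof.
move=> s0 r0 r1; rewrite /order_quotient.
have d0 : 0 < 1 - r by rewrite subr_gt0.
have l0 : 0 < ln (1 - r)^-1.
  by rewrite ln_gt0 // invf_gt1 //; clear -r0; lra.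
rewrite ler_pdivrMr // => h.
set x := logp (max_modulus r f) in h *.
have p1 : 1 <= (1 - r) `^ (- s).
  by apply: powRN_ge1 => //; clear -r0; lra.
have [x1|x1] := leP x 1; first exact: le_trans p1.
have x0 : 0 < x by clear -x1; lra.
rewrite -[leLHS]lnK ?posrE // powR_expR_ln // ler_expR.
have -> : - s * ln (1 - r) = s * ln (1 - r)^-1 by rewrite lnV ?posrE // mulrN mulNr.
by apply: le_trans h; rewrite /logp /pospart le_max lexx.
Qed.

Lemma near_left1 (P : R -> Prop) : (\forall r \near 1^'-, P r) <->
  exists2 d : R, 0 < d & forall r, 1 - d < r -> r < 1 -> P r.
Proof.
split.
  rewrite near_withinE => /nbhs_ballP[d /= d0 dP]; exists d => // r r1 r2.
  by apply: dP => //; rewrite /ball /= ltr_norml; clear -r1 r2 d0; lra.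
move=> [d d0 dP]; rewrite near_withinE; apply/nbhs_ballP; exists d => //= r.
rewrite /ball /= ltr_norml => /andP[_ h] r1; apply: dP => //; clear -h; lra.
Qed.

Lemma limf_esup_lt (h : R -> \bar R) (x : \bar R) :
  (limf_esup h 1^'- < x)%E -> exists2 d : R, 0 < d &
    forall r, 1 - d < r -> r < 1 -> (h r < x)%E.
Proof.
move=> /ereal_inf_lt[_ /= [V FV <-] hx].
have /near_left1[d d0 dP] := FV.
exists d => // r r1 r2; apply: le_lt_trans hx.
by apply: ereal_sup_ubound; exists r => //; exact: dP.
Qed.

Lemma limf_einf_lt (h : R -> \bar R) (x : \bar R) :
  (limf_einf h 1^'- < x)%E -> forall d : R, 0 < d ->
    exists r, [/\ 1 - d < r, r < 1 & (h r < x)%E].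
Proof.
rewrite /limf_einf => lx d d0.
have : (- x < limf_esup (\- h) 1^'-)%E by rewrite lteNl.
pose V : set R := [set r | 1 - d < r < 1].
have FV : (1 : R)^'- V.
  by apply/near_left1; exists d => // r r1 r2; rewrite /V /= r1.
have : (limf_esup (\- h) 1^'- <= ereal_sup [set (\- h)%E r | r in V])%E.
  by apply: ereal_inf_lbound; exists V.
move=> h1 h2; have /ereal_sup_gt[_ [r /= /andP[r1 r2] <-]] := lt_le_trans h2 h1.
by rewrite lteN2 => hr; exists r.
Qed.

Lemma limf_esup_le (h : R -> \bar R) (x : \bar R) (d : R) : 0 < d ->
  (forall r, 1 - d < r -> r < 1 -> (h r <= x)%E) -> (limf_esup h 1^'- <= x)%E.
Proof.
move=> d0 hx; pose V : set R := [set r | 1 - d < r < 1].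
have FV : (1 : R)^'- V.
  by apply/near_left1; exists d => // r r1 r2; rewrite /V /= r1.
apply: (@le_trans _ _ (ereal_sup [set h r | r in V])).
  by apply: ereal_inf_lbound; exists V.
by apply: ge_ereal_sup => _ [r /= /andP[r1 r2] <-]; exact: hx.
Qed.

Lemma limf_esup_ge (h : R -> \bar R) (x : R) :
  (forall d e : R, 0 < d -> 0 < e -> exists r, [/\ 1 - d < r, r < 1 & ((x - e)%:E <= h r)%E]) ->
  (x%:E <= limf_esup h 1^'-)%E.
Proof.
move=> H; apply: le_ereal_inf_tmp => _ [V /near_left1[d d0 dP] <-].
apply/lee_subgt0Pr => e e0; rewrite -EFinB.
have [r [r1 r2 hr]] := H d e d0 e0.
by apply: le_trans hr _; apply: ereal_sup_ubound; exists r => //; exact: dP.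
Qed.

(** For the zero function the order would be 0, since [ln] vanishes at 0. *)
Lemma nonvanishing_point f : (0 <= lambdaM f)%E -> (lambdaM f < sigmaM f)%E ->
  exists2 z0, normc z0 < 1 & f z0 != 0.
Proof.
move=> l0 ls; apply: contrapT => H.
have f0 z : normc z < 1 -> f z = 0.
  by move=> z1; apply/eqP; apply: contrapT => /negP fz; apply: H; exists z.
have : (sigmaM f <= 0)%E.
  apply: (@limf_esup_le _ _ 1) => // r; rewrite subrr => r0 r1.
  rewrite /order_quotient (_ : max_modulus r f = 0).
    have logp0 : logp (0 : R) = 0 by rewrite /logp /pospart ln0 // maxxx.
    by rewrite !logp0 mul0r.
  rewrite /max_modulus (_ : [set _ | _ in _] = [set 0]) ?sup1 //.
  apply/seteqP; split => x /=.
    by move=> [z zr <-]; rewrite f0 ?zr // Normc.normc0.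
  move=> ->; exists r%:C; first by rewrite normc_real gtr0_norm.
  by rewrite f0 ?Normc.normc0 // normc_real gtr0_norm.
by move=> /(lt_le_trans ls); rewrite ltNge l0.
Qed.

Lemma sigma_growth f (sigma e : R) : (forall z, normc z < 1 -> taylor2 f z) ->
  sigmaM f = sigma%:E -> 0 < sigma -> 0 < e ->
  exists2 K, 1 <= K & forall z, normc z < 1 ->
    normc (f z) <= expR (K * (1 - normc z) `^ (- (sigma + e))).
Proof.
move=> tf sE s0 e0.
have [|d d0 dP] := @limf_esup_lt (fun r => (order_quotient f r)%:E) (sigma + e)%:E.
  by rewrite -/(sigmaM f) sE lte_fin ltrDl.
pose r0 := Num.max (1 / 2) (1 - d / 2).
have r00 : 0 <= r0 by rewrite le_max divr_ge0.
have r01 : r0 < 1 by rewrite gt_max; apply/andP; split; clear -d0; lra.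
have [|K K1 KP] := @disc_bounded _ f r0 r00.
  by move=> z zr; apply: tf; exact: le_lt_trans r01.
exists K => // z z1.
have dz : 0 < 1 - normc z by rewrite subr_gt0.
have se : 0 <= sigma + e by clear -s0 e0; lra.
have p1 : 1 <= (1 - normc z) `^ (- (sigma + e)).
  by apply: powRN_ge1 => //; have := normc_ge0 z; clear; lra.
have [zr|zr] := leP (normc z) r0.
  apply: le_trans (KP _ zr) _; rewrite ler_expR ler_peMr //.
  by clear -K1; lra.
move: zr; rewrite gt_max => /andP[z2 zd].
apply: le_trans (normc_le_max_modulus tf z1 erefl) _.
apply: le_trans (le_expR_logp _) _; rewrite ler_expR.
apply: (@le_trans _ _ ((1 - normc z) `^ (- (sigma + e)))).
  apply: order_quotient_bound => //; first by clear -z2; lra.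
  have := dP (normc z) ltac:(clear -zd d0; lra) z1.
  by rewrite lte_fin => /ltW.
by rewrite ler_peMl // (le_trans _ p1).
Qed.

Lemma le_interpolate (x U V th : R) : 0 <= th -> th <= 1 -> 0 <= U -> 0 <= V ->
  x <= expR U -> x <= expR V -> x <= expR (U `^ th * V `^ (1 - th)).
Proof.
move=> th0 th1 U0 V0 xU xV.
pose m := Num.min U V.
have m0 : 0 <= m by rewrite le_min U0.
have xm : x <= expR m by rewrite /m minElt; case: ifP.
apply: le_trans xm _; rewrite ler_expR.
have mE : m = m `^ th * m `^ (1 - th).
  have [->|mn0] := eqVneq m 0.
    have [->|th_neq0] := eqVneq th 0; first by rewrite subr0 powRr1 // mulr0.
    by rewrite powR0 // mul0r.
  rewrite -powRD; last by apply/implyP.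
  by rewrite addrC subrK powRr1.
rewrite {1}mE; apply: ler_pM; rewrite ?powR_ge0 //.
  by apply: ge0_ler_powR; rewrite ?nnegrE // ge_min lexx.
by apply: ge0_ler_powR; rewrite ?nnegrE ?subr_ge0 // ge_min lexx orbT.
Qed.

End growth.

(** * The estimate along the proximate order *)

Section main_estimates.
Context {R : realType}.
Implicit Types (f : R[i] -> R[i]) (lam A : R -> R) (z w : R[i]) (r s t : R).
Local Notation mu := (@lebesgue_measure R).

(** The exponent [th] is the smallest weight for which interpolation with the
    global growth [(1 - |z|)^-sigma] leaves an exponent at most 1. *)
Lemma order_weight (sigma e : R) : 0 < sigma -> 0 <= e ->
  let th := pospart (1 - sigma^-1) in
  [/\ 0 <= th, th <= 1 & (sigma + e) * (1 - th) <= 1 + e].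
Proof.
move=> s0 e0 th; have si0 : 0 < sigma^-1 by rewrite invr_gt0.
rewrite /th /pospart; case: (leP (1 - sigma^-1) 0) => h.
  split=> //; rewrite subr0 mulr1 lerD2r.
  by move: h; rewrite subr_le0 invf_ge1.
have s1 : 1 <= sigma by move: h; rewrite subr_gt0 invf_lt1 // => /ltW.
split; [exact: ltW|by clear -si0; lra|].
have -> : 1 - (1 - sigma^-1) = sigma^-1 by ring.
rewrite mulrDl divff ?gt_eqF // lerD2l.
by rewrite ler_piMr // invf_le1.
Qed.

Lemma interpolated_bound f (sigma e th K U : R) z :
  0 <= th -> th <= 1 -> (sigma + e) * (1 - th) <= 1 + e -> 1 <= K -> 0 <= U ->
  normc z < 1 -> normc (f z) <= expR U ->
  normc (f z) <= expR (K * (1 - normc z) `^ (- (sigma + e))) ->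
  normc (f z) <= expR (K * U `^ th * (1 - normc z) `^ (- (1 + e))).
Proof.
move=> th0 th1 sth K1 U0 z1 fU fV.
have dz : 0 < 1 - normc z by rewrite subr_gt0.
have K0 : 0 <= K by clear -K1; lra.
have V0 : 0 <= K * (1 - normc z) `^ (- (sigma + e)) by rewrite mulr_ge0 ?powR_ge0.
apply: le_trans (le_interpolate th0 th1 U0 V0 fU fV) _; rewrite ler_expR.
rewrite powRM ?powR_ge0 // -powRrM mulNr mulrA (mulrC (U `^ th)).
apply: ler_pM; rewrite ?mulr_ge0 ?powR_ge0 //.
  rewrite ler_wpM2r ?powR_ge0 //; apply: ler1_powR => //; clear -th0; lra.
apply: ger_powR; last by rewrite lerN2.
by rewrite dz; have := normc_ge0 z; clear; lra.
Qed.

Lemma lne_le_expR (x y : R) : (lne x%:E <= y%:E)%E -> x <= expR y.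
Proof.
have [x0 _|x0] := leP x 0; first exact: le_trans x0 (expR_ge0 _).
by rewrite lne_EFin // lee_fin => xy; rewrite -[leLHS]lnK ?posrE // ler_expR.
Qed.

Lemma doubling_iter A (C : R) : 0 < C ->
  (forall r, 0 <= r < 1 -> A ((1 + r) / 2) <= C * A r) ->
  forall (m : nat) r, 0 <= r < 1 -> A (1 - (1 - r) / 2 ^+ m) <= C ^+ m * A r.
Proof.
move=> C0 dA m r /andP[r0 r1]; elim: m => [|m ih].
  by rewrite !expr0 divr1 mul1r (_ : 1 - (1 - r) = r) //; ring.
have p0 : 0 < 2 ^+ m :> R by rewrite exprn_gt0.
have p1 : 1 <= 2 ^+ m :> R by rewrite exprn_ege1 // ler1n.
have q0 : 0 < (1 - r) / 2 ^+ m by rewrite divr_gt0 // subr_gt0.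
have q1 : (1 - r) / 2 ^+ m <= 1.
  by rewrite ler_pdivrMr // mul1r; clear -r0 p1; lra.
have -> : 1 - (1 - r) / 2 ^+ m.+1 = (1 + (1 - (1 - r) / 2 ^+ m)) / 2.
  by rewrite exprS; field; rewrite gt_eqF.
apply: le_trans (dA _ _) _; first by apply/andP; split; clear -q0 q1; lra.
by rewrite exprS -mulrA ler_pM2l.
Qed.

Lemma exp2_inv_le (c : R) : 0 < c -> exists m : nat, (2 ^+ m)^-1 <= c.
Proof.
move=> c0; exists (Num.truncn c^-1).+1; rewrite invf_ple ?posrE ?exprn_gt0 //.
apply: le_trans (ltW (Num.Theory.truncnS_gt _)) _.
by rewrite -natrX ler_nat ltnW // ltn_expl.
Qed.

(** Monotonicity and doubling of the associated function turn the bound at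
    each radius into one bound on a disc slightly larger than [|z| = r]. *)
Lemma majorant_on_larger_disc f kappa lam A (c : R) :
  (forall z, normc z < 1 -> taylor2 f z) ->
  quasi_proximate_order_with f kappa lam A -> 0 < c -> c <= 1 ->
  exists K d, [/\ 1 <= K, 0 < d & forall r, 1 - d < r -> 0 < r -> r < 1 ->
    forall z, normc z <= 1 - c * (1 - r) ->
      normc (f z) <= expR (K * (1 - r) `^ (- lam r))].
Proof.
move=> tf [_ _ lam0 _ _ _ _ [e e0 eA] ndA [C C0 dA] maj] c0 c1.
have [m mc] := exp2_inv_le c0.
have /near_left1[d d0 dP] : \forall r \near 1^'-, 0 < A r /\
    (A r <= (1 - r) `^ (- lam r) <= 2 * A r).
  have e1 : \forall r \near 1^'-, `|0 - e r| < 1 by move/cvgrPdist_lt : e0; apply.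
  near=> r.
  have r1 : r < 1 by near: r; apply/near_left1; exists 1.
  have : `|0 - e r| < 1 by near: r.
  have : A r <= ((1 - r) `^ lam r)^-1 <= (1 + e r) * A r by near: r.
  rewrite sub0r normrN ltr_norml -powRN => /andP[a1 a2] /andP[h1 h2].
  have p0 : 0 < (1 - r) `^ (- lam r) by apply: powR_gt0; rewrite subr_gt0.
  have e10 : 0 < 1 + e r by clear -h1; lra.
  have A0 : 0 < A r by rewrite -(pmulr_rgt0 _ e10); exact: lt_le_trans a2.
  split=> //; rewrite a1 /=; apply: le_trans a2 _.
  by rewrite ler_wpM2r ?(ltW A0) //; clear -h2; lra.
pose s1 := Num.max 0 (1 - d / 2).
have s10 : 0 <= s1 by rewrite le_max lexx.
have s11 : s1 < 1 by rewrite gt_max ltr01 /=; clear -d0; lra.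
have [|M M1 MP] := @disc_bounded _ f s1 s10.
  by move=> z zs; apply: tf; exact: le_lt_trans s11.
exists (M + 2 * C ^+ m), d; split => //.
  have Cm : 0 < C ^+ m by rewrite exprn_gt0.
  by clear -M1 Cm; lra.
move=> r rd r0 r1 z zr.
have dr : 0 < 1 - r by rewrite subr_gt0.
have cr : 0 < c * (1 - r) by rewrite mulr_gt0.
have z1 : normc z < 1 by clear -zr cr; lra.
have z0 := normc_ge0 z.
have [Ar0 /andP[Ar1 _]] := dP _ rd r1.
have X1 : 1 <= (1 - r) `^ (- lam r).
  by apply: powRN_ge1 => //; [clear -r0; lra|apply/ltW/lam0; rewrite (ltW r0)].
have Cm : 0 < C ^+ m by rewrite exprn_gt0.
have [zs|zs] := leP (normc z) s1.
  apply: le_trans (MP _ zs) _; rewrite ler_expR.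
  apply: (@le_trans _ _ (M + 2 * C ^+ m)); first by clear -Cm; lra.
  by rewrite ler_peMr //; clear -M1 Cm; lra.
have zd : 1 - d < normc z.
  by move: zs; rewrite gt_max => /andP[_]; clear -d0; lra.
have [_ /andP[_ a2]] := dP _ zd z1.
apply: le_trans (normc_le_max_modulus tf z1 erefl) _.
have /lne_le_expR := maj (normc z) ltac:(by rewrite z0 z1).
move=> /le_trans; apply; rewrite ler_expR -powRN; apply: le_trans a2 _.
apply: (@le_trans _ _ (2 * (C ^+ m * A r))).
  rewrite ler_pM2l //.
  have r01 : 0 <= r < 1 by rewrite (ltW r0) r1.
  apply: le_trans (doubling_iter C0 dA m r01); apply: ndA => //.
    apply: le_trans zr _; rewrite lerD2l lerN2 (mulrC c) ler_pM2l //.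
  by rewrite ltrBlDr ltrDl divr_gt0 // exprn_gt0.
have CA : C ^+ m * A r <= C ^+ m * (1 - r) `^ (- lam r) by rewrite ler_pM2l.
have MX : 0 <= M * (1 - r) `^ (- lam r).
  by apply: mulr_ge0; [clear -M1; lra|exact: powR_ge0].
clear -CA MX; lra.
Unshelve. all: end_near. Qed.

Lemma powR_ge1 (x a : R) : 1 <= x -> 0 <= a -> 1 <= x `^ a.
Proof. by move=> x1 a0; rewrite -[leLHS](powRr0 x); apply: ler_powR. Qed.

Lemma mean_log_pointwise f kappa lam (sigma eps p : R) :
  (forall z, normc z < 1 -> taylor2 f z) ->
  quasi_proximate_order f kappa lam -> sigmaM f = sigma%:E -> 0 < sigma ->
  0 < eps -> 1 <= p ->
  exists2 C : R, 0 < C & \forall r \near 1^'-,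
    (mean_log p r f <=
     (C / (1 - r) `^ (lam r * pospart (1 - sigma^-1) + 1 + eps))%:E)%E.
Proof.
move=> tf [A hq] sE s0 eps0 p1.
have [[l0 [ls _]] _ lam0 _ _ _ _ _ _ _ _] := hq.
have [z0 z01 fz0] := nonvanishing_point l0 ls.
pose e := eps / 2.
have e0 : 0 < e by rewrite divr_gt0.
have [] := order_weight s0 (ltW e0); set th := pospart _ => th0 th1 sth.
have [c [d [[c0 c1] [d0 d4] H]]] := @mean_log_growth _ f (1 + e) (1 + eps) z0 tf z01 fz0
  ltac:(clear -e0; lra) ltac:(rewrite /e; clear -eps0; lra).
have [C C0 CP] := H p p1.
have [K K1 KP] := sigma_growth tf sE s0 e0.
have [K' [d' [K'1 d'0 K'P]]] := majorant_on_larger_disc tf hq c0 c1.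
have K'0 : 0 < K' by clear -K'1; lra.
exists (C * (K * K' `^ th)).
  by rewrite mulr_gt0 // mulr_gt0 ?powR_gt0 //; clear -K1; lra.
apply/near_left1; exists (Num.min d d'); first by rewrite lt_min d0.
move=> r rd r1.
have rd1 : 1 - d <= r.
  have : Num.min d d' <= d by rewrite ge_min lexx.
  by clear -rd; lra.
have rd2 : 1 - d' < r.
  have : Num.min d d' <= d' by rewrite ge_min lexx orbT.
  by clear -rd; lra.
have r0 : 0 < r by clear -rd1 d4; lra.
have dr : 0 < 1 - r by rewrite subr_gt0.
have lr0 : 0 <= lam r by apply/ltW/lam0; rewrite (ltW r0).
have X1 : 1 <= (1 - r) `^ (- lam r) by apply: powRN_ge1 => //; clear -r0; lra.
pose U := K' * (1 - r) `^ (- lam r).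
have U1 : 1 <= U by rewrite -[leLHS]mulr1; apply: ler_pM.
have Uth : 1 <= U `^ th by exact: powR_ge1.
have Q1 : 1 <= K * U `^ th by rewrite -[leLHS]mulr1; apply: ler_pM.
have cr : 0 < c * (1 - r) by rewrite mulr_gt0.
apply: le_trans (CP r (K * U `^ th) rd1 r1 Q1 _) _.
  move=> z zr; have z1 : normc z < 1 by clear -zr cr; lra.
  apply: (@interpolated_bound f sigma e) => //; first by clear -U1; lra.
  - by apply: K'P.
  - exact: KP.
rewrite lee_fin le_eqVlt; apply/orP; left; apply/eqP.
rewrite /U powRM ?powR_ge0 ?(ltW K'0) // -powRrM -powRN !mulrA -[LHS]mulrA; congr (_ * _).
rewrite -powRD; last by apply/implyP => _; rewrite gt_eqF.
by congr (_ `^ _); ring.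
Qed.

End main_estimates.

(** * The estimate on a set of upper density one *)

Section density.
Context {R : realType}.
Implicit Types (f : R[i] -> R[i]) (z w : R[i]) (r s t : R).
Local Notation mu := (@lebesgue_measure R).

Lemma small_radius (tau c d : R) (n : nat) : 0 < tau -> tau < 1 -> 0 < c -> 0 < d ->
  exists2 b : R, 0 < b & forall x, 0 < x -> x < b ->
    [/\ x `^ tau <= d, x `^ tau <= n.+2%:R^-1, x `^ (1 - tau) <= c / n.+2%:R & x < 1 / 2].
Proof.
move=> tau0 tau1 c0 d0.
have small a y : 0 < a -> 0 < y -> forall x, 0 < x -> x < y `^ a^-1 -> x `^ a <= y.
  move=> a0 y0 x x0 xy; apply: (@le_trans _ _ ((y `^ a^-1) `^ a)).
    by apply: ge0_ler_powR; rewrite ?nnegrE ?powR_ge0 // ltW.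
  by rewrite -powRrM mulVf ?gt_eqF // powRr1 // ltW.
have n0 : 0 < n.+2%:R^-1 :> R by rewrite invr_gt0.
have c1 : 0 < c / n.+2%:R by rewrite divr_gt0.
have tau2 : 0 < 1 - tau by rewrite subr_gt0.
exists (Num.min (Num.min (d `^ tau^-1) (n.+2%:R^-1 `^ tau^-1))
   (Num.min ((c / n.+2%:R) `^ (1 - tau)^-1) (1 / 2))).
  by rewrite !lt_min !powR_gt0 // divr_gt0.
move=> x x0; rewrite !lt_min => /andP[/andP[x1 x2] /andP[x3 x4]].
by split=> //; apply: small.
Qed.

Lemma upper_density_le1 (E : set R) : measurable E -> (upper_density E <= 1)%E.
Proof.
move=> mE; apply: (@limf_esup_le _ _ _ 1) => // r _ r1.
have mI : measurable (`[r, 1%R[%classic : set R) by exact: measurable_itv.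
have le : (mu (E `&` `[r, 1%R[%classic) <= (1 - r)%:E)%E.
  apply: (@le_trans _ _ (mu (`[r, 1%R[%classic))).
    by apply: le_measure => //; rewrite inE //; exact: measurableI.
  by rewrite lebesgue_measure_itv /= lte_fin r1 -EFinB.
have d0 : 0 < 1 - r by rewrite subr_gt0.
apply: le_trans (lee_wpmul2r _ le) _; first by rewrite lee_fin invr_ge0 ltW.
by rewrite -EFinM divff // gt_eqF.
Qed.

(** The intervals accumulate at 1, and each of them fills all of [[s n, 1[] but
    a proportion of at most [1 / (n + 2)]. *)
Lemma upper_density_bigcup (s t : nat -> R) :
  (forall n, [/\ 1 - s n <= n.+2%:R^-1, s n < 1, t n < 1 &
     1 - t n <= (1 - s n) / n.+2%:R]) ->
  upper_density (\bigcup_n `[s n, t n]%classic) = 1%E.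
Proof.
move=> st; set E := \bigcup_n _.
have mE : measurable E by apply: bigcup_measurable => n _; exact: measurable_itv.
apply/eqP; rewrite eq_le upper_density_le1 //=.
apply: limf_esup_ge => d e d0 e0.
pose n := Num.truncn (Num.min d e)^-1.
have m0 : 0 < Num.min d e by rewrite lt_min d0.
have nde : n.+2%:R^-1 < Num.min d e.
  rewrite invf_plt ?posrE //; apply: lt_trans (Num.Theory.truncnS_gt _) _.
  by rewrite ltr_nat.
move: nde; rewrite lt_min => /andP[nd ne].
have [s1 s2 t1 ts] := st n.
have ds : 0 < 1 - s n by rewrite subr_gt0.
exists (s n); split => //; first by have := le_lt_trans s1 nd; clear; lra.
have mI : measurable (`[s n, t n]%classic : set R) by exact: measurable_itv.
have tn : (1 - s n) / n.+2%:R <= (1 - s n) / 2.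
  by rewrite ler_pM2l // lef_pV2 ?posrE // ler_nat.
have st_lt : s n < t n by have := le_trans ts tn; clear -ds; lra.
have le : ((t n - s n)%:E <= mu (E `&` `[s n, 1%R[%classic))%E.
  apply: (@le_trans _ _ (mu `[s n, t n]%classic)).
    by rewrite lebesgue_measure_itv /= lte_fin st_lt -EFinB.
  apply: le_measure; rewrite ?inE //.
    by apply: measurableI => //; exact: measurable_itv.
  move=> x sx; split; first by exists n.
  by move: sx; rewrite /= !in_itv /= => /andP[-> /le_lt_trans]; apply.
apply: le_trans (lee_wpmul2r _ le); last by rewrite lee_fin invr_ge0 ltW.
rewrite -EFinM lee_fin ler_pdivlMr //.
have h : (1 - s n) / n.+2%:R <= (1 - s n) * e by rewrite ler_pM2l // ltW.
by have := le_trans ts h; clear; lra.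
Qed.

(** At the radius [rho n], taken from the definition of the lower order, the
    logarithm of the maximum modulus is at most [(1 - rho n)^-(l + eta/2)].  For
    [r <= t n] the disc on which a bound is needed lies inside [|z| <= rho n];
    for [r >= s n] the bound is at most [(1 - r)^-(l + eta)], since
    [tau (l + eta) = l + eta / 2]. *)
Lemma mean_log_density f (sigma l eps eta : R) :
  (forall z, normc z < 1 -> taylor2 f z) ->
  sigmaM f = sigma%:E -> lambdaM f = l%:E -> 0 <= l -> l < sigma ->
  0 < eps -> 0 < eta ->
  exists E : set R, [/\ measurable E, E `<=` `[0, 1[%classic, upper_density E = 1%E &
    forall p : R, 1 <= p -> exists2 C : R, 0 < C & forall r, E r ->
      (mean_log p r f <=
       (C / (1 - r) `^ ((l + eta) * pospart (1 - sigma^-1) + 1 + eps))%:E)%E].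
Proof.
move=> tf sE lE l0 ls eps0 eta0.
have s0 : 0 < sigma by exact: le_lt_trans ls.
have [z0 z01 fz0] : exists2 z0, normc z0 < 1 & f z0 != 0.
  by apply: nonvanishing_point; rewrite lE ?sE ?lee_fin ?lte_fin.
pose e := eps / 2.
have e0 : 0 < e by rewrite divr_gt0.
have [] := order_weight s0 (ltW e0); set th := pospart _ => th0 th1 sth.
have [c [d [[c0 c1] [d0 d4] H]]] := @mean_log_growth _ f (1 + e) (1 + eps) z0 tf z01 fz0
  ltac:(clear -e0; lra) ltac:(rewrite /e; clear -eps0; lra).
have [K K1 KP] := sigma_growth tf sE s0 e0.
have le0 : 0 < l + eta by clear -l0 eta0; lra.
have l'0 : 0 < l + eta / 2 by clear -l0 eta0; lra.
pose tau := (l + eta / 2) / (l + eta).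
have tau0 : 0 < tau by rewrite divr_gt0.
have tau1 : tau < 1 by rewrite ltr_pdivrMr // mul1r; clear -eta0; lra.
have /choice[rho rhoP] : forall n, exists x : R,
   [/\ x < 1, (1 - x) `^ tau <= d /\ (1 - x) `^ tau <= n.+2%:R^-1,
       (1 - x) `^ (1 - tau) <= c / n.+2%:R, 0 < x &
       order_quotient f x <= l + eta / 2].
  move=> n; have [b b0 bP] := small_radius n tau0 tau1 c0 d0.
  have [|x [x1 x2 x3]] := @limf_einf_lt _ (fun r => (order_quotient f r)%:E)
      (l + eta / 2)%:E _ b b0.
    by rewrite -/(lambdaM f) lE lte_fin ltrDl divr_gt0.
  have dx : 0 < 1 - x by rewrite subr_gt0.
  have [|b1 b2 b3 b4] := bP (1 - x) dx; first by clear -x1; lra.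
  exists x; split => //; first by clear -b4; lra.
  by rewrite -lee_fin ltW.
pose s n := 1 - (1 - rho n) `^ tau.
pose t n := 1 - (1 - rho n) / c.
have st n : [/\ 1 - s n <= n.+2%:R^-1, s n < 1, t n < 1 &
     1 - t n <= (1 - s n) / n.+2%:R].
  have [r1 [_ r3] r4 r5 _] := rhoP n.
  have dr : 0 < 1 - rho n by rewrite subr_gt0.
  have sE' : 1 - s n = (1 - rho n) `^ tau by rewrite /s; ring.
  have tE : 1 - t n = (1 - rho n) / c by rewrite /t; ring.
  split.
  - by rewrite sE'.
  - by rewrite /s ltrBlDr ltrDl powR_gt0.
  - by rewrite /t ltrBlDr ltrDl divr_gt0.
  rewrite sE' tE ler_pdivrMr //.
  apply: (@le_trans _ _ ((1 - rho n) `^ tau * (1 - rho n) `^ (1 - tau))).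
    rewrite -powRD; last by apply/implyP => _; rewrite gt_eqF.
    by rewrite (_ : tau + (1 - tau) = 1) ?powRr1 ?(ltW dr) //; ring.
  by rewrite -mulrA ler_pM2l ?powR_gt0 // mulrC.
exists (\bigcup_n `[s n, t n]%classic); split.
- by apply: bigcup_measurable => n _; exact: measurable_itv.
- move=> r [n _]; rewrite /= !in_itv /= => /andP[sr rt].
  have [_ _ t1 _] := st n; have [_ [r2 _] _ _ _] := rhoP n.
  rewrite (le_lt_trans rt t1) andbT.
  by move: sr; rewrite /s; clear -r2 d4; lra.
- exact: upper_density_bigcup.
move=> p p1; have [C C0 CP] := H p p1.
exists (C * K); first by rewrite mulr_gt0 //; clear -K1; lra.
move=> r [n _]; rewrite /= in_itv /= => /andP[sr rt].
have [_ s1 t1 _] := st n.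
have [r1 [r2 _] _ r0 oq] := rhoP n.
have dr : 0 < 1 - rho n by rewrite subr_gt0.
have rd : 1 - d <= r by move: sr; rewrite /s; clear -r2; lra.
have r_lt1 : r < 1 by exact: le_lt_trans t1.
have d1 : 0 < 1 - r by rewrite subr_gt0.
have d1' : 1 - r <= 1 by clear -rd d4; lra.
pose U := (1 - r) `^ (- (l + eta)).
have U1 : 1 <= U by apply: powRN_ge1 => //; exact: ltW.
have Uth : 1 <= U `^ th by exact: powR_ge1.
have Q1 : 1 <= K * U `^ th by rewrite -[leLHS]mulr1; apply: ler_pM.
have cr : 0 < c * (1 - r) by rewrite mulr_gt0.
apply: le_trans (CP r (K * U `^ th) rd r_lt1 Q1 _) _.
  move=> z zr; have z1 : normc z < 1 by clear -zr cr; lra.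
  apply: (@interpolated_bound _ f sigma e) => //; last exact: KP.
    by clear -U1; lra.
  have zrho : normc z <= rho n.
    apply: le_trans zr _; rewrite lerBlDr -lerBlDl -ler_pdivrMl // mulrC.
    by move: rt; rewrite /t; clear; lra.
  apply: le_trans (normc_le_max_modulus_disc tf r1 zrho) _.
  apply: le_trans (le_expR_logp _) _; rewrite ler_expR.
  apply: le_trans (order_quotient_bound (ltW l'0) r0 r1 oq) _.
  have -> : - (l + eta / 2) = tau * - (l + eta).
    by rewrite /tau mulrN divfK // gt_eqF.
  rewrite powRrM; apply: ler_powRN => //; first exact: ltW.
  by move: sr; rewrite /s; clear; lra.
rewrite lee_fin le_eqVlt; apply/orP; left; apply/eqP.
rewrite /U -powRrM -powRN !mulrA -[LHS]mulrA; congr (_ * _).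
rewrite -powRD; last by apply/implyP => _; rewrite gt_eqF.
by congr (_ `^ _); ring.
Qed.

End density.

Theorem theorem2 (R : realType) (f : R[i] -> R[i]) (kappa : R) (lam : R -> R)
    (hf : analytic_on unit_disc f)
    (hlam : generalized_proximate_order f kappa lam)
    (horders :
      (1 < lambdaM f /\ lambdaM f < sigmaM f /\ sigmaM f < +oo)%E \/
      (0 <= lambdaM f /\ lambdaM f < sigmaM f /\ sigmaM f <= 1)%E) :
  (forall p eps : R, 1 <= p -> 0 < eps ->
     exists2 C : R, 0 < C &
       \forall r \near 1^'-,
         (mean_log p r f <=
          (C / (1 - r) `^ (lam r * pospart (1 - (fine (sigmaM f))^-1)
                           + 1 + eps))%:E)%E) /\
  (forall eps eta : R, 0 < eps -> 0 < eta ->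
     (eta%:E < sigmaM f - lambdaM f)%E ->
     exists E : set R,
       [/\ measurable E,
           E `<=` `[0, 1[,
           upper_density E = 1%E &
           forall p : R, 1 <= p ->
             exists2 C : R, 0 < C &
               forall r, E r ->
                 (mean_log p r f <=
                  (C / (1 - r) `^ ((fine (lambdaM f) + eta)
                                   * pospart (1 - (fine (sigmaM f))^-1)
                                   + 1 + eps))%:E)%E]).
Proof.
have [l0 ls ltoo] : [/\ (0 <= lambdaM f)%E, (lambdaM f < sigmaM f)%E &
    (sigmaM f < +oo)%E].
  case: horders => [[l1 [ls soo]]|[l0 [ls s1]]]; split=> //.
    exact: le_trans (ltW l1).
  by apply: le_lt_trans s1 _; rewrite ltry.
have sfin : sigmaM f \is a fin_num.
  by rewrite ge0_fin_numE // (le_trans l0) // ltW.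
have lfin : lambdaM f \is a fin_num.
  by rewrite ge0_fin_numE // (lt_trans ls).
have tf z : normc z < 1 -> taylor2 f z by exact: analytic_taylor2.
have sE : sigmaM f = (fine (sigmaM f))%:E by rewrite fineK.
have lE : lambdaM f = (fine (lambdaM f))%:E by rewrite fineK.
have lr0 : 0 <= fine (lambdaM f) by rewrite -lee_fin -lE.
have lsr : fine (lambdaM f) < fine (sigmaM f) by rewrite -lte_fin -lE -sE.
have [hq _] := hlam.
split=> [p eps p1 eps0|eps eta eps0 eta0 _].
  by apply: mean_log_pointwise => //; [exact: hq|exact: le_lt_trans lsr].
exact: (mean_log_density tf sE lE lr0 lsr eps0 eta0).
Qed.
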